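(* Let $(\bar m_p,\bar m_\theta)\in\mathcal M_{ad}$ be fixed. Let $(\boldsymbol u,p,\theta)$ be the corresponding continuous state, $(\boldsymbol w,r,\phi)$ the continuous adjoint, $(\boldsymbol u_h,p_h,\theta_h)$ the fully discrete state, and $(\boldsymbol w_h,r_h,\phi_h)$ the corresponding discrete adjoint generated by the same controls. Assume that for some $0<s\le1$ $$r,\phi\in H^1(0,T;H^{1+s}(\Omega)),\qquad\boldsymbol w\in H^1(0,T;\boldsymbol H^{1+s}(\Omega)).$$ Then, with $C>0$ independent of $h$ and $\Delta t$, \begin{multline*} \|r_h-r\|_{L^2(0,T;L^2(\Omega))}+\|\phi_h-\phi\|_{L^2(0,T;L^2(\Omega))}\\ \le C\bigl(h^s+\Delta t+\|\boldsymbol u_h-\boldsymbol u\|_{L^2(0,T;L^2(\Omega))}+\|p_h-p\|_{L^2(0,T;L^2(\Omega))}+\|\theta_h-\theta\|_{L^2(0,T;L^2(\Omega))}\bigr). \end{multline*} Consequently, if $\|\boldsymbol u_h-\boldsymbol u\|_{L^2(0,T;L^2(\Omega))}+\|p_h-p\|_{L^2(0,T;L^2(\Omega))}+\|\theta_h-\theta\|_{L^2(0,T;L^2(\Omega))}\le C(h^s+\Delta t)$, then $$\|r_h-r\|_{L^2(0,T;L^2(\Omega))}+\|\phi_h-\phi\|_{L^2(0,T;L^2(\Omega))}\le C(h^s+\Delta t).$$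
   Context: Setting. $\Omega\subset\mathbb R^d$, $d\in\{2,3\}$, is a bounded domain with Lipschitz polygonal/polyhedral boundary, with three independent disjoint partitions $\partial\Omega=\Gamma_p\cup\Gamma_f=\Gamma_d\cup\Gamma_t=\Gamma_\theta\cup\Gamma_{\theta,f}$ with $|\Gamma_p|,|\Gamma_d|,|\Gamma_t|,|\Gamma_\theta|>0$; $T>0$. Spaces (with $H^1$ norms): $\boldsymbol V=\{\boldsymbol v\in H^1(\Omega;\mathbb R^d):\boldsymbol v|_{\Gamma_d}=0\}$, $Q=\{q\in H^1(\Omega):q|_{\Gamma_p}=0\}$, $\Psi=\{\psi\in H^1(\Omega):\psi|_{\Gamma_\theta}=0\}$. $(\cdot,\cdot)_D$ is the $L^2(D)$ inner product; a dot is the time derivative. $a_{\boldsymbol u}(\boldsymbol v,\boldsymbol w)=(\boldsymbol{\mathcal C}\epsilon(\boldsymbol v),\epsilon(\boldsymbol w))_\Omega$ with $\epsilon(\boldsymbol v)=\frac12(\nabla\boldsymbol v+(\nabla\boldsymbol v)^T)$ and elastic stiffness tensor $\boldsymbol{\mathcal C}$ (so $a_{\boldsymbol u}$ is symmetric, bounded, coercive on $\boldsymbol V$); $b_p(q,\boldsymbol v)=-\alpha_p(q,\operatorname{div}\boldsymbol v)_\Omega$, $b_\theta(\psi,\boldsymbol v)=-\alpha_\theta(\psi,\operatorname{div}\boldsymbol v)_\Omega$, constants $\alpha_p,\alpha_\theta>0$; $a_p(q,r)=(\kappa_p\nabla q,\nabla r)_\Omega$, $a_\theta(\psi,\zeta)=(\kappa_\theta\nabla\psi,\nabla\zeta)_\Omega$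 with constant symmetric positive definite $\kappa_p,\kappa_\theta$. $\boldsymbol S=\begin{pmatrix}s_{pp}&s_{p\theta}\\ s_{\theta p}&s_{\theta\theta}\end{pmatrix}$ is symmetric positive semidefinite with $\alpha_\theta^2 s_{pp}-2\alpha_p\alpha_\theta s_{p\theta}+\alpha_p^2 s_{\theta\theta}\ge C_s>0$. $\operatorname{div}:\boldsymbol V\to L^2(\Omega)$ is surjective (as $|\Gamma_d|,|\Gamma_t|>0$). Fixed data: $\boldsymbol f\in L^2(0,T;\boldsymbol L^2(\Omega))$, initial data $(\boldsymbol u(0),p(0),\theta(0))\in\boldsymbol V\times Q\times\Psi$, targets $\boldsymbol u_C\in L^2(0,T;\boldsymbol L^2(\Omega))$, $p_C,\theta_C\in L^2(0,T;L^2(\Omega))$, weights $\alpha_{\boldsymbol u,C},\alpha_{p,C},\alpha_{\theta,C}\ge0$ with positive sum. $\mathcal M_{ad}=\mathcal M_{ad}^p\times\mathcal M_{ad}^\theta$ with $\mathcal M_{ad}^p=\{m_p\in L^2(0,T;L^2(\Omega)):m_{p,a}\le m_p\le m_{p,b}\text{ a.e.}\}$, $\mathcal M_{ad}^\theta=\{m_\theta\in L^2(0,T;L^2(\Omega)):m_{\theta,a}\le m_\theta\le m_{\theta,b}\text{ a.e.}\}$, real constants $m_{p,a}<m_{p,b}$, $m_{\theta,a}<m_{\theta,b}$. Continuous state for controls $(m_p,m_\theta)$: for a.e. $t$, all $(\boldsymbol v,q,\psi)\in\boldsymbol V\times Q\times\Psi$: $a_{\boldsymbol u}(\dot{\boldsymbol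 u},\boldsymbol v)+b_p(\dot p,\boldsymbol v)+b_\theta(\dot\theta,\boldsymbol v)=(\boldsymbol f,\boldsymbol v)_\Omega$; $b_p(q,\dot{\boldsymbol u})-(s_{pp}\dot p,q)_\Omega-(s_{p\theta}\dot\theta,q)_\Omega-a_p(p,q)=(m_p,q)_\Omega$; $b_\theta(\psi,\dot{\boldsymbol u})-(s_{\theta p}\dot p,\psi)_\Omega-(s_{\theta\theta}\dot\theta,\psi)_\Omega-a_\theta(\theta,\psi)=(m_\theta,\psi)_\Omega$, with the given initial data. Continuous adjoint $(\boldsymbol w,r,\phi)$: $-a_{\boldsymbol u}(\dot{\boldsymbol w},\boldsymbol v)-b_p(\dot r,\boldsymbol v)-b_\theta(\dot\phi,\boldsymbol v)=\alpha_{\boldsymbol u,C}(\boldsymbol u-\boldsymbol u_C,\boldsymbol v)_\Omega$; $-b_p(q,\dot{\boldsymbol w})+(s_{pp}\dot r,q)_\Omega+(s_{p\theta}\dot\phi,q)_\Omega-a_p(r,q)=\alpha_{p,C}(p-p_C,q)_\Omega$; $-b_\theta(\psi,\dot{\boldsymbol w})+(s_{\theta p}\dot r,\psi)_\Omega+(s_{\theta\theta}\dot\phi,\psi)_\Omega-a_\theta(\phi,\psi)=\alpha_{\theta,C}(\theta-\theta_C,\psi)_\Omega$, with $\boldsymbol w(T)=0$, $r(T)=0$, $\phi(T)=0$. Discretization. $\{\mathcal T_h\}$ is a shape-regular family of simplicial partitions of $\overline\Omega$ with mesh size $h$; $\boldsymbol V_h\times Q_h\times\Psi_h\subset\boldsymbol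 V\times Q\times\Psi$ are continuous piecewise polynomial spaces satisfying, with $C$ independent of $h$, $\|\chi_h\|_{L^2(\Omega)}\le C\sup_{0\neq\boldsymbol v_h\in\boldsymbol V_h}|(\chi_h,\operatorname{div}\boldsymbol v_h)_\Omega|/\|\boldsymbol v_h\|_{\boldsymbol V}$ for all $\chi_h\in\alpha_pQ_h+\alpha_\theta\Psi_h$, and such that the elliptic (i.e. $a_{\boldsymbol u}$-, $a_p$-, $a_\theta$-orthogonal) projections onto $\boldsymbol V_h,Q_h,\Psi_h$ have energy-norm error at most $Ch^s\|\cdot\|_{H^{1+s}(\Omega)}$, $0\le s\le1$. $\Delta t=T/N$, $t_k=k\Delta t$, $I_k=(t_k,t_{k+1}]$, $d_t\varphi^{k+1}=(\varphi^{k+1}-\varphi^k)/\Delta t$. Fully discrete state: from given numerical initial data $(\boldsymbol u_h^0,p_h^0,\theta_h^0)\in\boldsymbol V_h\times Q_h\times\Psi_h$ satisfying $\|\boldsymbol u(0)-\boldsymbol u_h^0\|_{H^1}+\|p(0)-p_h^0\|_{H^1}+\|\theta(0)-\theta_h^0\|_{H^1}\le Ch^s(\|\boldsymbol u(0)\|_{H^{1+s}}+\|p(0)\|_{H^{1+s}}+\|\theta(0)\|_{H^{1+s}})$, for $k=0,\dots,N-1$, \begin{align*} a_{\boldsymbol u}(d_t\boldsymbol u_h^{k+1},\boldsymbol v)+b_p(d_tp_h^{k+1},\boldsymbol v)+b_\theta(d_t\theta_h^{k+1},\boldsymbol v)&=\tfrac1{\Delta t}(\boldsymbol f,\boldsymbol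 v)_{I_k\times\Omega},\\ b_p(q,d_t\boldsymbol u_h^{k+1})-(s_{pp}d_tp_h^{k+1},q)_\Omega-(s_{p\theta}d_t\theta_h^{k+1},q)_\Omega-a_p(p_h^{k+1},q)&=\tfrac1{\Delta t}(m_p,q)_{I_k\times\Omega},\\ b_\theta(\psi,d_t\boldsymbol u_h^{k+1})-(s_{\theta p}d_tp_h^{k+1},\psi)_\Omega-(s_{\theta\theta}d_t\theta_h^{k+1},\psi)_\Omega-a_\theta(\theta_h^{k+1},\psi)&=\tfrac1{\Delta t}(m_\theta,\psi)_{I_k\times\Omega} \end{align*} for all $(\boldsymbol v,q,\psi)\in\boldsymbol V_h\times Q_h\times\Psi_h$; as functions of time $(\boldsymbol u_h,p_h,\theta_h)|_{I_k}=(\boldsymbol u_h^{k+1},p_h^{k+1},\theta_h^{k+1})$. Discrete adjoint: $\boldsymbol w_h^N=0$, $r_h^N=0$, $\phi_h^N=0$ and, for $k=N-1,\dots,0$, \begin{align*} -a_{\boldsymbol u}(d_t\boldsymbol w_h^{k+1},\boldsymbol v)-b_p(d_tr_h^{k+1},\boldsymbol v)-b_\theta(d_t\phi_h^{k+1},\boldsymbol v)&=\tfrac{\alpha_{\boldsymbol u,C}}{\Delta t}(\boldsymbol u_h^{k+1}-\boldsymbol u_C,\boldsymbol v)_{I_k\times\Omega},\\ -b_p(q,d_t\boldsymbol w_h^{k+1})+(s_{pp}d_tr_h^{k+1},q)_\Omega+(s_{p\theta}d_t\phi_h^{k+1},q)_\Omega-a_p(r_h^k,q)&=\tfrac{\alpha_{p,C}}{\Delta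 t}(p_h^{k+1}-p_C,q)_{I_k\times\Omega},\\ -b_\theta(\psi,d_t\boldsymbol w_h^{k+1})+(s_{\theta p}d_tr_h^{k+1},\psi)_\Omega+(s_{\theta\theta}d_t\phi_h^{k+1},\psi)_\Omega-a_\theta(\phi_h^k,\psi)&=\tfrac{\alpha_{\theta,C}}{\Delta t}(\theta_h^{k+1}-\theta_C,\psi)_{I_k\times\Omega} \end{align*} for all discrete test functions; as functions of time $(\boldsymbol w_h,r_h,\phi_h)|_{I_k}=(\boldsymbol w_h^k,r_h^k,\phi_h^k)$. $C$ denotes generic positive constants independent of $h,\Delta t$, which may depend on the norms of $\boldsymbol w,r,\phi$ in the assumed regularity classes. *)

(* Defs.v *)
From HB Require Import structures.
From mathcomp Require Import all_boot all_order all_algebra.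
From mathcomp Require Import all_classical all_reals all_analysis measurable_realfun.
Set Implicit Arguments.
Unset Strict Implicit.
Unset Printing Implicit Defensive.
Import Order.TTheory GRing.Theory Num.Theory.
Import numFieldNormedType.Exports.
Local Open Scope classical_set_scope.
Local Open Scope ring_scope.

(* The Borel sigma-algebra of R^n, generated by the coordinates. *)
Fact rv_display : measure_display. Proof. exact: default_measure_display. Qed.

Section borel_rV.
Variables (R : realType) (n : nat).
Definition rV_coord (i : 'I_n) (x : 'rV[R]_n) : measurableTypeR R := x ord0 i.

Let rV_set0 : g_sigma_preimage rV_coord set0.
Proof. exact: sigma_algebra0. Qed.
Let rV_setC A : g_sigma_preimage rV_coord A -> g_sigma_preimage rV_coord (~` A).
Proof. exact: sigma_algebraC. Qed.
Let rV_bigcup (F : _^nat) : (forall i, g_sigma_preimage rV_coord (F i)) ->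
  g_sigma_preimage rV_coord (\bigcup_i (F i)).
Proof. exact: sigma_algebra_bigcup. Qed.

HB.instance Definition _ :=
  @isMeasurable.Build rv_display 'rV[R]_n (g_sigma_preimage rV_coord)
    rV_set0 rV_setC rV_bigcup.

Lemma measurable_rV_coord (i : 'I_n) :
  measurable_fun [set: 'rV[R]_n] (fun x : 'rV[R]_n => x ord0 i : R).
Proof.
move=> _ Y mY; rewrite setTI; apply: sub_sigma_algebra => /=.
rewrite -bigcup_seq/=; exists i => /=; first by rewrite mem_index_enum.
by exists Y => //; rewrite setTI.
Qed.

Lemma measurable_rV d1 (T1 : measurableType d1) (f : T1 -> 'rV[R]_n) :
  (forall i, measurable_fun [set: T1] (fun x => f x ord0 i : R)) ->
  measurable_fun [set: T1] f.
Proof.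
move=> mf _ A mA; rewrite setTI.
suff : g_sigma_preimage rV_coord `<=` [set B | measurable (f @^-1` B)] by exact.
apply: smallest_sub; first split.
- by rewrite /= preimage_set0; exact: measurable0.
- by move=> B mB; rewrite /= setTD preimage_setC; exact: measurableC.
- move=> F mF; rewrite /= preimage_bigcup; apply: bigcup_measurable => k _; exact: mF.
rewrite -bigcup_seq; apply: bigcup_sub => i _ _ [B mB <-].
rewrite /= setTI -comp_preimage -[X in measurable X]setTI.
exact: (mf i measurableT B mB).
Qed.

End borel_rV.

(* (y, x') |-> (y, x'_0, ..., x'_(n-1)) *)
Definition rcons0 (R : realType) (n : nat) (z : R * 'rV[R]_n) : 'rV[R]_n.+1 :=
  \row_(i < n.+1) oapp (z.2 ord0) z.1 (unlift ord0 i).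

Section lebesgue_step.
Variables (R : realType) (n : nat).
Variable mu : {sigma_finite_measure set 'rV[R]_n -> \bar R}.

Lemma measurable_rcons0 : measurable_fun setT (@rcons0 R n : measurableTypeR R * 'rV[R]_n -> 'rV[R]_n.+1).
Proof.
apply: measurable_rV => i; case: (unliftP ord0 i) => [j|] ->.
  rewrite (_ : (fun _ => _) = (fun z : R * 'rV[R]_n => z.2 ord0 j)).
    exact: measurableT_comp (measurable_rV_coord j) measurable_snd.
  by apply/funext => z; rewrite mxE liftK.
rewrite (_ : (fun _ => _) = fst); first exact: measurable_fst.
by apply/funext => z; rewrite mxE unlift_none.
Qed.

Definition lebS : set 'rV[R]_n.+1 -> \bar R := pushforward (lebesgue_measure \x mu)%E (@rcons0 R n).

Let lebS0 : lebS set0 = 0%E.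
Proof. by rewrite /lebS /pushforward preimage_set0 measure0. Qed.

Let lebS_ge0 A : (0 <= lebS A)%E.
Proof. by rewrite /lebS /pushforward; apply: integral_ge0 => x _; exact: measure_ge0. Qed.

Let lebS_sigma_additive : semi_sigma_additive lebS.
Proof.
have mr A : measurable A -> measurable (@rcons0 R n @^-1` A).
  by move=> mA; rewrite -[X in measurable X]setTI; exact: measurable_rcons0.
move=> F mF tF mUF; rewrite /lebS /pushforward preimage_bigcup.
apply: measure_semi_sigma_additive => //.
- by move=> k; exact: mr.
- apply/trivIsetP => /= i j _ _ ij; rewrite -preimage_setI.
  by move/trivIsetP : tF => /(_ _ _ _ _ ij) ->//; rewrite preimage_set0.
- by rewrite -preimage_bigcup; exact: mr.
Qed.

HB.instance Definition _ :=
  isMeasure.Build _ _ _ lebS lebS0 lebS_ge0 lebS_sigma_additive.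

Let lebS_sf : sigma_finite setT lebS.
Proof.
have [F FT Foo] : sigma_finite setT (lebesgue_measure \x mu)%E.
  have /sigma_finiteP[F [FT ndF Foo]] := sigma_finiteT (@lebesgue_measure R).
  have /sigma_finiteP[G [GT ndG Goo]] := sigma_finiteT mu.
  exists (fun k => F k `*` G k).
    rewrite -setXTT FT GT predeqE => -[x y]; split.
      move=> [/= [k _ Fkx] [l _ Gly]]; exists (maxn k l) => //; split.
      - by move: x Fkx; exact/subsetPset/ndF/leq_maxl.
      - by move: y Gly; exact/subsetPset/ndG/leq_maxr.
    by move=> [k _ []/= ? ?]; split; exists k.
  move=> k; have [? ?] := Foo k; have [? ?] := Goo k.
  split; first exact: measurableX.
  by rewrite product_measure1E// lte_mul_pinfty// ge0_fin_numE.
pose g (x : 'rV[R]_n.+1) : R * 'rV[R]_n := (x ord0 ord0, \row_j x ord0 (lift ord0 j)).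
have gK z : g (@rcons0 R n z) = z.
  case: z => a b; rewrite /g mxE unlift_none; congr (_, _).
  by apply/rowP => j; rewrite !mxE liftK.
have mg : measurable_fun setT g.
  apply/measurable_fun_pair; first exact: measurable_rV_coord.
  apply: measurable_rV => j.
  rewrite (_ : (fun _ => _) = (fun x : 'rV[R]_n.+1 => x ord0 (lift ord0 j))).
    exact: measurable_rV_coord.
  by apply/funext => x; rewrite mxE.
exists (fun k => g @^-1` F k).
  by rewrite -preimage_bigcup -FT preimage_setT.
move=> k; have [mF Fk] := Foo k; split.
  by rewrite -[X in measurable X]setTI; exact: mg.
rewrite /lebS /pushforward -comp_preimage.
by rewrite (_ : g \o @rcons0 R n = id)//; apply/funext => z; exact: gK.
Qed.

HB.instance Definition _ := Measure_isSigmaFinite.Build _ _ _ lebS lebS_sf.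

End lebesgue_step.

(* Lebesgue measure on R^n, as an iterated product measure. *)
Fixpoint leb (R : realType) (n : nat) : {sigma_finite_measure set 'rV[R]_n -> \bar R} :=
  match n with
  | 0 => \d_(0 : 'rV[R]_0)
  | m.+1 => lebS (leb R m)
  end.

(* d = n.+1 throughout, so that boundary charts are parametrized by R^n. *)

Section sobolev.
Variables (R : realType) (n : nat).
Local Notation rV := 'rV[R]_n.+1.
Local Notation dx := (leb R n.+1).

Definition scalar_fun := rV -> R.

(* A weakly differentiable function together with its gradient. *)
Definition jet := (scalar_fun * ('I_n.+1 -> scalar_fun))%type.
Definition vjet := 'I_n.+1 -> jet.

Definition enorm m (x : 'rV[R]_m) : R := Num.sqrt (\sum_i x ord0 i ^+ 2).

Definition partial (i : 'I_n.+1) (f : scalar_fun) : scalar_fun :=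
  fun x => 'D_(delta_mx ord0 i) f x.

Fixpoint Ck (k : nat) (f : scalar_fun) : Prop :=
  continuous f /\
  if k is k'.+1 then
    forall i, (forall x, derivable f x (delta_mx ord0 i)) /\ Ck k' (partial i f)
  else True.

Definition smooth (f : scalar_fun) : Prop := forall k, Ck k f.

Variable Om : set rV.

Definition boundary : set rV := closure Om `\` interior Om.

Definition ip (f g : scalar_fun) : R := \int[dx]_(x in Om) (f x * g x).

Definition L2sq (f : scalar_fun) : \bar R := (\int[dx]_(x in Om) ((f x) ^+ 2)%:E)%E.

Definition L2 (f : scalar_fun) : Prop := measurable_fun Om f /\ (L2sq f < +oo)%E.

Definition L2norm (f : scalar_fun) : R := Num.sqrt (fine (L2sq f)).

Definition test_function (phi : scalar_fun) : Prop :=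
  smooth phi /\
  exists K : set rV,
    [/\ compact K, K `<=` Om & forall x, ~ K x -> phi x = 0].

Definition weak_partial (i : 'I_n.+1) (f g : scalar_fun) : Prop :=
  forall phi, test_function phi -> ip f (partial i phi) = - ip g phi.

Definition H1 (j : jet) : Prop :=
  [/\ L2 j.1, forall i, L2 (j.2 i) & forall i, weak_partial i j.1 (j.2 i)].

Definition H1sq (j : jet) : \bar R := (L2sq j.1 + \sum_i L2sq (j.2 i))%E.

Definition H1norm (j : jet) : R := Num.sqrt (fine (H1sq j)).
Definition vH1norm (v : vjet) : R := Num.sqrt (fine (\sum_i H1sq (v i))%E).

(* Squared Sobolev-Slobodeckij seminorm of H^s(Om), 0 <= s <= 1 (Gagliardo
   double integral for 0 < s < 1); +oo outside H^s(Om). *)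
Definition gagliardo (s : R) (g : scalar_fun) : \bar R :=
  (\int[dx \x dx]_(z in Om `*` Om)
     ((g z.1 - g z.2) ^+ 2 / enorm (z.1 - z.2) `^ (n.+1%:R + 2 * s))%:E)%E.

Definition Hs_semi (s : R) (g : scalar_fun) : \bar R :=
  if s == 0 then 0%E else if s < 1 then gagliardo s g else
  ereal_inf [set (\sum_i L2sq (D i))%E | D in
    [set D : 'I_n.+1 -> scalar_fun | forall i, L2 (D i) /\ weak_partial i g (D i)]].

(* Squared norm of H^(1+s)(Om), 0 <= s <= 1. *)
Definition H1s_sq (s : R) (j : jet) : \bar R :=
  (H1sq j + \sum_i Hs_semi s (j.2 i))%E.

Definition H1s_norm (s : R) (j : jet) : \bar R := sqrte (H1s_sq s j).
Definition vH1s_norm (s : R) (v : vjet) : \bar R :=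
  sqrte (\sum_i H1s_sq s (v i))%E.

Definition jet_ae_eq (j k : jet) : Prop :=
  {ae dx, forall x, Om x -> j.1 x = k.1 x /\ forall i, j.2 i x = k.2 i x}.

(* Local description of Om as the region above a Lipschitz graph, in the
   orthonormal frame c_rot centred at c_pt; the graph variable is the first
   coordinate of the frame. *)
Record chart := Chart {
  c_pt : rV ;
  c_rot : 'M[R]_n.+1 ;
  c_fun : 'rV[R]_n -> R ;
  c_rad : R ;
  c_hgt : R }.

Definition chart_map (c : chart) (y : R) (x' : 'rV[R]_n) : rV :=
  c_pt c + rcons0 (y, x') *m c_rot c.

Definition is_chart (c : chart) : Prop :=
  [/\ c_rot c *m (c_rot c)^T = 1%:M,
      0 < c_rad c /\ 0 < c_hgt c,
      exists L : R, forall a b,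
        `|c_fun c a - c_fun c b| <= L * enorm (a - b),
      forall x', enorm x' < c_rad c -> `|c_fun c x'| < c_hgt c
    & forall x' y, enorm x' < c_rad c -> `|y| < c_hgt c ->
        (Om (chart_map c y x') <-> c_fun c x' < y)].

(* The part of G covered by the chart, seen in R^n. On it the surface measure
   has density sqrt (1 + |grad c_fun|^2), between two positive constants, with
   respect to Lebesgue measure: null sets and L^2-convergence to 0 on the
   boundary can be read chartwise. *)
Definition bd_patch (c : chart) (G : set rV) : set 'rV[R]_n :=
  [set x' | enorm x' < c_rad c /\ G (chart_map c (c_fun c x') x')].

Definition positive_area (G : set rV) : Prop :=
  exists2 c, is_chart c & (0 < leb R n (bd_patch c G))%E.

(* j has trace 0 on G: the trace is the continuous extension to H^1(Om) of the
   restriction to the boundary of functions smooth up to the boundary. *)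
Definition zero_trace (G : set rV) (j : jet) : Prop :=
  exists phi : nat -> scalar_fun,
    [/\ forall k, smooth (phi k),
        (fun k => H1sq (j - (phi k, fun i => partial i (phi k)))) @ \oo --> 0%E
      & forall c, is_chart c ->
        (fun k => (\int[leb R n]_(x' in bd_patch c G)
           ((phi k (chart_map c (c_fun c x') x')) ^+ 2)%:E)%E) @ \oo --> 0%E].

Definition H1_0 (G : set rV) : set jet := [set j | H1 j /\ zero_trace G j].
Definition vH1_0 (G : set rV) : set vjet := [set v | forall i, H1_0 G (v i)].

Definition divg (v : vjet) : scalar_fun := fun x => \sum_i (v i).2 i x.
Definition strain (v : vjet) (i j : 'I_n.+1) : scalar_fun :=
  fun x => 2^-1 * ((v i).2 j x + (v j).2 i x).

Definition vip (f g : 'I_n.+1 -> scalar_fun) : R :=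
  \int[dx]_(x in Om) (\sum_i f i x * g i x).

Definition vval (v : vjet) : 'I_n.+1 -> scalar_fun := fun i => (v i).1.

End sobolev.

Arguments enorm {R m}.

Section mesh.
Variables (R : realType) (n : nat).
Local Notation rV := 'rV[R]_n.+1.

(* The rows are the vertices. *)
Definition simplex := 'M[R]_(n.+2, n.+1).

Definition face (P : simplex) (a : pred 'I_n.+2) : set rV :=
  [set x | exists l : 'rV[R]_n.+2,
    [/\ forall i, 0 <= l ord0 i, \sum_i l ord0 i = 1,
        forall i, ~~ a i -> l ord0 i = 0 & x = l *m P]].

Definition hull (P : simplex) : set rV := face P predT.

Definition nondegenerate_simplex (P : simplex) : Prop :=
  \det (\matrix_(i < n.+1) (row (lift ord0 i) P - row ord0 P)) != 0.

Definition simplicial_partition (Om : set rV) (M : seq simplex) : Prop :=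
  [/\ forall P, P \in M -> nondegenerate_simplex P,
      \bigcup_(P in [set` M]) hull P = closure Om
    & forall P P', P \in M -> P' \in M -> P != P' ->
        hull P `&` hull P' =
        face P (fun i => [exists j, row j P' == row i P])].

Definition diam (A : set rV) : R :=
  sup [set enorm (z.1 - z.2) | z in A `*` A].

Definition mesh_size (M : seq simplex) : R :=
  \big[Num.max/0]_(P <- M) diam (hull P).

Definition shape_regular (rho : R) (M : seq simplex) : Prop :=
  forall P, P \in M -> exists c : rV,
    [set x | enorm (x - c) <= rho * diam (hull P)] `<=` hull P.

Definition poly_le (ell : nat) (f : rV -> R) (A : set rV) : Prop :=
  exists c : {ffun 'I_n.+1 -> 'I_ell.+1} -> R, forall x, A x ->
    f x = \sum_(a : {ffun 'I_n.+1 -> 'I_ell.+1} | (\sum_i a i <= ell)%N)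
            c a * \prod_i x ord0 i ^+ a i.

Definition cont_pw_poly (Om : set rV) (M : seq simplex) (ell : nat)
    (f : rV -> R) : Prop :=
  {within closure Om, continuous f} /\
  forall P, P \in M -> poly_le ell f (hull P).

(* Linear span of a finite list of continuous piecewise polynomial functions,
   contained in X. *)
Definition fe_space (Om : set rV) (M : seq simplex) (ell : nat)
    (X Xh : set (jet R n)) : Prop :=
  Xh `<=` X /\
  exists m (b : 'I_m -> jet R n),
    (forall j, cont_pw_poly Om M ell (b j).1) /\
    Xh = [set \sum_j c j *: b j | c in [set: 'I_m -> R]].

Definition vfe_space (Om : set rV) (M : seq simplex) (ell : nat)
    (X Xh : set (vjet R n)) : Prop :=
  Xh `<=` X /\
  exists m (b : 'I_m -> vjet R n),
    (forall j i, cont_pw_poly Om M ell (b j i).1) /\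
    Xh = [set \sum_j c j *: b j | c in [set: 'I_m -> R]].

End mesh.

Section bochner.
Variables (R : realType) (n : nat) (T : R) (Om : set 'rV[R]_n.+1).
Local Notation rV := 'rV[R]_n.+1.
Local Notation scalar_fun := (scalar_fun R n).
Local Notation jet := (jet R n).
Local Notation vjet := (vjet R n).
Local Notation dt := (@lebesgue_measure R).
Local Notation dtdx := (@lebesgue_measure R \x leb R n.+1)%E.

Definition QT : set (R * rV) := `[0, T]%classic `*` Om.

Definition meas_QT (f : R -> scalar_fun) : Prop :=
  measurable_fun (QT : set (measurableTypeR R * rV)) (fun z => f z.1 z.2).

(* L^2(0,T;L^2(Om)) *)
Definition L2L2 (f : R -> scalar_fun) : Prop :=
  meas_QT f /\ (\int[dtdx]_(z in QT) ((f z.1 z.2) ^+ 2)%:E < +oo)%E.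

Definition L2L2_dist (f g : R -> scalar_fun) : R :=
  Num.sqrt (\int[dtdx]_(z in QT) (f z.1 z.2 - g z.1 z.2) ^+ 2).

Definition vL2L2_dist (f g : R -> 'I_n.+1 -> scalar_fun) : R :=
  Num.sqrt (\int[dtdx]_(z in QT) \sum_i (f z.1 i z.2 - g z.1 i z.2) ^+ 2).

(* p is in L^2(0,T; X with the H^(1+s) norm); for these separable spaces strong
   measurability is joint measurability of the function and its gradient. *)
Definition L2_time (X : set jet) (s : R) (p : R -> jet) : Prop :=
  [/\ meas_QT (fun t => (p t).1), forall i, meas_QT (fun t => (p t).2 i),
      {ae dt, forall t, `[0, T]%classic t -> X (p t)},
      measurable_fun `[0, T]%classic (fun t => H1s_sq Om s (p t))
    & (\int[dt]_(t in `[0%R, T]) H1s_sq Om s (p t) < +oo)%E].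

(* df is the time derivative of f, and f is the representative continuous in
   time. *)
Definition time_deriv (f df : R -> scalar_fun) : Prop :=
  forall t, 0 <= t <= T ->
    {ae leb R n.+1, forall x, Om x ->
       f t x = f 0 x + \int[dt]_(tau in `[0, t]) df tau x}.

Definition jet_time_deriv (p dp : R -> jet) : Prop :=
  time_deriv (fun t => (p t).1) (fun t => (dp t).1) /\
  forall i, time_deriv (fun t => (p t).2 i) (fun t => (dp t).2 i).

(* H^1(0,T; X with the H^(1+s) norm), for X a closed subspace of H^1(Om) *)
Definition H1_time (X : set jet) (s : R) (p dp : R -> jet) : Prop :=
  [/\ L2_time X s p, L2_time X s dp, forall t, 0 <= t <= T -> X (p t)
    & jet_time_deriv p dp].

Definition vH1_time (X : set jet) (s : R) (v dv : R -> vjet) : Prop :=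
  forall i, H1_time X s (fun t => v t i) (fun t => dv t i).

End bochner.

Section model.
Variables (R : realType) (n : nat).
Local Notation rV := 'rV[R]_n.+1.
Local Notation scalar_fun := (scalar_fun R n).
Local Notation jet := (jet R n).
Local Notation vjet := (vjet R n).
Local Notation dt := (@lebesgue_measure R).
Local Notation dtdx := (@lebesgue_measure R \x leb R n.+1)%E.

Record geometry := Geometry {
  Om : set rV ;
  Gam_p : set rV ; Gam_f : set rV ;
  Gam_d : set rV ; Gam_t : set rV ;
  Gam_th : set rV ; Gam_thf : set rV }.

Definition bd_partition (O A B : set rV) : Prop :=
  [/\ measurable A, measurable B, A `|` B = boundary O & A `&` B = set0].

Definition geometry_ok (D : geometry) : Prop :=
  [/\ [/\ Om D !=set0, open (Om D), connected (Om D) & bounded_set (Om D)],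
      forall x, boundary (Om D) x -> exists2 c, is_chart (Om D) c & c_pt c = x,
      exists M, simplicial_partition (Om D) M,
      [/\ bd_partition (Om D) (Gam_p D) (Gam_f D),
          bd_partition (Om D) (Gam_d D) (Gam_t D)
        & bd_partition (Om D) (Gam_th D) (Gam_thf D)]
    & [/\ positive_area (Om D) (Gam_p D), positive_area (Om D) (Gam_d D),
          positive_area (Om D) (Gam_t D) & positive_area (Om D) (Gam_th D)]].

Definition spV (D : geometry) : set vjet := vH1_0 (Om D) (Gam_d D).
Definition spQ (D : geometry) : set jet := H1_0 (Om D) (Gam_p D).
Definition spPsi (D : geometry) : set jet := H1_0 (Om D) (Gam_th D).

Record coefficients := Coefficients {
  stiff : 'I_n.+1 -> 'I_n.+1 -> 'I_n.+1 -> 'I_n.+1 -> scalar_fun ;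
  al_p : R ; al_th : R ;
  kap_p : 'M[R]_n.+1 ; kap_th : 'M[R]_n.+1 ;
  s_pp : R ; s_pth : R ; s_thp : R ; s_thth : R }.

Section forms.
Variables (D : geometry) (c : coefficients).

Definition a_u (v w : vjet) : R :=
  \int[leb R n.+1]_(x in Om D)
    (\sum_i \sum_j \sum_k \sum_l
       stiff c i j k l x * strain v k l x * strain w i j x).

Definition b_p (q : scalar_fun) (v : vjet) : R := - al_p c * ip (Om D) q (divg v).
Definition b_th (q : scalar_fun) (v : vjet) : R := - al_th c * ip (Om D) q (divg v).

Definition a_kap (kap : 'M[R]_n.+1) (q r : jet) : R :=
  \int[leb R n.+1]_(x in Om D)
    (\sum_i (\sum_j kap i j * q.2 j x) * r.2 i x).

Definition a_p : jet -> jet -> R := a_kap (kap_p c).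
Definition a_th : jet -> jet -> R := a_kap (kap_th c).

Definition spd (kap : 'M[R]_n.+1) : Prop :=
  kap^T = kap /\
  forall x : rV, x != 0 -> 0 < (x *m kap *m x^T) ord0 ord0.

Definition coefficients_ok : Prop :=
  [/\ [/\ forall i j k l, measurable_fun (Om D) (stiff c i j k l),
          exists B : R, forall i j k l x, Om D x -> `|stiff c i j k l x| <= B,
          forall i j k l x, Om D x -> stiff c i j k l x = stiff c k l i j x,
          forall i j k l x, Om D x -> stiff c i j k l x = stiff c j i k l x
        & exists2 ca : R, 0 < ca &
            forall v, spV D v -> ca * vH1norm (Om D) v ^+ 2 <= a_u v v],
      0 < al_p c /\ 0 < al_th c,
      spd (kap_p c) /\ spd (kap_th c),
      [/\ s_thp c = s_pth c,
          forall a b, 0 <= s_pp c * a ^+ 2 + 2 * s_pth c * a * b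
                           + s_thth c * b ^+ 2
        & exists2 Cs : R, 0 < Cs &
            Cs <= al_th c ^+ 2 * s_pp c - 2 * al_p c * al_th c * s_pth c
                  + al_p c ^+ 2 * s_thth c]
    & forall g, L2 (Om D) g -> exists2 v, spV D v &
        {ae leb R n.+1, forall x, Om D x -> divg v x = g x}].

End forms.

Record problem_data := ProblemData {
  force : R -> 'I_n.+1 -> scalar_fun ;
  u_ini : vjet ; p_ini : jet ; th_ini : jet ;
  u_C : R -> 'I_n.+1 -> scalar_fun ; p_C : R -> scalar_fun ; th_C : R -> scalar_fun ;
  al_uC : R ; al_pC : R ; al_thC : R ;
  mp_a : R ; mp_b : R ; mth_a : R ; mth_b : R }.

Definition data_ok (D : geometry) (T : R) (dat : problem_data) : Prop :=
  [/\ forall i, L2L2 T (Om D) (fun t => force dat t i),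
      [/\ spV D (u_ini dat), spQ D (p_ini dat) & spPsi D (th_ini dat)],
      [/\ forall i, L2L2 T (Om D) (fun t => u_C dat t i),
          L2L2 T (Om D) (p_C dat) & L2L2 T (Om D) (th_C dat)],
      [/\ 0 <= al_uC dat, 0 <= al_pC dat, 0 <= al_thC dat
        & 0 < al_uC dat + al_pC dat + al_thC dat]
    & mp_a dat < mp_b dat /\ mth_a dat < mth_b dat].

Definition admissible (D : geometry) (T : R) (ma mb : R) (m : R -> scalar_fun) :=
  L2L2 T (Om D) m /\
  {ae dtdx, forall z : measurableTypeR R * rV, QT T (Om D) z ->
     ma <= m z.1 z.2 <= mb}.

Section continuous.
Variables (D : geometry) (c : coefficients) (T : R) (dat : problem_data).
Let O := Om D.

Definition aet (P : R -> Prop) : Prop :=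
  {ae dt, forall t, `[0, T]%classic t -> P t}.

(* The weak solution class: H^1(0,T;V) for the displacement, and
   L^2(0,T;Q) /\ H^1(0,T;L^2) for the two scalar fields. *)
Definition solution_class (u du : R -> vjet) (p : R -> jet) (dp : R -> scalar_fun)
    (th : R -> jet) (dth : R -> scalar_fun) : Prop :=
  [/\ vH1_time T O (H1_0 O (Gam_d D)) 0 u du,
      [/\ L2_time T O (spQ D) 0 p, L2L2 T O dp
        & time_deriv T O (fun t => (p t).1) dp]
    & [/\ L2_time T O (spPsi D) 0 th, L2L2 T O dth
        & time_deriv T O (fun t => (th t).1) dth]].

Definition is_state (mp mth : R -> scalar_fun) (u du : R -> vjet)
    (p : R -> jet) (dp : R -> scalar_fun) (th : R -> jet) (dth : R -> scalar_fun) : Prop :=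
  [/\ solution_class u du p dp th dth,
      aet (fun t => forall v, spV D v ->
        a_u D c (du t) v + b_p D c (dp t) v + b_th D c (dth t) v
        = vip O (force dat t) (vval v)),
      aet (fun t => forall q, spQ D q ->
        b_p D c q.1 (du t) - s_pp c * ip O (dp t) q.1
        - s_pth c * ip O (dth t) q.1 - a_p D c (p t) q
        = ip O (mp t) q.1),
      aet (fun t => forall q, spPsi D q ->
        b_th D c q.1 (du t) - s_thp c * ip O (dp t) q.1
        - s_thth c * ip O (dth t) q.1 - a_th D c (th t) q
        = ip O (mth t) q.1)
    & [/\ forall i, jet_ae_eq O (u 0 i) (u_ini dat i),
          jet_ae_eq O (p 0) (p_ini dat) & jet_ae_eq O (th 0) (th_ini dat)]].

Definition is_adjoint (u : R -> vjet) (p th : R -> jet) (w dw : R -> vjet)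
    (r : R -> jet) (dr : R -> scalar_fun) (ph : R -> jet) (dph : R -> scalar_fun) : Prop :=
  [/\ solution_class w dw r dr ph dph,
      aet (fun t => forall v, spV D v ->
        - a_u D c (dw t) v - b_p D c (dr t) v - b_th D c (dph t) v
        = al_uC dat * vip O (vval (u t) - u_C dat t) (vval v)),
      aet (fun t => forall q, spQ D q ->
        - b_p D c q.1 (dw t) + s_pp c * ip O (dr t) q.1
        + s_pth c * ip O (dph t) q.1 - a_p D c (r t) q
        = al_pC dat * ip O ((p t).1 - p_C dat t) q.1),
      aet (fun t => forall q, spPsi D q ->
        - b_th D c q.1 (dw t) + s_thp c * ip O (dr t) q.1
        + s_thth c * ip O (dph t) q.1 - a_th D c (ph t) q
        = al_thC dat * ip O ((th t).1 - th_C dat t) q.1)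
    & [/\ forall i, jet_ae_eq O (w T i) 0, jet_ae_eq O (r T) 0
        & jet_ae_eq O (ph T) 0]].

End continuous.

(* A family of meshes and finite element spaces, indexed by fam. *)
Record discretization := Discretization {
  fam : Type ;
  mesh : fam -> seq (simplex R n) ;
  Vh : fam -> set vjet ; Qh : fam -> set jet ; Psih : fam -> set jet }.

Definition hsz (H : discretization) (i : fam H) : R := mesh_size (mesh i).

Section discrete.
Variables (D : geometry) (c : coefficients) (H : discretization).
Let O := Om D.

Definition inf_sup : Prop :=
  exists2 C : R, 0 < C & forall (i : fam H) q psi, Qh i q -> Psih i psi ->
    let chi : scalar_fun := fun x => al_p c * q.1 x + al_th c * psi.1 x in
    L2norm O chi <=
      C * sup [set `|ip O chi (divg v)| / vH1norm O v | v in
                 [set v | Vh i v /\ vH1norm O v != 0]].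

(* Error of the elliptic projections, in the norm of the energy spaces V, Q and
   Psi. *)
Definition projection_estimates : Prop :=
  forall s : R, 0 <= s <= 1 -> exists2 C : R, 0 < C & forall i : fam H,
    [/\ forall v vh, spV D v -> Vh i vh ->
          (forall z, Vh i z -> a_u D c (v - vh) z = 0) ->
          ((vH1norm O (v - vh))%:E
             <= (C * hsz i `^ s)%:E * vH1s_norm O s v)%E,
        forall q qh, spQ D q -> Qh i qh ->
          (forall z, Qh i z -> a_p D c (q - qh) z = 0) ->
          ((H1norm O (q - qh))%:E
             <= (C * hsz i `^ s)%:E * H1s_norm O s q)%E
      & forall q qh, spPsi D q -> Psih i qh ->
          (forall z, Psih i z -> a_th D c (q - qh) z = 0) ->
          ((H1norm O (q - qh))%:E
             <= (C * hsz i `^ s)%:E * H1s_norm O s q)%E].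

Definition discretization_ok : Prop :=
  [/\ forall i : fam H, simplicial_partition O (mesh i),
      exists2 rho : R, 0 < rho & forall i : fam H, shape_regular rho (mesh i),
      exists ell : nat, forall i : fam H,
        [/\ vfe_space O (mesh i) ell (spV D) (Vh i),
            fe_space O (mesh i) ell (spQ D) (Qh i)
          & fe_space O (mesh i) ell (spPsi D) (Psih i)],
      inf_sup
    & projection_estimates].

Variables (T : R) (dat : problem_data) (i : fam H) (N : nat).

Definition tau : R := T / N%:R.
Definition Ik (k : nat) : set R := `]k%:R * tau, k.+1%:R * tau]%classic.

(* (f, g)_(I_k x Om) *)
Definition ipk (k : nat) (f : R -> scalar_fun) (g : scalar_fun) : R :=
  \int[dtdx]_(z in Ik k `*` O) (f z.1 z.2 * g z.2).
Definition vipk (k : nat) (f : R -> 'I_n.+1 -> scalar_fun) (g : 'I_n.+1 -> scalar_fun) : R :=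
  \int[dtdx]_(z in Ik k `*` O) (\sum_i f z.1 i z.2 * g i z.2).

Definition jdiff (q : nat -> jet) (k : nat) : jet := tau^-1 *: (q k.+1 - q k).
Definition vjdiff (v : nat -> vjet) (k : nat) : vjet := tau^-1 *: (v k.+1 - v k).

Definition in_spaces (u : nat -> vjet) (p th : nat -> jet) : Prop :=
  forall k, (k <= N)%N -> [/\ Vh i (u k), Qh i (p k) & Psih i (th k)].

(* s and Cini enter through the approximation of the initial data. *)
Definition is_discrete_state (s Cini : R) (mp mth : R -> scalar_fun)
    (u : nat -> vjet) (p th : nat -> jet) : Prop :=
  [/\ in_spaces u p th,
      ((vH1norm O (u_ini dat - u 0) + H1norm O (p_ini dat - p 0)
        + H1norm O (th_ini dat - th 0))%:E
       <= (Cini * hsz i `^ s)%:E *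
          (vH1s_norm O s (u_ini dat) + H1s_norm O s (p_ini dat)
           + H1s_norm O s (th_ini dat)))%E,
      forall k, (k < N)%N -> forall v, Vh i v ->
        a_u D c (vjdiff u k) v + b_p D c (jdiff p k).1 v
        + b_th D c (jdiff th k).1 v
        = tau^-1 * vipk k (force dat) (vval v),
      forall k, (k < N)%N -> forall q, Qh i q ->
        b_p D c q.1 (vjdiff u k) - s_pp c * ip O (jdiff p k).1 q.1
        - s_pth c * ip O (jdiff th k).1 q.1 - a_p D c (p k.+1) q
        = tau^-1 * ipk k mp q.1
    & forall k, (k < N)%N -> forall q, Psih i q ->
        b_th D c q.1 (vjdiff u k) - s_thp c * ip O (jdiff p k).1 q.1
        - s_thth c * ip O (jdiff th k).1 q.1 - a_th D c (th k.+1) q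
        = tau^-1 * ipk k mth q.1].

Definition is_discrete_adjoint (u : nat -> vjet) (p th : nat -> jet)
    (w : nat -> vjet) (r ph : nat -> jet) : Prop :=
  [/\ in_spaces w r ph,
      [/\ forall l, jet_ae_eq O (w N l) 0, jet_ae_eq O (r N) 0
        & jet_ae_eq O (ph N) 0],
      forall k, (k < N)%N -> forall v, Vh i v ->
        - a_u D c (vjdiff w k) v - b_p D c (jdiff r k).1 v
        - b_th D c (jdiff ph k).1 v
        = al_uC dat / tau * vipk k (fun t => vval (u k.+1) - u_C dat t) (vval v),
      forall k, (k < N)%N -> forall q, Qh i q ->
        - b_p D c q.1 (vjdiff w k) + s_pp c * ip O (jdiff r k).1 q.1
        + s_pth c * ip O (jdiff ph k).1 q.1 - a_p D c (r k) q
        = al_pC dat / tau * ipk k (fun t => (p k.+1).1 - p_C dat t) q.1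
    & forall k, (k < N)%N -> forall q, Psih i q ->
        - b_th D c q.1 (vjdiff w k) + s_thp c * ip O (jdiff r k).1 q.1
        + s_thth c * ip O (jdiff ph k).1 q.1 - a_th D c (ph k) q
        = al_thC dat / tau * ipk k (fun t => (th k.+1).1 - th_C dat t) q.1].

(* The function of time equal to a k on I_k, for k < N. *)
Definition pw_const (a : nat -> scalar_fun) : R -> scalar_fun :=
  fun t x => \sum_(k < N) \1_(Ik k) t * a k x.

Definition state_error (u : R -> vjet) (p th : R -> jet)
    (uh : nat -> vjet) (pd thd : nat -> jet) : R :=
  vL2L2_dist T O (fun t l => pw_const (fun k => (uh k.+1 l).1) t)
                 (fun t l => (u t l).1)
  + L2L2_dist T O (pw_const (fun k => (pd k.+1).1)) (fun t => (p t).1)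
  + L2L2_dist T O (pw_const (fun k => (thd k.+1).1)) (fun t => (th t).1).

Definition adjoint_error (r ph : R -> jet) (rh phh : nat -> jet) : R :=
  L2L2_dist T O (pw_const (fun k => (rh k).1)) (fun t => (r t).1)
  + L2L2_dist T O (pw_const (fun k => (phh k).1)) (fun t => (ph t).1).

End discrete.
End model.

(* Main.v *)
Require Import Defs.
From HB Require Import structures.
From mathcomp Require Import all_boot all_order all_algebra.
From mathcomp Require Import all_classical all_reals all_analysis measurable_realfun.
From mathcomp Require Import ring lra.
Set Implicit Arguments.
Unset Strict Implicit.
Unset Printing Implicit Defensive.
Import Order.TTheory GRing.Theory Num.Theory.
Import numFieldNormedType.Exports.
Local Open Scope classical_set_scope.
Local Open Scope ring_scope.

(** The estimate is an energy argument for the combined unknown z = (w, r, phi).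
    Let M collect the elastic form, the couplings and the storage form, and let K
    be the sum of the two diffusion forms. Subtracting the two scalar equations
    from the first one, the adjoint problem reads - M(z', y) + K(z, y) = load, and
    the scheme is its backward Euler discretization. In this combination the
    couplings are antisymmetric, so that M(x, x) is the elastic energy plus the
    storage form.

    Both solutions vanish at the final time. Integrating the error equation from
    the m-th knot to the final time therefore gives an equation for the error
    xi^m itself and for its integral S^m, instead of its difference quotients.
    Tested with xi^m, the diffusion term K(S^m, xi^m) telescopes, and M(xi^m,
    xi^m) bounds the error in L2 in time. The consistency error of the diffusion
    term is a sum tested with S^m - S^(m+1); after summation by parts each of its
    terms is paired with the bounded sequence S, which preserves first order in
    time for solutions with one time derivative ([implicit_euler_estimate]).

    M(x, x) controls the displacement and, up to the combination
    al_p r + al_th phi, the two scalar fields, the storage form being only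
    semi-definite. That combination is bounded by the inf-sup condition and the
    first equation, which is the error equation tested with displacements; there
    the diffusion term is absent ([stability]).

    The discrete solution is compared with elliptic projections
    ([elliptic_projection]) of z at a time of each interval where its H^(1+s) norm
    does not exceed its mean by much ([good_times]). The sum over the intervals is
    then of order h^s by the square integrability in time of this norm. Two times
    of an interval differ in H1 by at most the square root of tau times the
    integral of |z'|^2 over the interval, which is of order tau after summation
    ([increment_nsq]).

    All forms are sums of scalar products of values and derivatives against fixed
    square integrable functions. Hence they commute with integration in time by
    Fubini's theorem, which turns the equations, valid at almost every time, into
    equations on the intervals of the grid ([interval_equation]). *)

(** * Semi-inner products and projections onto finite spans *)

Section semi_inner_product.
Variables (R : realType) (E : lmodType R).
Implicit Types (X : set E) (f : E -> R) (B : E -> E -> R).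

Definition subspace X := X 0 /\ forall a x y, X x -> X y -> X (a *: x + y).

(** Integrals are additive on integrable functions only, so the forms below are
    linear on a subspace, not on the whole type. *)
Definition linear_on X f :=
  forall a x y, X x -> X y -> f (a *: x + y) = a * f x + f y.

Definition semi_inner X B :=
  [/\ forall y, X y -> linear_on X (B ^~ y),
      forall x y, X x -> X y -> B x y = B y x
    & forall x, X x -> 0 <= B x x].

Section linear_on_theory.
Variables (X : set E) (f : E -> R).
Hypotheses (Xs : subspace X) (fl : linear_on X f).

Lemma subspaceD x y : X x -> X y -> X (x + y).
Proof. by move=> Xx Xy; rewrite -[x]scale1r; apply: Xs.2. Qed.

Lemma subspaceZ a x : X x -> X (a *: x).
Proof. by move=> Xx; rewrite -[_ *: _]addr0; apply: Xs.2 => //; exact: Xs.1. Qed.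

Lemma subspaceB x y : X x -> X y -> X (x - y).
Proof. by move=> Xx Xy; rewrite -scaleN1r addrC; apply: Xs.2. Qed.

Lemma subspace_sum (I : Type) (l : seq I) (P : pred I) (F : I -> E) :
  (forall i, P i -> X (F i)) -> X (\sum_(i <- l | P i) F i).
Proof. by move=> XF; apply: (big_ind X) => //; [exact: Xs.1|exact: subspaceD]. Qed.

Lemma linear_on0 : f 0 = 0.
Proof.
by have := fl (-1) Xs.1 Xs.1; rewrite scaler0 addr0 mulN1r addNr.
Qed.

Lemma linear_onD x y : X x -> X y -> f (x + y) = f x + f y.
Proof. by move=> Xx Xy; rewrite -[x in LHS]scale1r fl// mul1r. Qed.

Lemma linear_onZ a x : X x -> f (a *: x) = a * f x.
Proof. by move=> Xx; rewrite -[_ *: _]addr0 fl ?linear_on0 ?addr0//; exact: Xs.1. Qed.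

Lemma linear_onB x y : X x -> X y -> f (x - y) = f x - f y.
Proof. by move=> Xx Xy; rewrite -scaleN1r addrC fl// mulN1r addrC. Qed.

End linear_on_theory.

Lemma linear_onS X Y f : Y `<=` X -> linear_on X f -> linear_on Y f.
Proof. by move=> YX fl a x y /YX Xx /YX Xy; exact: fl. Qed.

Lemma semi_innerS X Y B : Y `<=` X -> semi_inner X B -> semi_inner Y B.
Proof.
move=> YX [l s p]; split => [y /YX Xy|x y /YX Xx /YX Xy|x /YX Xx].
- exact: linear_onS YX (l _ Xy).
- exact: s.
- exact: p.
Qed.

Lemma discriminant_le (a b c : R) : 0 <= c ->
  (forall t, 0 <= a + 2 * t * b + t ^+ 2 * c) -> b ^+ 2 <= a * c.
Proof.
move=> c_ge0 h; have [c0|c0] := eqVneq c 0.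
  have [->|b0] := eqVneq b 0; first by rewrite c0 expr0n mulr0.
  have := h (- (a + 1) / (2 * b)); rewrite c0 !mulr0 addr0.
  suff -> : 2 * (- (a + 1) / (2 * b)) * b = - (a + 1) by lra.
  by field.
have cp : 0 < c by rewrite lt_neqAle eq_sym c0.
have := h (- b / c).
have -> : a + 2 * (- b / c) * b + (- b / c) ^+ 2 * c = (a * c - b ^+ 2) / c by field.
by rewrite pmulr_lge0 ?invr_gt0// subr_ge0.
Qed.

Section semi_inner_theory.
Variables (X : set E) (B : E -> E -> R).
Hypotheses (Xs : subspace X) (BX : semi_inner X B).

Lemma semi_innerC x y : X x -> X y -> B x y = B y x.
Proof. by case: BX => _ h _; exact: h. Qed.

Lemma semi_inner_ge0 x : X x -> 0 <= B x x.
Proof. by case: BX => _ _; exact. Qed.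

Lemma semi_inner_linl y : X y -> linear_on X (B ^~ y).
Proof. by case: BX => h _ _; exact: h. Qed.

Lemma semi_inner_linr x : X x -> linear_on X (B x).
Proof.
move=> Xx a y z Xy Xz; rewrite semi_innerC//; last exact: Xs.2.
by rewrite (semi_inner_linl Xx)// (semi_innerC Xy)// (semi_innerC Xz).
Qed.

Lemma semi_inner_comb a x y : X x -> X y ->
  B (x + a *: y) (x + a *: y) = B x x + 2 * a * B x y + a ^+ 2 * B y y.
Proof.
move=> Xx Xy; have Xay : X (a *: y) by exact: subspaceZ.
have Xxy : X (x + a *: y) by exact: subspaceD.
rewrite (linear_onD (semi_inner_linl Xxy))// (linear_onZ Xs (semi_inner_linl Xxy))//.
rewrite !(linear_onD (semi_inner_linr _))// !(linear_onZ Xs (semi_inner_linr _))//.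
by rewrite (semi_innerC Xy Xx); ring.
Qed.

Lemma cauchy_schwarz x y : X x -> X y -> B x y ^+ 2 <= B x x * B y y.
Proof.
move=> Xx Xy; apply: discriminant_le; first exact: semi_inner_ge0.
move=> t; rewrite -semi_inner_comb//; apply: semi_inner_ge0.
by apply: subspaceD => //; exact: subspaceZ.
Qed.

Lemma cauchy_schwarz_sqrt x y : X x -> X y ->
  `|B x y| <= Num.sqrt (B x x) * Num.sqrt (B y y).
Proof.
move=> Xx Xy; rewrite -sqrtrM ?semi_inner_ge0// -sqrtr_sqr.
by rewrite ler_wsqrtr// cauchy_schwarz.
Qed.

Lemma semi_innerD_le x y : X x -> X y -> B (x + y) (x + y) <= 2 * B x x + 2 * B y y.
Proof.
move=> Xx Xy; have := semi_inner_comb 1 Xx Xy; have := semi_inner_comb (-1) Xx Xy.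
rewrite scale1r => h1 ->.
have : 0 <= B (x + -1 *: y) (x + -1 *: y).
  by apply: semi_inner_ge0; apply: subspaceD => //; exact: subspaceZ.
by rewrite h1; lra.
Qed.

Lemma semi_inner_telescope x y : X x -> X y ->
  B x x - B y y <= 2 * B x (x - y).
Proof.
move=> Xx Xy; have := semi_inner_comb (-1) Xx Xy; rewrite scaleN1r => h.
have : 0 <= B (x - y) (x - y) by apply: semi_inner_ge0; exact: subspaceB.
have -> : B x (x - y) = B x x - B x y by apply: (linear_onB (semi_inner_linr Xx)).
by rewrite h; lra.
Qed.

End semi_inner_theory.

Definition lin_span m (b : 'I_m -> E) : set E :=
  [set \sum_j c j *: b j | c in [set: 'I_m -> R]].

Lemma lin_span_subspace m (b : 'I_m -> E) : subspace (lin_span b).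
Proof.
split; first by exists (fun=> 0) => //; rewrite big1// => j _; rewrite scale0r.
move=> a _ _ [c _ <-] [c' _ <-]; exists (fun j => a * c j + c' j) => //.
rewrite scaler_sumr -big_split/=; apply: eq_bigr => j _.
by rewrite scalerDl scalerA.
Qed.

Lemma lin_span_sub X m (b : 'I_m -> E) : subspace X -> (forall j, X (b j)) -> lin_span b `<=` X.
Proof.
move=> Xs Xb _ [c _ <-]; apply: subspace_sum => // j _.
by apply: subspaceZ.
Qed.

(** Gram-Schmidt, one vector of the list at a time. A vector [e] with
    [B e e = 0] cannot be normalized; the hypothesis says that such an [e] is
    orthogonal to everything, hence needs no correction. This covers forms that
    are only semi-definite. *)
Lemma projection_span X B m (b : 'I_m -> E) : subspace X ->
  (forall y, X y -> linear_on X (B ^~ y)) -> (forall x, X x -> linear_on X (B x)) ->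
  (forall j, X (b j)) ->
  (forall e, lin_span b e -> B e e = 0 -> forall q, X q -> B q e = 0) ->
  forall q, X q ->
  exists2 x, lin_span b x & forall z, lin_span b z -> B (q - x) z = 0.
Proof.
move=> Xs Bl Br; elim: m b => [|m IH] b Xb deg q Xq.
  exists 0 => [|z]; first by exists (fun=> 0) => //; rewrite big_ord0.
  by case=> c _ <-; rewrite big_ord0 (linear_on0 Xs (Br _ (subspaceB Xs Xq Xs.1))).
pose b' (j : 'I_m) := b (lift ord0 j).
have Xb' j : X (b' j) by exact: Xb.
have cons a v : lin_span b' v -> lin_span b (a *: b ord0 + v).
  case=> c _ <-; exists (fun j => oapp c a (unlift ord0 j)) => //.
  rewrite big_ord_recl unlift_none/=; congr (_ + _).
  by apply: eq_bigr => j _; rewrite liftK.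
have uncons z : lin_span b z -> exists a, exists2 v, lin_span b' v & z = a *: b ord0 + v.
  case=> c _ <-; exists (c ord0); exists (\sum_(j < m) c (lift ord0 j) *: b' j).
    by exists (fun j => c (lift ord0 j)).
  by rewrite big_ord_recl.
have {}IH : forall q, X q -> exists2 x, lin_span b' x & forall z, lin_span b' z -> B (q - x) z = 0.
  apply: IH => // e se; apply: deg.
  by have := cons 0 _ se; rewrite scale0r add0r.
have sb' : lin_span b' `<=` X by apply: lin_span_sub.
have [x sx xP] := IH q Xq.
have [y sy yP] := IH (b ord0) (Xb ord0).
have Xx := sb' _ sx; have Xy := sb' _ sy.
pose e := b ord0 - y; have Xe : X e by exact: subspaceB.
have Xqx : X (q - x) by exact: subspaceB.
have se : lin_span b e.
  have := cons 1 _ (subspaceZ (lin_span_subspace b') (-1) sy).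
  by rewrite scale1r scaleN1r.
have [a aP] : exists a, B (q - x) e = a * B e e.
  have [e0|e0] := eqVneq (B e e) 0; last by exists (B (q - x) e / B e e); field.
  by exists 0; rewrite mul0r; exact: deg.
(* add to the projection on the tail the component along the new direction *)
exists (x + a *: e).
  have -> : x + a *: e = a *: b ord0 + (x + (- a) *: y).
    by rewrite scalerBr scaleNr addrCA.
  by apply: cons; rewrite addrC; exact: (lin_span_subspace b').2.
move=> z /uncons[t [v sv ->]]; have Xv := sb' _ sv.
have Xae : X (a *: e) by exact: subspaceZ.
have Xty : X (t *: y) by exact: subspaceZ.
have Xte : X (t *: e) by exact: subspaceZ.
have -> : t *: b ord0 + v = t *: e + (t *: y + v).
  by rewrite scalerBr addrA subrK.
rewrite opprD addrA.
have s2 : lin_span b' (t *: y + v) by exact: (lin_span_subspace b').2.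
have X2 := sb' _ s2.
have XX : X (q - x - a *: e) by exact: subspaceB.
rewrite (linear_onD (Br _ XX))// (linear_onZ Xs (Br _ XX))//.
rewrite (linear_onB (Bl _ Xe) Xqx Xae) (linear_onB (Bl _ X2) Xqx Xae).
rewrite (linear_onZ Xs (Bl _ Xe) a Xe) (linear_onZ Xs (Bl _ X2) a Xe).
by rewrite /= aP (xP _ s2) (yP _ s2); ring.
Qed.

End semi_inner_product.

(** * Energy estimate for the implicit Euler scheme *)

(** Backward scheme for an equation [- M(z', y) + K(z, y) = load], with final
    value given at the knot [N]. [M] is only bounded below in the sense of
    [stable], whose right-hand side allows for the part of the norm that is
    controlled by testing with [X0] rather than by [M x x]; [K] vanishes on
    [X0]. The comparison sequence [P] enters through [del], its distance to the
    exact values, and [lam], the error that it makes in the diffusion term. *)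
Section implicit_euler.
Variables (R : realType) (E : lmodType R) (X Xh X0 : set E).
Hypotheses (Xs : subspace X) (Xhs : subspace Xh) (XhX : Xh `<=` X) (X0h : X0 `<=` Xh).
Variables (M K : E -> E -> R) (nrm : E -> R).
Hypotheses (Ml : forall y, Xh y -> linear_on X (M ^~ y)) (KX : semi_inner Xh K).
Hypothesis nrm_ge0 : forall x, 0 <= nrm x.
Hypothesis K0 : forall y, X0 y -> K y y = 0.
Variables (Cs T tau : R) (N : nat).
Hypotheses (Cs0 : 0 < Cs) (tau0 : 0 < tau) (TE : N%:R * tau = T).
Hypothesis stable : forall x (f : R), Xh x -> 0 <= f ->
  (forall y, X0 y -> `|M x y| <= f * nrm y) -> nrm x ^+ 2 <= Cs * (M x x + f ^+ 2).
Variables (z zh P : nat -> E) (load defect : nat -> E -> R) (eps lam del : nat -> R).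
Hypotheses (zX : forall k, (k <= N)%N -> X (z k))
  (zhX : forall k, (k <= N)%N -> Xh (zh k)) (PX : forall k, (k < N)%N -> Xh (P k)).
Hypothesis final : forall y, Xh y -> M (zh N - z N) y = 0.
Hypothesis step : forall k, (k < N)%N -> forall y, Xh y ->
  M (zh k - z k) y - M (zh k.+1 - z k.+1) y + tau * K (zh k - P k) y
    = load k y + defect k y.
Hypothesis defectl : forall k, (k < N)%N -> linear_on Xh (defect k).
Hypothesis load_le : forall k, (k < N)%N -> forall y, Xh y ->
  `|load k y| <= tau * eps k * nrm y.
Hypothesis defect_le : forall k, (k < N)%N -> forall y, Xh y ->
  `|defect k y| <= tau * lam k * Num.sqrt (K y y).
Hypothesis del_le : forall k, (k < N)%N -> forall y, Xh y ->
  `|M (P k - z k) y| <= del k * nrm y.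
Hypotheses (eps0 : forall k, 0 <= eps k) (lam0 : forall k, 0 <= lam k)
  (del0 : forall k, 0 <= del k).

(** [S m] is the integral of the error [xi] from the [m]-th knot on. The error
    equation summed from [m] to [N] involves [xi m] and [S m] but no difference
    quotient of [xi]. *)
Let xi k := zh k - P k.
Let S m : E := \sum_(m <= k < N) tau *: xi k.

Let xiX k : (k < N)%N -> Xh (xi k).
Proof. by move=> kN; apply: subspaceB => //; [apply: zhX; exact: ltnW|exact: PX]. Qed.

Let SX m : Xh (S m).
Proof.
rewrite /S big_nat_cond; apply: subspace_sum => // k /andP[/andP[_ kN] _].
by apply: subspaceZ => //; exact: xiX.
Qed.

Let S_rec m : (m < N)%N -> S m = tau *: xi m + S m.+1.
Proof. by move=> mN; rewrite /S big_ltn. Qed.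

Let SN : S N = 0. Proof. by rewrite /S big_geq. Qed.

Let down (Q : nat -> Prop) : Q N -> (forall m, (m < N)%N -> Q m.+1 -> Q m) ->
  forall m, (m <= N)%N -> Q m.
Proof.
move=> QN QS m mN; rewrite -(subKn mN); elim: (N - m)%N (leq_subr m N) => [|k IH] kN.
  by rewrite subn0.
apply: QS; first by rewrite ltn_subrL/= (leq_trans _ kN).
by rewrite -subSn// subSS; apply: IH; exact: ltnW.
Qed.

Let summed m : (m <= N)%N -> forall y, Xh y ->
  M (zh m - z m) y + K (S m) y = \sum_(m <= k < N) (load k y + defect k y).
Proof.
move=> mN y Xy; move: m mN; apply: down.
  by rewrite final// SN big_geq// (linear_on0 Xhs (semi_inner_linl KX Xy)) addr0.
move=> m mN IH; rewrite big_ltn// -IH -step// S_rec//.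
by rewrite (semi_inner_linl KX Xy)//; [ring|exact: xiX].
Qed.

Let e := \sum_(0 <= k < N) tau * eps k.
Let L := \sum_(0 <= k < N) tau * lam k.

Let e0 : 0 <= e.
Proof. by apply: sumr_ge0 => k _; rewrite mulr_ge0// ltW. Qed.

Let partial_le m (a : nat -> R) : (forall k, 0 <= a k) ->
  \sum_(m <= k < N) a k <= \sum_(0 <= k < N) a k.
Proof.
move=> a0; have [mN|Nm] := leqP m N; last first.
  by rewrite [leLHS]big_geq ?(ltnW Nm)//; exact: sumr_ge0.
by rewrite [leRHS](big_cat_nat (n:=m))//= lerDr sumr_ge0.
Qed.

Let Mxi m y : (m < N)%N -> Xh y ->
  M (xi m) y = \sum_(m <= k < N) (load k y + defect k y) - K (S m) y - M (P m - z m) y.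
Proof.
move=> mN Xy; rewrite -summed ?(ltnW mN)//.
have -> : zh m - z m = xi m + (P m - z m) by rewrite /xi addrA subrK.
rewrite (linear_onD (Ml Xy)); first ring.
  by apply: XhX; exact: xiX.
by apply: subspaceB; [|apply: XhX; exact: PX|apply: zX; exact: ltnW].
Qed.

Let sum_load_le m y : Xh y -> `|\sum_(m <= k < N) load k y| <= e * nrm y.
Proof.
move=> Xy; rewrite (le_trans (ler_norm_sum _ _ _))//.
apply: (@le_trans _ _ (\sum_(m <= k < N) tau * eps k * nrm y)).
  by apply: ler_sum_nat => k /andP[_ kN]; exact: load_le.
rewrite -mulr_suml ler_wpM2r//; apply: partial_le => k.
by rewrite mulr_ge0// ltW.
Qed.

Let K0l x y : Xh x -> X0 y -> K x y = 0.
Proof.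
move=> Xx Xy; have := cauchy_schwarz Xhs KX Xx (X0h Xy).
by rewrite (K0 Xy) mulr0 => h; apply/eqP; rewrite -sqrf_eq0 eq_le h sqr_ge0.
Qed.

Let f m := e + del m.

(** Test the summed equation with [xi m], and use [stable] with the part of the
    equation seen by [X0], where the diffusion and the defects disappear. *)
Let xi_le m : (m < N)%N -> nrm (xi m) ^+ 2 <=
  (Cs ^+ 2 + 2 * Cs) * f m ^+ 2
  + 2 * Cs * (\sum_(m <= k < N) defect k (xi m) - K (S m) (xi m)).
Proof.
move=> mN; have Xxi := xiX mN.
have f0 : 0 <= f m by rewrite addr_ge0.
have : nrm (xi m) ^+ 2 <= Cs * (M (xi m) (xi m) + f m ^+ 2).
  apply: stable => // y Xy; have Xhy := X0h Xy.
  have c0 : \sum_(m <= k < N) defect k y = 0.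
    apply: big1_seq => k; rewrite mem_index_iota => /andP[_ /andP[_ kN]].
    apply/eqP; rewrite -normr_le0; apply: le_trans (defect_le kN Xhy) _.
    by rewrite K0// sqrtr0 mulr0.
  rewrite Mxi// K0l// subr0 big_split/= c0 addr0.
  rewrite (le_trans (ler_normB _ _))// mulrDl lerD//; first exact: sum_load_le.
  exact: del_le.
rewrite Mxi// big_split/=; set A := \sum_(m <= k < N) load k _.
set B := \sum_(m <= k < N) defect k _; set k := K _ _; set d := M _ _ => h.
have hA : A <= e * nrm (xi m) by apply: le_trans (ler_norm _) _; exact: sum_load_le.
have hd : - d <= del m * nrm (xi m).
  by apply: le_trans (ler_norm _) _; rewrite normrN; exact: del_le.
have h1 : nrm (xi m) ^+ 2 <= Cs * (f m * nrm (xi m)) + Cs * f m ^+ 2 + Cs * (B - k).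
  by apply: le_trans h _; rewrite -!mulrDr ler_pM2l// /f; lra.
have := sqr_ge0 (Cs * f m - nrm (xi m)); nra.
Qed.

(** Since [tau xi m = S m - S m.+1], the diffusion term telescopes. The
    defects, which are sums over [k >= m] tested with [S m - S m.+1], are
    rearranged by summation by parts: only [defect k (S j) - defect k (S k.+1)]
    remains, so that each defect is used once and order [tau] is not lost. *)
Let energy j : (j <= N)%N ->
  \sum_(j <= m < N) tau * nrm (xi m) ^+ 2 + Cs * K (S j) (S j) <=
  \sum_(j <= m < N) tau * ((Cs ^+ 2 + 2 * Cs) * f m ^+ 2)
  + 2 * Cs * \sum_(j <= k < N) (defect k (S j) - defect k (S k.+1)).
Proof.
move: j; apply: down.
  by rewrite !big_geq// SN (linear_on0 Xhs (semi_inner_linl KX Xhs.1)) !(mulr0, addr0).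
move=> m mN IH; rewrite (big_ltn mN) [X in _ <= X + _](big_ltn mN).
rewrite [X in _ <= _ + _ * X](big_ltn mN).
have Xxi := xiX mN; have := xi_le mN.
rewrite -(ler_pM2l tau0) => h1.
have h2 : \sum_(m <= k < N) tau * defect k (xi m)
    = \sum_(m <= k < N) (defect k (S m) - defect k (S m.+1)).
  apply: eq_big_nat => k /andP[_ kN].
  have Xt : Xh (tau *: xi m) by exact: (subspaceZ Xhs).
  by rewrite (S_rec mN) (linear_onD (defectl kN) Xt)// (linear_onZ Xhs (defectl kN))// addrK.
have h3 : K (S m) (S m) - K (S m.+1) (S m.+1) <= 2 * (tau * K (S m) (xi m)).
  rewrite -(linear_onZ Xhs (semi_inner_linr Xhs KX (SX m)))//.
  have -> : tau *: xi m = S m - S m.+1 by rewrite (S_rec mN) addrK.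
  exact: (semi_inner_telescope Xhs KX (SX _) (SX _)).
have h4 : \sum_(m <= k < N) (defect k (S m) - defect k (S m.+1)) =
  defect m (S m) - defect m (S m.+1) + (\sum_(m.+1 <= k < N) (defect k (S m) - defect k (S k.+1)) - \sum_(m.+1 <= k < N) (defect k (S m.+1) - defect k (S k.+1))).
  by rewrite (big_ltn mN); congr (_ + _); rewrite -sumrB; apply: eq_bigr => k _; ring.
move: h1; rewrite mulrDr (mulrCA tau (2 * Cs)) mulrBr mulr_sumr h2 h4 => h1.
have h5 := ler_wpM2l (ltW Cs0) h3.
lra.
Qed.

(** [Cs ^+ 2 + 2 * Cs] is what Young's inequality leaves in front of the square
    of the data when the diagonal term is absorbed; the powers of [T] come from
    Cauchy-Schwarz for sums over the grid. *)
Definition euler_const := 10 * (Cs ^+ 2 + 2 * Cs) * (T ^+ 2 + 1) + 34 * Cs * T.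

Let sq_sum (a : nat -> R) : (\sum_(0 <= k < N) tau * a k) ^+ 2 <= T * \sum_(0 <= k < N) tau * a k ^+ 2.
Proof.
apply: discriminant_le; first by apply: sumr_ge0 => k _; rewrite mulr_ge0 ?sqr_ge0// ltW.
move=> t; rewrite -TE.
have -> : N%:R * tau = \sum_(0 <= k < N) tau by rewrite sumr_const_nat subn0 mulr_natl.
rewrite (_ : _ + _ = \sum_(0 <= k < N) tau * (1 + t * a k) ^+ 2).
  by apply: sumr_ge0 => k _; rewrite mulr_ge0 ?sqr_ge0// ltW.
by rewrite !mulr_sumr -!big_split/=; apply: eq_bigr => k _; ring.
Qed.

(** The rearranged defects are bounded by the largest of the seminorms
    of the [S j]; the energy inequality at the index where it is attained
    bounds this maximum, and the one at [0] then bounds the error. *)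
Theorem implicit_euler_estimate :
  \sum_(0 <= k < N) tau * nrm (xi k) ^+ 2 <=
  euler_const * \sum_(0 <= k < N) tau * (del k ^+ 2 + eps k ^+ 2 + lam k ^+ 2).
Proof.
pose mx := \big[Num.max/0]_(j < N.+1) Num.sqrt (K (S j) (S j)).
have mx0 : 0 <= mx by exact: bigmax_ge_id.
have mxP j : (j <= N)%N -> Num.sqrt (K (S j) (S j)) <= mx.
  by move=> jN; apply: (le_bigmax _ (fun j : 'I_N.+1 => Num.sqrt (K (S j) (S j))) (Ordinal (jN : (j < N.+1)%N))).
have [j jN mxE] : exists2 j, (j <= N)%N & mx = Num.sqrt (K (S j) (S j)).
  rewrite /mx; have -> := @bigmax_eq_arg _ _ _ 0 ord0 xpredT (fun j : 'I_N.+1 => Num.sqrt (K (S j) (S j))) isT (fun _ _ => sqrtr_ge0 _).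
  by eexists; last reflexivity; rewrite -ltnS.
pose A := Cs ^+ 2 + 2 * Cs.
have A0 : 0 <= A by rewrite addr_ge0 ?sqr_ge0// mulr_ge0// ltW.
pose F := \sum_(0 <= m < N) tau * (A * f m ^+ 2).
have F0 i : \sum_(i <= m < N) tau * (A * f m ^+ 2) <= F.
  by apply: partial_le => k; rewrite mulr_ge0// ?(ltW tau0)// mulr_ge0// sqr_ge0.
have defects_le i : (i <= N)%N ->
    \sum_(i <= k < N) (defect k (S i) - defect k (S k.+1)) <= 2 * L * mx.
  move=> iN; apply: (@le_trans _ _ (\sum_(i <= k < N) 2 * (tau * lam k) * mx)).
    apply: ler_sum_nat => k /andP[_ kN].
    have := defect_le kN (SX i); have := defect_le kN (SX k.+1).
    have h0 : 0 <= tau * lam k by rewrite mulr_ge0// ltW.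
    have h1 := ler_wpM2l h0 (mxP _ iN); have h2 := ler_wpM2l h0 (mxP _ kN).
    by rewrite !ler_norml => /andP[? ?] /andP[? ?]; lra.
  rewrite -mulr_suml ler_wpM2r// -mulr_sumr ler_pM2l//.
  by apply: partial_le => k; rewrite mulr_ge0// ltW.
have L0 : 0 <= L by apply: sumr_ge0 => k _; rewrite mulr_ge0// ltW.
have h1 : Cs * mx ^+ 2 <= F + 4 * Cs * L * mx.
  have := energy jN; rewrite mxE sqr_sqrtr ?(semi_inner_ge0 KX)// -mxE => h.
  have h0 : 0 <= \sum_(j <= m < N) tau * nrm (xi m) ^+ 2.
    by apply: sumr_ge0 => k _; rewrite mulr_ge0 ?sqr_ge0// ltW.
  have := defects_le _ jN; rewrite -(ler_pM2l Cs0) => h2; have := F0 j; lra.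
have h2 : \sum_(0 <= m < N) tau * nrm (xi m) ^+ 2 <= F + 4 * Cs * L * mx.
  have := energy (leq0n N).
  have h0 : 0 <= Cs * K (S 0) (S 0) by rewrite mulr_ge0 ?(semi_inner_ge0 KX)// ltW.
  have := defects_le _ (leq0n N); rewrite -(ler_pM2l Cs0) => h2; have := F0 0; lra.
have h3 : \sum_(0 <= m < N) tau * nrm (xi m) ^+ 2 <= 5 * F + 34 * Cs * L ^+ 2.
  have h4 : 0 <= Cs * (L * 4 - mx) ^+ 2 by rewrite mulr_ge0 ?sqr_ge0// ltW.
  have h5 : 0 <= Cs * (L - mx) ^+ 2 by rewrite mulr_ge0 ?sqr_ge0// ltW.
  lra.
apply: (le_trans h3).
pose De := \sum_(0 <= k < N) tau * del k ^+ 2.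
pose Ee := \sum_(0 <= k < N) tau * eps k ^+ 2.
pose Le := \sum_(0 <= k < N) tau * lam k ^+ 2.
have De0 : 0 <= De by apply: sumr_ge0 => k _; rewrite mulr_ge0 ?sqr_ge0// ltW.
have Ee0 : 0 <= Ee by apply: sumr_ge0 => k _; rewrite mulr_ge0 ?sqr_ge0// ltW.
have Le0 : 0 <= Le by apply: sumr_ge0 => k _; rewrite mulr_ge0 ?sqr_ge0// ltW.
have T0 : 0 <= T by rewrite -TE mulr_ge0// ltW.
have -> : \sum_(0 <= k < N) tau * (del k ^+ 2 + eps k ^+ 2 + lam k ^+ 2) = De + Ee + Le.
  by rewrite -!big_split/=; apply: eq_bigr => k _; ring.
have hL : L ^+ 2 <= T * Le by exact: sq_sum.
have he : e ^+ 2 <= T * Ee by exact: sq_sum.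
have hF : F <= 2 * A * (T * e ^+ 2 + De).
  apply: (@le_trans _ _ (\sum_(0 <= k < N) (2 * A * e ^+ 2 * tau + 2 * A * (tau * del k ^+ 2)))).
    apply: ler_sum_nat => k _; rewrite /f.
    have h : 0 <= (tau * A) * (e - del k) ^+ 2 by exact: (mulr_ge0 (mulr_ge0 (ltW tau0) A0) (sqr_ge0 _)).
    lra.
  rewrite big_split/= -[X in X + _]mulr_sumr -[X in _ + X]mulr_sumr -/De.
  by rewrite sumr_const_nat subn0 -[tau *+ N]mulr_natl TE; lra.
have hF2 : F <= 2 * A * (T ^+ 2 * Ee + De).
  apply: (le_trans hF); rewrite ler_wpM2l ?mulr_ge0// lerD2r expr2 -mulrA.
  by rewrite ler_wpM2l.
rewrite /euler_const -/A.
have : 0 <= A * De * T ^+ 2 by exact: (mulr_ge0 (mulr_ge0 A0 De0) (sqr_ge0 _)).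
have : 0 <= A * Le * (T ^+ 2 + 1) by exact: (mulr_ge0 (mulr_ge0 A0 Le0) (addr_ge0 (sqr_ge0 _) ler01)).
have : 0 <= A * Ee by rewrite mulr_ge0.
have : 0 <= Cs * T * De := mulr_ge0 (mulr_ge0 (ltW Cs0) T0) De0.
have : 0 <= Cs * T * Ee := mulr_ge0 (mulr_ge0 (ltW Cs0) T0) Ee0.
have := ler_wpM2l (ltW Cs0) hL.
lra.
Qed.

End implicit_euler.

(** * Square integrable functions *)

Section square_integrable.
Context d (T : measurableType d) (R : realType).
Variables (mu : {measure set T -> \bar R}) (A : set T).
Hypothesis mA : measurable A.
Implicit Types f g : T -> R.

Definition sqint : set (T -> R) := [set f : T -> R | measurable_fun A f /\
  (\int[mu]_(x in A) ((f x) ^+ 2)%:E < +oo)%E].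

Definition ipm f g : R := \int[mu]_(x in A) (f x * g x).

Lemma measurable_sqr (f : T -> R) : measurable_fun A f ->
  measurable_fun A (fun x => ((f x) ^+ 2)%:E).
Proof. by move=> mf; apply/measurable_EFinP; exact: measurable_funX. Qed.

Lemma sqr_integral_ge0 f : (0 <= \int[mu]_(x in A) ((f x) ^+ 2)%:E)%E.
Proof. by apply: integral_ge0 => x _; rewrite lee_fin sqr_ge0. Qed.

(** From [2 |f g| <= f^2 + g^2]. *)
Lemma sqint_integrable f g : sqint f -> sqint g ->
  mu.-integrable A (fun x => (f x * g x)%:E).
Proof.
move=> [mf f2] [mg g2].
apply: (@le_integrable _ _ _ _ _ mA _ (fun x => ((f x) ^+ 2)%:E + ((g x) ^+ 2)%:E)%E).
- by apply/measurable_EFinP; exact: measurable_funM.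
- move=> x _; rewrite -EFinD !abse_EFin lee_fin [leRHS]ger0_norm ?addr_ge0 ?sqr_ge0//.
  rewrite normrM -[f x ^+ 2]real_normK ?num_real// -[g x ^+ 2]real_normK ?num_real//.
  by have := sqr_ge0 (`|f x| - `|g x|); have := normr_ge0 (f x); have := normr_ge0 (g x); nra.
apply: integrableD => //; apply/integrableP; split; do ?exact: measurable_sqr.
- by rewrite (eq_integral (fun x => ((f x) ^+ 2)%:E))// => x _; rewrite abse_EFin ger0_norm ?sqr_ge0.
- by rewrite (eq_integral (fun x => ((g x) ^+ 2)%:E))// => x _; rewrite abse_EFin ger0_norm ?sqr_ge0.
Qed.

Lemma sqintZD a f g : sqint f -> sqint g -> sqint (fun x => a * f x + g x).
Proof.
move=> fL gL; have [mf f2] := fL; have [mg g2] := gL; split.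
  by apply: measurable_funD => //; exact: measurable_funM.
have := sqint_integrable fL fL; have := sqint_integrable gL gL.
move=> ig if_; have := @integrableD _ _ _ mu _ mA _ _ (integrableZl mA (2 * a ^+ 2) if_) (integrableZl mA 2 ig).
move=> /integrableP[mh]; apply: le_lt_trans.
apply: ge0_le_integral => //.
- by move=> x _; rewrite lee_fin sqr_ge0.
- by apply: measurable_sqr; apply: measurable_funD => //; exact: measurable_funM.
- exact: measurableT_comp.
move=> x _; rewrite -!EFinM -EFinD abse_EFin lee_fin (le_trans _ (ler_norm _))//.
by have := sqr_ge0 (a * f x - g x); lra.
Qed.

Lemma sqint0 : sqint 0.
Proof.
split; first exact: measurable_cst.
by rewrite integral0_eq// => x _; rewrite expr0n.
Qed.

Lemma sqint_subspace : subspace sqint.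
Proof. by split; [exact: sqint0|move=> a f g Lf Lg; exact: sqintZD]. Qed.

Lemma sqintZ a f : sqint f -> sqint (fun x => a * f x).
Proof. by move=> Lf; have := subspaceZ sqint_subspace a Lf. Qed.

Lemma sqintD f g : sqint f -> sqint g -> sqint (fun x => f x + g x).
Proof. by move=> Lf Lg; have := subspaceD sqint_subspace Lf Lg. Qed.

Lemma sqintB f g : sqint f -> sqint g -> sqint (fun x => f x - g x).
Proof. by move=> Lf Lg; have := subspaceB sqint_subspace Lf Lg. Qed.

Lemma sqint_sum (I : Type) (l : seq I) (F : I -> T -> R) :
  (forall i, sqint (F i)) -> sqint (fun x => \sum_(i <- l) F i x).
Proof.
move=> LF; elim: l => [|i l IH].
  by rewrite (_ : (fun _ => _) = 0); [exact: sqint0|apply/funext => x; rewrite big_nil].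
rewrite (_ : (fun _ => _) = (fun x => F i x + \sum_(j <- l) F j x)); first exact: sqintD.
by apply/funext => x; rewrite big_cons.
Qed.

Lemma sqint_bounded (c : T -> R) (k : R) f : measurable_fun A c -> (forall x, A x -> `|c x| <= k) ->
  sqint f -> sqint (fun x => c x * f x).
Proof.
move=> mc ck fL; have [mf _] := fL; split; first exact: measurable_funM.
have := integrableZl mA (k ^+ 2) (sqint_integrable fL fL).
move=> /integrableP[mh]; apply: le_lt_trans.
apply: ge0_le_integral => //.
- by move=> x _; rewrite lee_fin sqr_ge0.
- by apply: measurable_sqr; exact: measurable_funM.
- exact: measurableT_comp.
move=> x Ax; rewrite -EFinM abse_EFin lee_fin (le_trans _ (ler_norm _))//.
rewrite exprMn -expr2 ler_wpM2r ?sqr_ge0// -[leLHS]real_normK ?num_real//.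
by rewrite ler_sqr ?nnegrE ?(le_trans _ (ck x Ax))//; exact: ck.
Qed.

Lemma ipmE f : ipm f f = fine (\int[mu]_(x in A) ((f x) ^+ 2)%:E)%E.
Proof. by []. Qed.

Lemma ipm_semi_inner : semi_inner sqint ipm.
Proof.
split.
- move=> g gL a f f' fL fL'; rewrite /ipm -RintegralZl//; last exact: sqint_integrable.
  rewrite -RintegralD//; [|exact: (integrableZl mA a (sqint_integrable fL gL))|exact: sqint_integrable].
  by apply: eq_Rintegral => x _; rewrite mulrDl mulrA.
- by move=> f g _ _; apply: eq_Rintegral => x _; rewrite mulrC.
- by move=> f _; apply: Rintegral_ge0 => x _; rewrite -expr2 sqr_ge0.
Qed.

Lemma ipm_fin f : sqint f ->
  (\int[mu]_(x in A) ((f x) ^+ 2)%:E = (ipm f f)%:E)%E.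
Proof.
by move=> [mf f2]; rewrite ipmE fineK// ge0_fin_numE// sqr_integral_ge0.
Qed.

Lemma ipm_ge0 f : 0 <= ipm f f.
Proof. by apply: Rintegral_ge0 => x _; rewrite -expr2 sqr_ge0. Qed.

Lemma ipm_cs f g : sqint f -> sqint g ->
  `|ipm f g| <= Num.sqrt (ipm f f) * Num.sqrt (ipm g g).
Proof. exact: (cauchy_schwarz_sqrt sqint_subspace ipm_semi_inner). Qed.

End square_integrable.

Lemma sqintS d (T : measurableType d) (R : realType) (mu : {measure set T -> \bar R})
  (A B : set T) (f : T -> R) : measurable A -> measurable B -> A `<=` B ->
  sqint mu B f -> sqint mu A f.
Proof.
move=> mA mB AB [mf f2]; split; first exact: measurable_funS mf.
apply: le_lt_trans f2; apply: ge0_subset_integral => //; first exact: measurable_sqr.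
by move=> x _; rewrite lee_fin sqr_ge0.
Qed.

Lemma sqint_cst d (T : measurableType d) (R : realType) (mu : {measure set T -> \bar R})
  (A : set T) (k : R) : measurable A -> (mu A < +oo)%E -> sqint mu A (cst k).
Proof.
move=> mA fA; split; first exact: measurable_cst.
rewrite /cst integral_cst//; apply: lte_mul_pinfty => //.
by rewrite lee_fin sqr_ge0.
Qed.

Lemma ae_eq_Rintegral d (T : measurableType d) (R : realType) (mu : {measure set T -> \bar R})
  (A : set T) (f g : T -> R) : measurable A -> measurable_fun A f -> measurable_fun A g ->
  {ae mu, forall x, A x -> f x = g x} ->
  \int[mu]_(x in A) f x = \int[mu]_(x in A) g x.
Proof.
move=> mA mf mg fg; congr fine; apply: ae_eq_integral => //; [exact/measurable_EFinP..|].
by apply: filterS fg => x h Ax; congr EFin; exact: h.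
Qed.

Lemma Rintegral_sum d (T : measurableType d) (R : realType) (mu : {measure set T -> \bar R})
  (A : set T) (I : finType) (f : I -> T -> R) : measurable A ->
  (forall i, mu.-integrable A (EFin \o f i)) ->
  \int[mu]_(x in A) (\sum_i f i x) = \sum_i \int[mu]_(x in A) f i x.
Proof.
move=> mA fi; rewrite [RHS](_ : _ = fine (\sum_i \int[mu]_(x in A) (f i x)%:E)%E).
  rewrite -integral_sum//; congr fine; apply: eq_integral => x _.
  by rewrite sumEFin.
by rewrite -sum_fine// => i _; exact: (integrable_fin_num mA (fi i)).
Qed.

(** * Tonelli and Fubini on rectangles *)

Section fubini_on_rectangles.
Context d1 d2 (T1 : measurableType d1) (T2 : measurableType d2) (R : realType).
Variables (m1 : {sigma_finite_measure set T1 -> \bar R})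
  (m2 : {sigma_finite_measure set T2 -> \bar R}).
Variables (J : set T1) (O : set T2).
Hypotheses (mJ : measurable J) (mO : measurable O).
Let mJO : measurable (J `*` O). Proof. exact: measurableX. Qed.

Let patch1 (f : T1 * T2 -> \bar R) x :
  (\int[m2]_y ((f \_ (J `*` O)) (x, y)) = ((fun x => \int[m2]_(y in O) f (x, y)) \_ J) x)%E.
Proof.
rewrite patchE; case: ifPn => [xJ|xJ].
  rewrite [RHS]integral_mkcond; apply: eq_integral => y _.
  by rewrite !patchE in_setX xJ.
by rewrite integral0_eq// => y _; rewrite patchE in_setX (negbTE xJ).
Qed.

Let patch2 (f : T1 * T2 -> \bar R) y :
  (\int[m1]_x ((f \_ (J `*` O)) (x, y)) = ((fun y => \int[m1]_(x in J) f (x, y)) \_ O) y)%E.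
Proof.
rewrite patchE; case: ifPn => [yO|yO].
  rewrite [RHS]integral_mkcond; apply: eq_integral => x _.
  by rewrite !patchE in_setX yO andbT.
by rewrite integral0_eq// => x _; rewrite patchE in_setX (negbTE yO) andbF.
Qed.

Lemma section_measurable d3 (T3 : measurableType d3) (f : T1 * T2 -> T3) x :
  measurable_fun (J `*` O) f -> J x -> measurable_fun O (fun y => f (x, y)).
Proof.
move=> mf Jx; apply: (@measurable_comp _ _ _ _ _ _ (J `*` O) f O (fun y => (x, y))) => //.
- by move=> _ [y Oy <-].
- apply: measurable_funTS; exact: pair1_measurable.
Qed.

Section tonelli.
Variable f : T1 * T2 -> \bar R.
Hypotheses (mf : measurable_fun (J `*` O) f) (f0 : forall z, (0 <= f z)%E).

Let mpf : measurable_fun setT (f \_ (J `*` O)).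
Proof. by apply/(measurable_restrictT f mJO). Qed.

Let pf0 z : (0 <= (f \_ (J `*` O)) z)%E.
Proof. by rewrite patchE; case: ifP. Qed.

Lemma tonelli_measurable1 :
  measurable_fun J (fun x => (\int[m2]_(y in O) f (x, y))%E).
Proof.
apply/(measurable_restrictT _ mJ).
have := measurable_fun_fubini_tonelli_F (m2 := m2) _ mpf pf0.
by congr measurable_fun; apply/funext => x; rewrite /fubini_F patch1.
Qed.

Lemma tonelli_on1 : (\int[m1 \x m2]_(z in J `*` O) f z =
  \int[m1]_(x in J) \int[m2]_(y in O) f (x, y))%E.
Proof.
rewrite [LHS]integral_mkcond (fubini_tonelli1 _ mpf pf0) [RHS]integral_mkcond.
by apply: eq_integral => x _; rewrite /fubini_F patch1.
Qed.

Lemma tonelli_on2 : (\int[m1 \x m2]_(z in J `*` O) f z =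
  \int[m2]_(y in O) \int[m1]_(x in J) f (x, y))%E.
Proof.
rewrite [LHS]integral_mkcond (fubini_tonelli2 _ mpf pf0) [RHS]integral_mkcond.
by apply: eq_integral => x _; rewrite /fubini_G patch2.
Qed.

Lemma tonelli_measurable2 :
  measurable_fun O (fun y => (\int[m1]_(x in J) f (x, y))%E).
Proof.
apply/(measurable_restrictT _ mO).
have := measurable_fun_fubini_tonelli_G (m1 := m1) _ mpf pf0.
by congr measurable_fun; apply/funext => x; rewrite /fubini_G patch2.
Qed.

End tonelli.

Section fubini.
Variable f : T1 * T2 -> R.
Hypothesis fi : (m1 \x m2)%E.-integrable (J `*` O) (EFin \o f).

Let pfi : (m1 \x m2)%E.-integrable setT ((EFin \o f) \_ (J `*` O)).
Proof. exact/(integrable_mkcond _ mJO). Qed.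

Let integrable1 : m1.-integrable J (fun x => \int[m2]_(y in O) (f (x, y))%:E)%E.
Proof.
apply/(integrable_mkcond _ mJ); have := integrable_fubini_F pfi.
by congr (integrable _ _); apply/funext => x; rewrite /fubini_F patch1.
Qed.

Let integrable2 : m2.-integrable O (fun y => \int[m1]_(x in J) (f (x, y))%:E)%E.
Proof.
apply/(integrable_mkcond _ mO).
have -> : (fun y => \int[m1]_(x in J) (f (x, y))%:E)%E \_ O =
   fubini_G m1 ((EFin \o f) \_ (J `*` O)).
  by apply/funext => x; rewrite /fubini_G patch2.
apply/integrableP; split; first exact: (measurable_fubini_G pfi).
have mf := measurable_int _ pfi.
apply: le_lt_trans ((integrable21ltyP m1 m2 mf).1 pfi).
apply: ge0_le_integral => //.
- by apply: measurableT_comp => //; exact: (measurable_fubini_G pfi).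
- apply: (@measurable_fun_fubini_tonelli_G _ _ _ _ _ m1 (fun z => `|((EFin \o f) \_ (J `*` O)) z|%E)) => //.
  exact: measurableT_comp.
- move=> y _; apply: le_abse_integral => //.
  exact: measurableT_comp.
Qed.

Let fine1 : {ae m1, forall x, J x ->
  ((\int[m2]_(y in O) f (x, y))%:E = \int[m2]_(y in O) (f (x, y))%:E)%E}.
Proof.
have := integrable_ae mJ integrable1; apply: filterS => x h Jx.
by rewrite fineK// h.
Qed.

Let fine2 : {ae m2, forall y, O y ->
  ((\int[m1]_(x in J) f (x, y))%:E = \int[m1]_(x in J) (f (x, y))%:E)%E}.
Proof.
have := integrable_ae mO integrable2; apply: filterS => x h Jx.
by rewrite fineK// h.
Qed.

Let mfine1 : measurable_fun J (fun x => (\int[m2]_(y in O) f (x, y))%:E).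
Proof.
apply/measurable_EFinP; apply: (@measurableT_comp _ _ _ _ _ _ (@fine R)) => //.
exact: measurable_int integrable1.
Qed.

Let mfine2 : measurable_fun O (fun y => (\int[m1]_(x in J) f (x, y))%:E).
Proof.
apply/measurable_EFinP; apply: (@measurableT_comp _ _ _ _ _ _ (@fine R)) => //.
exact: measurable_int integrable2.
Qed.

Lemma fubini_integrable1 : m1.-integrable J (fun x => (\int[m2]_(y in O) f (x, y))%:E).
Proof.
apply/integrableP; split => //; have /integrableP[mi] := integrable1.
apply: le_lt_trans; rewrite le_eqVlt; apply/orP; left; apply/eqP.
apply: ge0_ae_eq_integral => //.
- exact: measurableT_comp.
- exact: measurableT_comp.
- by apply: filterS fine1 => x h Jx; rewrite -h.
Qed.

(** The inner integral is finite almost everywhere only, hence the detour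
    through extended reals in the iterated integral. *)
Lemma fubini_on1 : \int[(m1 \x m2)%E]_(z in J `*` O) f z =
  \int[m1]_(x in J) \int[m2]_(y in O) f (x, y).
Proof.
rewrite /Rintegral; congr fine.
transitivity (\int[m1]_(x in J) \int[m2]_(y in O) (f (x, y))%:E)%E; last first.
  apply: ae_eq_integral => //; first exact: measurable_int integrable1.
  by apply: filterS fine1 => x h Dx; rewrite /= h.
rewrite [LHS]integral_mkcond -(integral12_prod_meas1 pfi) [RHS]integral_mkcond.
by apply: eq_integral => x _; rewrite /fubini_F patch1.
Qed.

Lemma fubini_on2 : \int[(m1 \x m2)%E]_(z in J `*` O) f z =
  \int[m2]_(y in O) \int[m1]_(x in J) f (x, y).
Proof.
rewrite /Rintegral; congr fine.
transitivity (\int[m2]_(x in O) \int[m1]_(t in J) (f (t, x))%:E)%E; last first.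
  apply: ae_eq_integral => //; first exact: measurable_int integrable2.
  by apply: filterS fine2 => x h Dx; rewrite /= h.
rewrite [LHS]integral_mkcond -(integral21_prod_meas1 pfi) [RHS]integral_mkcond.
by apply: eq_integral => x _; rewrite /fubini_G patch2.
Qed.

Lemma fubini_measurable2 :
  measurable_fun O (fun y => \int[m1]_(x in J) f (x, y)).
Proof. exact/measurable_EFinP. Qed.

End fubini.

(** A function of the second variable alone is square integrable on the
    rectangle because the first side has finite measure; it serves as a test
    function there. *)
Lemma sqint_const_time (g : T2 -> R) : (m1 J < +oo)%E -> sqint m2 O g ->
  sqint (m1 \x m2)%E (J `*` O) (fun z => g z.2) /\
  ipm (m1 \x m2)%E (J `*` O) (fun z => g z.2) (fun z => g z.2) = fine (m1 J) * ipm m2 O g g.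
Proof.
move=> Jfin gL; have [mg g2] := gL.
have mgz : measurable_fun (J `*` O) (fun z => g z.2).
  apply: (@measurable_comp _ _ _ _ _ _ O g (J `*` O) snd) => //.
  - by move=> _ [[x y] [_ /= Oy] <-].
  - apply: measurable_funTS; exact: measurable_snd.
have e : (\int[m1 \x m2]_(z in J `*` O) ((g z.2) ^+ 2)%:E = m1 J * (ipm m2 O g g)%:E)%E.
  rewrite tonelli_on1//; last 2 first.
  - exact: measurable_sqr.
  - by move=> z; rewrite lee_fin sqr_ge0.
  by under eq_integral do rewrite (ipm_fin gL); rewrite integral_cst// muleC.
have m1J : m1 J \is a fin_num by rewrite ge0_fin_numE.
split; last by rewrite ipmE e fineM.
by split => //; rewrite e -(fineK m1J) -EFinM ltry.
Qed.

Lemma sqint_sections (f : T1 * T2 -> R) : sqint (m1 \x m2)%E (J `*` O) f ->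
  {ae m1, forall x, J x -> sqint m2 O (fun y => f (x, y))}.
Proof.
move=> [mf f2].
have i1 : m1.-integrable J (fun x => \int[m2]_(y in O) ((f (x, y)) ^+ 2)%:E)%E.
  apply/integrableP; split.
    apply: (tonelli_measurable1 (f := fun z => ((f z) ^+ 2)%:E)); first exact: measurable_sqr.
    by move=> z; rewrite lee_fin sqr_ge0.
  under eq_integral do rewrite gee0_abs ?sqr_integral_ge0//.
  rewrite -(tonelli_on1 (f := fun z => ((f z) ^+ 2)%:E))//; first exact: measurable_sqr.
  by move=> z; rewrite lee_fin sqr_ge0.
have := integrable_ae mJ i1; apply: filterS => x h Jx; split.
  exact: section_measurable mf Jx.
by rewrite -ge0_fin_numE ?sqr_integral_ge0// h.
Qed.

Lemma sqint_sections2 (f : T1 * T2 -> R) : sqint (m1 \x m2)%E (J `*` O) f ->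
  {ae m2, forall y, O y -> sqint m1 J (fun x => f (x, y))}.
Proof.
move=> [mf f2].
have i1 : m2.-integrable O (fun y => \int[m1]_(x in J) ((f (x, y)) ^+ 2)%:E)%E.
  apply/integrableP; split.
    apply: (tonelli_measurable2 (f := fun z => ((f z) ^+ 2)%:E)); first exact: measurable_sqr.
    by move=> z; rewrite lee_fin sqr_ge0.
  under eq_integral do rewrite gee0_abs ?sqr_integral_ge0//.
  rewrite -(tonelli_on2 (f := fun z => ((f z) ^+ 2)%:E))//; first exact: measurable_sqr.
  by move=> z; rewrite lee_fin sqr_ge0.
have := integrable_ae mO i1; apply: filterS => y h Oy; split.
  apply: (@measurable_comp _ _ _ _ _ _ (J `*` O) f J (fun x => (x, y))) => //.
  - by move=> _ [x Jx <-].
  - apply: measurable_funTS; exact: pair2_measurable.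
by rewrite -ge0_fin_numE ?sqr_integral_ge0// h.
Qed.

End fubini_on_rectangles.

(** * Open sets are measurable *)

(** The sigma-algebra on row vectors is generated by the coordinates; an open
    set is a countable union of cubes with rational centers and radii
    [1 / (k + 1)]. *)
Lemma open_measurable_rV (R : realType) (n : nat) (U : set 'rV[R]_n.+1) :
  open U -> measurable U.
Proof.
move=> oU.
pose box (z : {ffun 'I_n.+1 -> rat} * nat) : set 'rV[R]_n.+1 :=
  [set y | forall i, `|y ord0 i - ratr (z.1 i)| < z.2.+1%:R^-1].
have mbox z : measurable (box z).
  rewrite (_ : box z = \bigcap_(i in [set: 'I_n.+1])
    ((fun y : 'rV[R]_n.+1 => y ord0 i) @^-1` [set a | `|a - ratr (z.1 i)| < z.2.+1%:R^-1])); last first.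
    by apply/seteqP; split=> y /= h i; [move=> _|]; apply: h.
  apply: fin_bigcap_measurable => // i _; rewrite -[X in measurable X]setTI.
  apply: (measurable_rV_coord i) => //; apply: open_measurable.
  rewrite (_ : [set _ | _] = ball (ratr (z.1 i) : R) z.2.+1%:R^-1); first exact: ball_open.
  by apply/seteqP; split => a; rewrite /ball/= distrC.
rewrite (_ : U = \bigcup_(z in [set z | box z `<=` U]) box z).
  rewrite bigcup_mkcond; apply: countable_bigcupT_measurable => // z.
  by case: ifP.
apply/seteqP; split=> [x Ux|x [z /= zU zx]]; last exact: zU.
have /nbhs_ballP[e /= e0 eU] : nbhs x U by move: oU; rewrite openE => /(_ _ Ux).
have [k ke] : exists k : nat, k.+1%:R^-1 < e / 2.
  have /ltr_add_invr[k] : 0 < e / 2 by rewrite divr_gt0.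
  by rewrite add0r => h; exists k.
have k0 : 0 < k.+1%:R^-1 :> R by rewrite invr_gt0.
have /choice[q qP] : forall i : 'I_n.+1, exists q : rat, `|x ord0 i - ratr q| < k.+1%:R^-1.
  move=> i; have : x ord0 i - k.+1%:R^-1 < x ord0 i by rewrite ltrBlDr ltrDl.
  move=> /rat_in_itvoo[q]; rewrite in_itv/= => /andP[h1 h2]; exists q.
  by rewrite ltr_norml; move: k0 h1 h2; set t := k.+1%:R^-1 => k0 h1 h2; apply/andP; split; lra.
exists ([ffun i => q i], k) => /=; last by move=> i; rewrite /= ffunE; exact: qP.
move=> y ybox; apply: eU; split => // i j /=; rewrite ord1 /ball/=.
have := ybox j; have := qP j; rewrite /= ffunE !ltr_norml; move: ke; set t := k.+1%:R^-1 => ke /andP[? ?] /andP[? ?]; apply/andP; split; lra.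
Qed.

(** * Square integrable evolutions and their increments *)

Section time_integrals.
Variables (R : realType) (n : nat) (T : R) (O : set 'rV[R]_n.+1).
Hypothesis mO : measurable O.
Local Notation dx := (leb R n.+1).
Local Notation dt := (@lebesgue_measure R).
Local Notation dtdx := (@lebesgue_measure R \x leb R n.+1)%E.
Local Notation scalar_fun := (scalar_fun R n).

(** The domain is spelled with the measurable structure of the time line, which
    the plain product of types does not display. *)
Definition uncurried (f : R -> scalar_fun) (z : measurableTypeR R * 'rV[R]_n.+1) : R :=
  f z.1 z.2.

Lemma subQT (a b : R) : 0 <= a -> b <= T ->
  (`]a, b]%classic `*` O `<=` QT T O).
Proof.
move=> a0 bT [t x] [/= ]; rewrite !in_itv/= => /andP[h1 h2] Ox; split => //=.
by rewrite in_itv/=; apply/andP; split; lra.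
Qed.

Lemma itv_measure (a b : R) : a <= b -> dt `]a, b]%classic = (b - a)%:E.
Proof.
by move=> ab; rewrite lebesgue_measure_itv/= lte_fin; case: ltgtP ab => // ->; rewrite subrr.
Qed.

Variables (a b : R).
Hypotheses (a0 : 0 <= a) (ab : a <= b) (bT : b <= T).
Let J : set (measurableTypeR R) := `]a, b]%classic.
Let mJ : measurable J. Proof. exact: measurable_itv. Qed.
Let Jfin : (dt J < +oo)%E. Proof. by rewrite itv_measure// ltry. Qed.

Section test.
Variables (f : R -> scalar_fun) (g : scalar_fun).
Hypotheses (fL : sqint dtdx (J `*` O) (uncurried f)) (gL : L2 O g).

Let fgi : dtdx.-integrable (J `*` O) (EFin \o (fun z => f z.1 z.2 * g z.2)).
Proof.
have [gJ _] := sqint_const_time mJ mO Jfin gL.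
by apply: sqint_integrable => //; exact: measurableX.
Qed.

Lemma ip_time_integrable : dt.-integrable J (fun t => (ip O (f t) g)%:E).
Proof. exact: (fubini_integrable1 mJ mO fgi). Qed.

Lemma ip_time_fubini :
  \int[dtdx]_(z in J `*` O) (f z.1 z.2 * g z.2) = \int[dt]_(t in J) ip O (f t) g.
Proof. exact: (fubini_on1 mJ mO fgi). Qed.

Lemma ip_time_fubini2 :
  \int[dtdx]_(z in J `*` O) (f z.1 z.2 * g z.2) =
  \int[dx]_(x in O) (\int[dt]_(t in J) (f t x * g x)).
Proof. exact: (fubini_on2 mJ mO fgi). Qed.

Lemma ip_time_measurable2 :
  measurable_fun O (fun x => \int[dt]_(t in J) (f t x * g x)).
Proof. exact: (fubini_measurable2 mJ mO fgi). Qed.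

Lemma ip_time_cs :
  `|\int[dtdx]_(z in J `*` O) (f z.1 z.2 * g z.2)|
   <= Num.sqrt (ipm dtdx (J `*` O) (uncurried f) (uncurried f)) *
      (Num.sqrt (b - a) * Num.sqrt (ip O g g)).
Proof.
have [gJ e] := sqint_const_time mJ mO Jfin gL.
have ba : fine (dt J) = b - a by rewrite itv_measure.
rewrite -sqrtrM ?subr_ge0// -ba -e.
by apply: ipm_cs => //; exact: measurableX.
Qed.

End test.

Section derivative.
Variables (f df : R -> scalar_fun).
Hypotheses (fdf : time_deriv T O f df) (dfL : L2L2 T O df).
Hypothesis fL : forall t, 0 <= t <= T -> L2 O (f t).

Let dfJ : sqint dtdx (J `*` O) (uncurried df).
Proof.
have h : sqint dtdx (QT T O : set (measurableTypeR R * 'rV[R]_n.+1)) (uncurried df) := dfL.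
apply: sqintS h; [exact: measurableX| |exact: subQT].
by apply: measurableX => //; exact: measurable_itv.
Qed.

(** The value at the origin cancels between the two end points. Almost every
    section of the derivative is square integrable
    by Tonelli. *)
Let increment : {ae dx, forall x, O x ->
  f b x - f a x = \int[dt]_(t in J) df t x /\ sqint dt J (fun t => df t x)}.
Proof.
have hb : 0 <= b <= T by rewrite bT (le_trans a0 ab).
have ha : 0 <= a <= T by rewrite a0 (le_trans ab bT).
have mT : measurable (`[0, T]%classic : set (measurableTypeR R)) by exact: measurable_itv.
have dfs := sqint_sections2 (m1 := dt) mT mO dfL.
move: (fdf hb) (fdf ha) dfs; apply: filterS3 => x hbx hax s Ox.
have {}s := s Ox; split; last first.
  by apply: (sqintS mJ mT) s => t; rewrite /J/= !in_itv/= => /andP[? ?]; apply/andP; split; lra.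
rewrite hbx// hax// opprD addrACA subrr add0r.
have i0b : dt.-integrable `[0, b] (EFin \o (fun t => df t x)).
  have sb : sqint dt (`[0, b]%classic : set (measurableTypeR R)) (fun t => df t x).
    by apply: (sqintS _ mT) s => // t; rewrite /= !in_itv/= => /andP[? ?]; apply/andP; split; lra.
  have sc : sqint dt (`[0, b]%classic : set (measurableTypeR R)) (cst 1).
    apply: sqint_cst => //; rewrite /= lebesgue_measure_itv/=; case: ifP => _ //.
    by rewrite -EFinB ltry.
  rewrite (_ : EFin \o _ = fun t => (df t x * cst 1 t)%:E).
    by apply: sqint_integrable.
  by apply/funext => t; rewrite /= mulr1.
by rewrite Rintegral_itvB//= bnd_simp.
Qed.

(** Integrate in time under the scalar product, by Fubini. *)
Lemma ip_increment g : L2 O g ->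
  ip O (fun x => f b x - f a x) g = \int[dt]_(t in J) ip O (df t) g.
Proof.
move=> gL; rewrite -ip_time_fubini// ip_time_fubini2//.
have fb : L2 O (f b) by apply: fL; rewrite ?(le_trans a0 ab) ?(le_trans ab bT) ?a0 ?bT.
have fa : L2 O (f a) by apply: fL; rewrite ?(le_trans a0 ab) ?(le_trans ab bT) ?a0 ?bT.
apply: ae_eq_Rintegral => //.
- apply: measurable_funM; last by case: gL.
  by apply: measurable_funB; [case: fb|case: fa].
- exact: ip_time_measurable2.
apply: filterS increment => x + Ox => /(_ Ox)[e s].
rewrite e RintegralZr// (_ : EFin \o _ = fun t => (df t x * cst 1 t)%:E).
  by apply: sqint_integrable => //; exact: sqint_cst.
by apply/funext => t; rewrite /= mulr1.
Qed.

(** Cauchy-Schwarz in time at almost every point, then Tonelli. *)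
Lemma increment_le :
  ip O (fun x => f b x - f a x) (fun x => f b x - f a x)
  <= (b - a) * ipm dtdx (J `*` O) (uncurried df) (uncurried df).
Proof.
have fb : L2 O (f b) by apply: fL; rewrite ?(le_trans a0 ab) ?(le_trans ab bT) ?a0 ?bT.
have fa : L2 O (f a) by apply: fL; rewrite ?(le_trans a0 ab) ?(le_trans ab bT) ?a0 ?bT.
have fL2 : sqint dx O (fun x => f b x - f a x) by exact: sqintB.
have mdf := measurable_sqr dfJ.1.
have df0 z : (0 <= ((uncurried df z) ^+ 2)%:E)%E by rewrite lee_fin sqr_ge0.
rewrite -lee_fin EFinM -(ipm_fin fL2) -(ipm_fin dfJ).
rewrite (tonelli_on2 _ _ mJ mO mdf df0) -ge0_integralZl//; last 3 first.
- exact: (tonelli_measurable2 _ mJ mO mdf df0).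
- by move=> x _; exact: integral_ge0.
- by rewrite lee_fin subr_ge0.
apply: ae_ge0_le_integral => //.
- by move=> x _; rewrite lee_fin sqr_ge0.
- by apply: measurable_sqr; case: fL2.
- by move=> x _; rewrite mule_ge0 ?lee_fin ?subr_ge0// integral_ge0.
- by apply: measurable_funeM; exact: (tonelli_measurable2 _ mJ mO mdf df0).
apply: filterS increment => x + Ox => /(_ Ox)[-> s].
rewrite /uncurried/= (ipm_fin s) -EFinM lee_fin.
have s1 := sqint_cst 1 mJ Jfin.
have := cauchy_schwarz (sqint_subspace _ mJ) (ipm_semi_inner _ mJ) s s1.
have -> : ipm dt J (fun t => df t x) (cst 1) = \int[dt]_(t in J) df t x.
  by apply: eq_Rintegral => t _; rewrite /= mulr1.
have -> : ipm dt J (cst 1) (cst 1) = b - a.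
  have ba : fine (dt J) = b - a by rewrite itv_measure.
  by rewrite /ipm/= mulr1 Rintegral_cst// mul1r; exact: ba.
by rewrite mulrC.
Qed.

End derivative.
End time_integrals.

(** * The time grid *)

Section time_grid.
Variables (R : realType) (n : nat) (T : R) (N : nat).
Hypotheses (T0 : 0 < T) (N0 : (0 < N)%N).
Local Notation dx := (leb R n.+1).
Local Notation dt := (@lebesgue_measure R).
Local Notation dtdx := (@lebesgue_measure R \x leb R n.+1)%E.
Local Notation scalar_fun := (scalar_fun R n).
Local Notation tau := (tau T N).
Local Notation Ik := (Ik T N).

Lemma tau_gt0 : 0 < tau.
Proof. by rewrite divr_gt0// ltr0n. Qed.

Lemma natr_tau : N%:R * tau = T.
Proof. by rewrite mulrC mulfVK// pnatr_eq0 -lt0n. Qed.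

Lemma knot_ge0 k : 0 <= k%:R * tau.
Proof. by rewrite mulr_ge0// ltW// tau_gt0. Qed.

Lemma knot_le k : k.+1%:R * tau - k%:R * tau = tau.
Proof. by rewrite -mulrBl -natrB// subSnn mul1r. Qed.

Lemma knotS k : k%:R * tau <= k.+1%:R * tau.
Proof. by rewrite ler_pM2r ?tau_gt0// ler_nat. Qed.

Lemma knot_leT k : (k <= N)%N -> k%:R * tau <= T.
Proof. by move=> kN; rewrite -[leRHS]natr_tau ler_pM2r ?tau_gt0// ler_nat. Qed.

Lemma mem_Ik k t : Ik k t <-> k%:R * tau < t <= k.+1%:R * tau.
Proof. by rewrite /Ik/= in_itv/=. Qed.

Lemma Ik_range k t : (k < N)%N -> Ik k t -> 0 <= t <= T.
Proof.
move=> kN /mem_Ik/andP[h1 h2].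
by rewrite (le_trans (knot_ge0 k) (ltW h1)) (le_trans h2 (knot_leT kN)).
Qed.

Lemma Ik_disjoint j k t : Ik j t -> Ik k t -> j = k.
Proof.
move=> /mem_Ik/andP[j1 j2] /mem_Ik/andP[k1 k2].
have := lt_le_trans j1 k2; have := lt_le_trans k1 j2.
rewrite !ltr_pM2r ?tau_gt0// !ltr_nat !ltnS => h1 h2.
by apply/eqP; rewrite eqn_leq h1 h2.
Qed.

Lemma Ik_sub k : (k < N)%N -> Ik k `<=` `[0, T].
Proof. by move=> kN t h; rewrite /= in_itv/=; exact: (Ik_range kN). Qed.

(** The intervals are open on the left and cover [0, T] up to the origin. *)
Lemma integral_grid (F : R -> \bar R) : measurable_fun `[0, T] F ->
  (forall t, 0 <= F t)%E ->
  (\int[dt]_(t in `[0%R, T]) F t = \sum_(0 <= k < N) \int[dt]_(t in Ik k) F t)%E.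
Proof.
move=> mF F0.
have -> : (\int[dt]_(t in `[0%R, T]) F t = \int[dt]_(t in `]0%R, (N%:R * tau)%R]) F t)%E.
  rewrite natr_tau [RHS]integral_itv_obnd_cbnd//.
  by apply: measurable_funS mF => //; apply: subset_itvr; rewrite bnd_simp.
suff gen m : (m <= N)%N -> (\int[dt]_(t in `]0%R, (m%:R * tau)%R]) F t =
    \sum_(0 <= k < m) \int[dt]_(t in Ik k) F t)%E by exact: gen.
elim: m => [|m IH] mN.
  by rewrite big_nil mul0r set_itv_ge ?bnd_simp// integral_set0.
rewrite big_nat_recr//= -IH ?(ltnW mN)//.
rewrite -ge0_integral_setU//=.
- congr integral; rewrite -itv_bndbnd_setU ?bnd_simp//.
  + exact: knot_ge0.
  + exact: knotS.
- exact: measurable_itv.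
- apply: measurable_funS mF => // t [|/mem_Ik/andP[h1 h2]].
    rewrite /= !in_itv/= => /andP[h1 h2].
    by rewrite (ltW h1) (le_trans h2 (knot_leT (ltnW mN))).
  rewrite /= in_itv/=.
  by rewrite (le_trans (knot_ge0 _) (ltW h1)) (le_trans h2 (knot_leT mN)).
- apply/disj_setPS => t [] /=; rewrite !in_itv/= => /andP[_ h2] /mem_Ik/andP[h1 _].
  by move: (lt_le_trans h1 h2); rewrite ltxx.
Qed.

(** A function cannot exceed its mean value everywhere on the interval; the
    additional [tau] leaves room to conclude with non-strict inequalities. *)
Lemma good_time k (F : R -> \bar R) : (k < N)%N -> measurable_fun (Ik k) F ->
  (forall t, 0 <= F t)%E -> (\int[dt]_(t in Ik k) F t < +oo)%E ->
  exists2 t, Ik k t & (tau%:E * F t <= \int[dt]_(t in Ik k) F t + tau%:E)%E.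
Proof.
move=> kN mF F0 Foo; apply: contrapT => /forall2NP no.
have Ff : (\int[dt]_(t in Ik k) F t \is a fin_num)%E.
  by rewrite ge0_fin_numE//; exact: integral_ge0.
set I := (\int[dt]_(t in Ik k) F t)%E in no Foo Ff.
have mI : measurable (Ik k : set (measurableTypeR R)) by exact: measurable_itv.
have dI : dt (Ik k) = tau%:E by rewrite itv_measure ?knotS// knot_le.
have : (\int[dt]_(t in Ik k) (fine I / tau + 1)%:E <= I)%E.
  apply: ge0_le_integral => //.
  - move=> t _; rewrite lee_fin addr_ge0// divr_ge0 ?(ltW tau_gt0)//.
    by rewrite fine_ge0// integral_ge0.
  move=> t It; have [//|/negP] := no t.
  rewrite -ltNge => h.
  rewrite -(@lee_pmul2l _ tau%:E)// ?lte_fin ?tau_gt0//.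
  rewrite (le_trans _ (ltW h))// -[in leRHS](fineK Ff) -EFinM -EFinD lee_fin.
  by rewrite mulrDr mulr1 mulrC mulfVK// gt_eqF// tau_gt0.
rewrite integral_cst// [X in (_ * X)%E]dI -{2}(fineK Ff) -EFinM lee_fin mulrDl mul1r mulfVK ?gt_eqF ?tau_gt0//.
by rewrite gerDl leNgt tau_gt0.
Qed.

Variable O : set 'rV[R]_n.+1.
Hypothesis mO : measurable O.
Let mIk k : measurable (Ik k : set (measurableTypeR R)).
Proof. exact: measurable_itv. Qed.
Let mIkO k : measurable (Ik k `*` O : set (measurableTypeR R * 'rV[R]_n.+1)).
Proof. exact: measurableX. Qed.
Let mT : measurable (`[0, T]%classic : set (measurableTypeR R)).
Proof. exact: measurable_itv. Qed.
Let mQT : measurable (QT T O : set (measurableTypeR R * 'rV[R]_n.+1)).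
Proof. exact: measurableX. Qed.
Let Ikfin k : (dt (Ik k) < +oo)%E.
Proof. by rewrite itv_measure ?knotS// ltry. Qed.

Lemma sqint_Ik k (f : R -> scalar_fun) : (k < N)%N -> L2L2 T O f ->
  sqint dtdx (Ik k `*` O) (uncurried f).
Proof.
move=> kN fL; have h : sqint dtdx (QT T O : set (measurableTypeR R * 'rV[R]_n.+1)) (uncurried f) := fL.
apply: sqintS h => //; apply: subQT; first exact: knot_ge0.
exact: knot_leT.
Qed.

Lemma ipm_grid (f : R -> scalar_fun) : L2L2 T O f ->
  ipm dtdx (QT T O) (uncurried f) (uncurried f) =
  \sum_(0 <= k < N) ipm dtdx (Ik k `*` O) (uncurried f) (uncurried f).
Proof.
move=> fL; have h : sqint dtdx (QT T O : set (measurableTypeR R * 'rV[R]_n.+1)) (uncurried f) := fL.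
have mf := measurable_sqr h.1.
have f0 z : (0 <= ((uncurried f z) ^+ 2)%:E)%E by rewrite lee_fin sqr_ge0.
apply: EFin_inj; rewrite -(ipm_fin h) (tonelli_on1 _ _ mT mO mf f0).
rewrite integral_grid; last 2 first.
- exact: (tonelli_measurable1 _ mT mO mf f0).
- by move=> t; exact: integral_ge0.
rewrite -sumEFin; apply: eq_big_nat => k /andP[_ kN].
rewrite -(ipm_fin (sqint_Ik kN fL)) tonelli_on1//.
exact: measurable_sqr (sqint_Ik kN fL).1.
Qed.

Lemma pw_constE (a : nat -> scalar_fun) k t x : (k < N)%N -> Ik k t ->
  pw_const T N a t x = a k x.
Proof.
move=> kN It; rewrite /pw_const (bigD1 (Ordinal kN))//= big1 ?addr0 => [|j jk].
  by rewrite indicE mem_set// mul1r.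
rewrite indicE memNset ?mul0r// => Ij.
by move/eqP: jk; apply; apply/val_inj => /=; exact: Ik_disjoint Ij It.
Qed.

Lemma pw_const_L2L2 (a : nat -> scalar_fun) : (forall k, (k < N)%N -> L2 O (a k)) ->
  L2L2 T O (pw_const T N a).
Proof.
move=> aL; have Tfin : (dt `[0%R, T]%classic < +oo)%E.
  by rewrite lebesgue_measure_itv/=; case: ifP => _ //; rewrite -EFinB ltry.
suff : sqint dtdx (QT T O : set (measurableTypeR R * 'rV[R]_n.+1))
  (fun z => \sum_(k < N) \1_(Ik k) z.1 * a k z.2) by exact.
apply: sqint_sum => // k.
have [h _] := sqint_const_time mT mO Tfin (aL k (ltn_ord k)).
apply: (@sqint_bounded _ _ _ _ _ mQT _ 1) h => [|z _].
  apply: measurable_funTS.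
  by apply: (@measurableT_comp _ _ _ _ _ _ (\1_(Ik k) : measurableTypeR R -> R)) => //.
by rewrite indicE; case: (_ \in _); rewrite ?normr1 ?normr0.
Qed.

Lemma L2L2_distE (f g : R -> scalar_fun) :
  L2L2_dist T O f g = Num.sqrt (ipm dtdx (QT T O)
    (uncurried (fun t x => f t x - g t x)) (uncurried (fun t x => f t x - g t x))).
Proof. by congr Num.sqrt; apply: eq_Rintegral => z _; rewrite expr2. Qed.

Lemma L2L2B (f g : R -> scalar_fun) : L2L2 T O f -> L2L2 T O g ->
  L2L2 T O (fun t x => f t x - g t x).
Proof.
move=> fL gL.
have h : sqint dtdx (QT T O : set (measurableTypeR R * 'rV[R]_n.+1)) (uncurried f) := fL.
have h' : sqint dtdx (QT T O : set (measurableTypeR R * 'rV[R]_n.+1)) (uncurried g) := gL.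
exact: (sqintB mQT h h').
Qed.

Lemma L2L2_dist_grid (a : nat -> scalar_fun) (f : R -> scalar_fun) :
  (forall k, (k < N)%N -> L2 O (a k)) -> L2L2 T O f ->
  L2L2_dist T O (pw_const T N a) f ^+ 2 =
  \sum_(0 <= k < N) ipm dtdx (Ik k `*` O)
    (uncurried (fun t x => a k x - f t x)) (uncurried (fun t x => a k x - f t x)).
Proof.
move=> aL fL; rewrite L2L2_distE sqr_sqrtr ?ipm_ge0// ipm_grid; last first.
  by apply: L2L2B => //; exact: pw_const_L2L2.
apply: eq_big_nat => k /andP[_ kN]; apply: eq_Rintegral => z.
by rewrite inE => -[Iz _]; rewrite /uncurried !(pw_constE _ _ kN Iz).
Qed.

Lemma sqint_Ik_diff k (a : scalar_fun) (f : R -> scalar_fun) : (k < N)%N ->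
  L2 O a -> L2L2 T O f -> sqint dtdx (Ik k `*` O) (uncurried (fun t x => a x - f t x)).
Proof.
move=> kN aL fL.
have [h _] := sqint_const_time (mIk k) mO (Ikfin k) aL.
exact: (sqintB (mIkO k) h (sqint_Ik kN fL)).
Qed.

Lemma ipm_Ik_le k (a : scalar_fun) (f : R -> scalar_fun) (c : R) : (k < N)%N ->
  L2 O a -> L2L2 T O f ->
  (forall t, Ik k t -> ip O (fun x => a x - f t x) (fun x => a x - f t x) <= c) ->
  ipm dtdx (Ik k `*` O) (uncurried (fun t x => a x - f t x))
    (uncurried (fun t x => a x - f t x)) <= tau * c.
Proof.
move=> kN aL fL le_c.
have h := sqint_Ik_diff kN aL fL.
have hi := sqint_integrable (mIkO k) h h.
rewrite /ipm (fubini_on1 (mIk k) mO hi).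
have -> : tau * c = \int[dt]_(t in Ik k) (cst c t).
  rewrite Rintegral_cst//; rewrite mulrC; congr (_ * _).
  have e : dt (Ik k) = tau%:E by rewrite itv_measure ?knotS// knot_le.
  by rewrite [X in fine X]e.
apply: le_Rintegral => //.
- exact: (fubini_integrable1 (mIk k) mO hi).
- rewrite (_ : EFin \o _ = fun t => (cst c t * cst 1 t)%:E).
    exact: (sqint_integrable (mIk k) (sqint_cst c (mIk k) (Ikfin k)) (sqint_cst 1 (mIk k) (Ikfin k))).
  by apply/funext => t; rewrite /= mulr1.
Qed.

End time_grid.

(** * Triples of fields and bilinear forms on them *)

(** The unknowns of the problem. A record with its own module structure, rather
    than a product, keeps the structure inferred on differences of triples small
    enough for unification. *)
Record fields (R : realType) (n : nat) := Fields {
  displacement : vjet R n ; pressure : jet R n ; temperature : jet R n }.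

Section fields_lmodule.
Variables (R : realType) (n : nat).
Implicit Types x y : fields R n.

HB.instance Definition _ := gen_eqMixin (fields R n).
HB.instance Definition _ := gen_choiceMixin (fields R n).

Let add x y := Fields (displacement x + displacement y) (pressure x + pressure y)
  (temperature x + temperature y).
Let opp x := Fields (- displacement x) (- pressure x) (- temperature x).
Let zero : fields R n := Fields 0 0 0.
Let scale (a : R) x := Fields (a *: displacement x) (a *: pressure x) (a *: temperature x).

Let addA : associative add.
Proof. by move=> x y z; congr Fields; rewrite /= addrA. Qed.

Let addC : commutative add.
Proof. by move=> x y; congr Fields; rewrite /= addrC. Qed.

Let add0 : left_id zero add.
Proof. by case=> u p t; congr Fields; rewrite /= add0r. Qed.

Let addN : left_inverse zero opp add.
Proof. by move=> x; congr Fields; rewrite /= addNr. Qed.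

HB.instance Definition _ := GRing.isZmodule.Build (fields R n) addA addC add0 addN.

Let scaleA a b x : scale a (scale b x) = scale (a * b) x.
Proof. by congr Fields; rewrite /= scalerA. Qed.

Let scale1 : left_id 1 scale.
Proof. by case=> u p t; congr Fields; rewrite /= scale1r. Qed.

Let scaleDr : right_distributive scale +%R.
Proof. by move=> a x y; congr Fields; rewrite /= scalerDr. Qed.

Let scaleDl x : {morph scale^~ x : a b / a + b}.
Proof. by move=> a b; congr Fields; rewrite /= scalerDl. Qed.

HB.instance Definition _ := GRing.Zmodule_isLmodule.Build R (fields R n)
  scaleA scale1 scaleDr scaleDl.

End fields_lmodule.

Section jets.
Variables (R : realType) (n : nat) (O : set 'rV[R]_n.+1).
Hypothesis mO : measurable O.
Local Notation dx := (leb R n.+1).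
Local Notation fields := (fields R n).
Local Notation scalar_fun := (scalar_fun R n).
Local Notation jet := (jet R n).
Local Notation vjet := (vjet R n).

(** Addresses of the scalar functions in a triple: a component ([inl] for the
    displacement, [inr false] for the pressure, [inr true] for the temperature),
    then its value ([None]) or a partial derivative. *)
Definition slot := (('I_n.+1 + bool) * option 'I_n.+1)%type.

Definition field_of (z : fields) (i : 'I_n.+1 + bool) : jet :=
  match i with inl i => displacement z i | inr false => pressure z | inr true => temperature z end.

Definition jet_entry (j : jet) (o : option 'I_n.+1) : scalar_fun :=
  if o is Some l then j.2 l else j.1.

Definition entry (z : fields) (c : slot) : scalar_fun := jet_entry (field_of z c.1) c.2.

Lemma jet_entryZD a j k o x : jet_entry (a *: j + k) o x = a * jet_entry j o x + jet_entry k o x.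
Proof. by case: o. Qed.

Lemma entryZD a (z y : fields) c x : entry (a *: z + y) c x = a * entry z c x + entry y c x.
Proof. by case: c => -[i|[]] o; exact: jet_entryZD. Qed.

Lemma entryB (z y : fields) c x : entry (z - y) c x = entry z c x - entry y c x.
Proof. by case: c => -[i|[]] [l|]. Qed.

Lemma entry0 c : entry 0 c = 0.
Proof. by case: c => -[i|[]] [l|]. Qed.

Definition L2fields : set fields := [set z | forall c, L2 O (entry z c)].

Lemma L2fields_subspace : subspace L2fields.
Proof.
split=> [c|a z y zL yL c]; first by rewrite entry0; exact: (sqint_subspace dx mO).1.
rewrite (_ : entry _ c = a *: entry z c + entry y c).
  exact: (sqint_subspace dx mO).2 (zL c) (yL c).
by apply/funext => x; rewrite entryZD.
Qed.

Lemma ip_linl (g : scalar_fun) : L2 O g -> linear_on (L2 O) (fun f => ip O f g).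
Proof. by move=> gL; have [h _ _] := ipm_semi_inner dx mO; exact: h. Qed.

Lemma ipC (f g : scalar_fun) : ip O f g = ip O g f.
Proof. by apply: eq_Rintegral => x _; rewrite mulrC. Qed.

Lemma ip_linr (f : scalar_fun) : L2 O f -> linear_on (L2 O) (ip O f).
Proof. by move=> fL a g h gL hL; rewrite ipC ip_linl// !(ipC _ f). Qed.

Lemma ip_entry_linear c g : L2 O g -> linear_on L2fields (fun z => ip O (entry z c) g).
Proof.
move=> gL a z y zL yL; rewrite -(ip_linl gL)//; congr ip.
by apply/funext => x; rewrite entryZD.
Qed.

Lemma linear_on_sum (E : lmodType R) (X : set E) (I : Type) (l : seq I) (f : I -> E -> R) :
  (forall i, linear_on X (f i)) -> linear_on X (fun z => \sum_(i <- l) f i z).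
Proof.
move=> fl a x y Xx Xy; rewrite mulr_sumr -big_split/=; apply: eq_bigr => i _.
exact: fl.
Qed.

(** Functionals with an [L2] representative against all values and derivatives.
    They commute with integration in time, by applying Fubini slot by slot. *)
Definition represents (Phi : fields -> R) (g : slot -> scalar_fun) : Prop :=
  (forall c, L2 O (g c)) /\
  forall z, L2fields z -> Phi z = \sum_c ip O (entry z c) (g c).

Lemma represents_linear Phi g : represents Phi g -> linear_on L2fields Phi.
Proof.
move=> [gL PhiE] a z y zL yL; rewrite !PhiE//; last exact: L2fields_subspace.2.
have h : linear_on L2fields (fun z => \sum_c ip O (entry z c) (g c)).
  by apply: linear_on_sum => c; exact: ip_entry_linear.
by rewrite -h.
Qed.

Lemma representsZD Phi g Psi h a : represents Phi g -> represents Psi h ->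
  represents (fun z => a * Phi z + Psi z) (fun c x => a * g c x + h c x).
Proof.
move=> [gL PhiE] [hL PsiE]; split=> [c|z zL]; first exact: (sqintZD mO a (gL c) (hL c)).
rewrite PhiE// PsiE// mulr_sumr -big_split/=; apply: eq_bigr => c _.
by rewrite -(ip_linr (zL c)).
Qed.

Lemma represents_ip c (g : scalar_fun) : L2 O g ->
  represents (fun z => ip O (entry z c) g) (fun c' => if c' == c then g else 0).
Proof.
move=> gL; split=> [c'|z zL]; first by case: ifP => // _; exact: (sqint_subspace dx mO).1.
rewrite (bigD1 c)//= eqxx big1 ?addr0// => c' /negbTE ->.
exact: (linear_on0 (sqint_subspace dx mO) (ip_linr (zL c'))).
Qed.

(** The predicate selects the slots that are measured: all of them for the full
    [H1] norm, the weak ones for [H1] in the displacement and [L2] in the two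
    scalar fields. *)
Definition nsq (P : pred slot) (z : fields) : R :=
  \sum_(c | P c) ip O (entry z c) (entry z c).

Lemma nsq_ge0 P z : 0 <= nsq P z.
Proof. by apply: sumr_ge0 => c _; exact: ipm_ge0. Qed.

Lemma ip_le_nsq (P : pred slot) z c : P c -> ip O (entry z c) (entry z c) <= nsq P z.
Proof.
by move=> Pc; rewrite /nsq (bigD1 c)//= lerDl sumr_ge0// => c' _; exact: ipm_ge0.
Qed.


(** What all forms of the problem have in common; [P] selects the norm in which
    they are bounded. *)
Definition L2_bilinear (P : pred slot) (B : fields -> fields -> R) : Prop :=
  [/\ forall y, L2fields y -> exists g, represents (B ^~ y) g,
      forall z, L2fields z -> linear_on L2fields (B z)
    & exists2 C, 0 <= C & forall z y, L2fields z -> L2fields y ->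
        `|B z y| <= C * (Num.sqrt (nsq P z) * Num.sqrt (nsq P y))].

Lemma L2_bilinear_ext P B B' : (forall z y, L2fields z -> L2fields y -> B z y = B' z y) ->
  L2_bilinear P B -> L2_bilinear P B'.
Proof.
move=> BB [d l [C C0 b]]; split.
- move=> y yL; have [g [gL gE]] := d y yL; exists g; split=> // z zL.
  by rewrite -BB// gE.
- move=> z zL a y y' yL yL'; rewrite -!BB//; first exact: l.
  exact: L2fields_subspace.2.
- by exists C => // z y zL yL; rewrite -BB//; exact: b.
Qed.

Lemma L2_bilinearZD P B B' a : L2_bilinear P B -> L2_bilinear P B' -> L2_bilinear P (fun z y => a * B z y + B' z y).
Proof.
move=> [d l [C C0 b]] [d' l' [C' C0' b']]; split.
- move=> y yL; have [g dg] := d y yL; have [g' dg'] := d' y yL.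
  by eexists; exact: representsZD dg dg'.
- by move=> z zL e y y' yL yL'; rewrite l// l'//; ring.
- exists (`|a| * C + C') => [|z y zL yL]; first by rewrite addr_ge0// mulr_ge0.
  rewrite (le_trans (ler_normD _ _))// mulrDl lerD//; last exact: b'.
  by rewrite normrM -mulrA ler_wpM2l//; exact: b.
Qed.

Lemma L2_bilinear0 P : L2_bilinear P (fun _ _ => 0).
Proof.
split.
- move=> y yL; exists (fun=> 0); split=> [c|z zL]; first exact: (sqint_subspace dx mO).1.
  rewrite big1// => c _.
  exact: (linear_on0 (sqint_subspace dx mO) (ip_linr (zL c))).
- by move=> z zL a y y' _ _; rewrite mulr0 addr0.
- by exists 0 => // z y _ _; rewrite normr0 mul0r.
Qed.

Lemma L2_bilinearZ P B a : L2_bilinear P B -> L2_bilinear P (fun z y => a * B z y).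
Proof.
move=> h; have := L2_bilinearZD a h (L2_bilinear0 P); apply: L2_bilinear_ext => z y _ _.
by rewrite addr0.
Qed.

Lemma L2_bilinearD P B B' : L2_bilinear P B -> L2_bilinear P B' -> L2_bilinear P (fun z y => B z y + B' z y).
Proof.
move=> h h'; have := L2_bilinearZD 1 h h'; apply: L2_bilinear_ext => z y _ _.
by rewrite mul1r.
Qed.

(** Closed under sums because the integrals are finite, which is what allows
    the integrals of the quadruple sums of elasticity to be split. *)
Definition density (P : pred slot) (b : fields -> fields -> scalar_fun) : Prop :=
  (forall z y, L2fields z -> L2fields y -> dx.-integrable O (EFin \o b z y)) /\
  L2_bilinear P (fun z y => \int[dx]_(x in O) b z y x).

Lemma density_bilinear P b : density P b -> L2_bilinear P (fun z y => \int[dx]_(x in O) b z y x).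
Proof. by case. Qed.

Lemma densityZD P b b' a : density P b -> density P b' ->
  density P (fun z y x => a * b z y x + b' z y x).
Proof.
move=> [i d] [i' d']; have ia z y : L2fields z -> L2fields y ->
    dx.-integrable O (EFin \o (fun x => a * b z y x)).
  by move=> zL yL; exact: (integrableZl mO a (i z y zL yL)).
split => [z y zL yL|].
  exact: (integrableD mO (ia z y zL yL) (i' z y zL yL)).
apply: L2_bilinear_ext (L2_bilinearZD a d d') => z y zL yL.
by rewrite RintegralD ?RintegralZl//; [exact: i|exact: ia|exact: i'].
Qed.

Lemma density0 P : density P (fun _ _ _ => 0).
Proof.
split=> [z y _ _|]; first exact: integrable0.
apply: L2_bilinear_ext (L2_bilinear0 P) => z y _ _.
by rewrite /Rintegral integral0_eq.
Qed.

Lemma densityD P b b' : density P b -> density P b' ->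
  density P (fun z y x => b z y x + b' z y x).
Proof.
move=> h h'; have := densityZD 1 h h'; congr density.
by apply/funext => z; apply/funext => y; apply/funext => x; rewrite mul1r.
Qed.

Lemma densityZ P b a : density P b -> density P (fun z y x => a * b z y x).
Proof.
move=> h; have := densityZD a h (density0 P); congr density.
by apply/funext => z; apply/funext => y; apply/funext => x; rewrite addr0.
Qed.

Lemma density_sum P (I : Type) (l : seq I) (b : I -> fields -> fields -> scalar_fun) :
  (forall i, density P (b i)) -> density P (fun z y x => \sum_(i <- l) b i z y x).
Proof.
move=> h; elim: l => [|i l IH].
  have := density0 P; congr density.
  by apply/funext => z; apply/funext => y; apply/funext => x; rewrite big_nil.
have := densityD (h i) IH; congr density.
by apply/funext => z; apply/funext => y; apply/funext => x; rewrite big_cons.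
Qed.

(** The building block of all forms: one slot against another, with a bounded
    coefficient. *)
Lemma density_entry (P : pred slot) (k : scalar_fun) (K : R) a b :
  measurable_fun O k -> (forall x, O x -> `|k x| <= K) -> P a -> P b ->
  density P (fun z y x => k x * (entry z a x * entry y b x)).
Proof.
move=> mk kK Pa Pb.
have kL f : L2 O f -> L2 O (fun x => k x * f x) by move=> fL; exact: (sqint_bounded mO mk kK fL).
have E z y : \int[dx]_(x in O) (k x * (entry z a x * entry y b x)) =
    ip O (entry z a) (fun x => k x * entry y b x).
  by apply: eq_Rintegral => x _; rewrite mulrCA.
have K0 : 0 <= `|K| by [].
split=> [z y zL yL|].
  rewrite (_ : _ \o _ = fun x => (entry z a x * (k x * entry y b x))%:E).
    exact: (sqint_integrable mO (zL a) (kL _ (yL b))).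
  by apply/funext => x /=; rewrite mulrCA.
apply: (L2_bilinear_ext (B := fun z y => ip O (entry z a) (fun x => k x * entry y b x))).
  by move=> z y _ _; rewrite E.
split.
- by move=> y yL; eexists; exact: (represents_ip a (kL _ (yL b))).
- move=> z zL t y y' yL yL'.
  rewrite -(ip_linr (zL a) t (kL _ (yL b)) (kL _ (yL' b))).
  by congr ip; apply/funext => x; rewrite entryZD mulrDr mulrCA.
exists `|K| => // z y zL yL.
apply: le_trans (ipm_cs mO (zL a) (kL _ (yL b))) _.
rewrite mulrCA ler_pM ?sqrtr_ge0//.
  by rewrite ler_wsqrtr//; exact: ip_le_nsq.
apply: (@le_trans _ _ (Num.sqrt (`|K| ^+ 2 * ip O (entry y b) (entry y b)))).
  rewrite ler_wsqrtr// /ip -RintegralZl//; last exact: (sqint_integrable mO (yL b) (yL b)).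
  apply: le_Rintegral => //.
  - exact: (sqint_integrable mO (kL _ (yL b)) (kL _ (yL b))).
  - exact: (integrableZl mO (`|K| ^+ 2) (sqint_integrable mO (yL b) (yL b))).
  move=> x Ox; have h : k x ^+ 2 <= `|K| ^+ 2.
    rewrite -[leLHS]real_normK ?num_real// ler_sqr ?nnegrE//.
    by rewrite (le_trans (kK x Ox))// ler_norm.
  rewrite (_ : _ * _ = k x ^+ 2 * (entry y b x * entry y b x)); last by ring.
  by rewrite ler_wpM2r// -expr2 sqr_ge0.
rewrite sqrtrM ?sqr_ge0// sqrtr_sqr normr_id ler_wpM2l// ler_wsqrtr//.
exact: ip_le_nsq.
Qed.

End jets.

(** * One time step of an evolution *)

Section evolution.
Variables (R : realType) (n : nat) (T : R) (N : nat) (O : set 'rV[R]_n.+1).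
Hypotheses (T0 : 0 < T) (N0 : (0 < N)%N) (mO : measurable O).
Local Notation dx := (leb R n.+1).
Local Notation dt := (@lebesgue_measure R).
Local Notation dtdx := (@lebesgue_measure R \x leb R n.+1)%E.
Local Notation scalar_fun := (scalar_fun R n).
Local Notation fields := (fields R n).
Local Notation tau := (tau T N).
Local Notation Ik := (Ik T N).

Let mIk k : measurable (Ik k : set (measurableTypeR R)).
Proof. exact: measurable_itv. Qed.

Section pairing.
Variables (I : finType) (f : R -> I -> scalar_fun) (g : I -> scalar_fun).

Definition pairing (t : R) : R := \sum_c ip O (f t c) (g c).

Variable k : nat.
Hypotheses (kN : (k < N)%N) (fT : forall c, L2L2 T O (f ^~ c)) (gL : forall c, L2 O (g c)).

Let ip_integrable c : dt.-integrable (Ik k) (fun t => (ip O (f t c) (g c))%:E).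
Proof. by apply: (ip_time_integrable mO (knotS T0 N0 k)) => //; exact: (sqint_Ik T0 N0 mO kN (fT c)). Qed.

Lemma pairing_integrable : dt.-integrable (Ik k) (EFin \o pairing).
Proof.
rewrite (_ : _ \o _ = fun t => (\sum_c (ip O (f t c) (g c))%:E)%E).
  by apply: integrable_sum => // c _; exact: ip_integrable.
by apply/funext => t /=; rewrite sumEFin.
Qed.

Lemma pairing_measurable : measurable_fun (Ik k) pairing.
Proof. by apply/measurable_EFinP; have /integrableP[] := pairing_integrable. Qed.

Lemma Rintegral_pairing :
  \int[dt]_(t in Ik k) pairing t = \sum_c \int[dt]_(t in Ik k) ip O (f t c) (g c).
Proof.
exact: (Rintegral_sum (mIk k) ip_integrable).
Qed.

Lemma Rintegral_pairing_ipk :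
  \int[dt]_(t in Ik k) pairing t = \sum_c \int[dtdx]_(z in Ik k `*` O) (f z.1 c z.2 * g c z.2).
Proof.
rewrite Rintegral_pairing; apply: eq_bigr => c _.
by rewrite -(ip_time_fubini mO (knotS T0 N0 k) (sqint_Ik T0 N0 mO kN (fT c)) (gL c)).
Qed.

End pairing.

Variables (z dz : R -> fields).
Hypotheses (zL : forall t, 0 <= t <= T -> L2fields O (z t)) (dzT : forall c, L2L2 T O (fun t => entry (dz t) c)).
Hypothesis zdz : forall c, time_deriv T O (fun t => entry (z t) c) (fun t => entry (dz t) c).

Definition variation k : R := \sum_c ipm dtdx (Ik k `*` O)
  (uncurried (fun t => entry (dz t) c)) (uncurried (fun t => entry (dz t) c)).

Lemma variation_ge0 k : 0 <= variation k.
Proof. by apply: sumr_ge0 => c _; exact: ipm_ge0. Qed.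

Lemma sum_variation : \sum_(0 <= k < N) variation k =
  \sum_c ipm dtdx (QT T O)
    (uncurried (fun t => entry (dz t) c)) (uncurried (fun t => entry (dz t) c)).
Proof.
rewrite exchange_big/=; apply: eq_bigr => c _.
by rewrite (ipm_grid T0 N0 mO (dzT c)).
Qed.

(** Fubini moves the integral in time inside the representation. *)
Lemma represents_increment Phi g k : (k < N)%N -> represents O Phi g ->
  \int[dt]_(t in Ik k) pairing (fun t => entry (dz t)) g t =
  Phi (z (k.+1%:R * tau) - z (k%:R * tau)).
Proof.
move=> kN [gL PhiE].
have r0 : 0 <= k%:R * tau <= T by rewrite knot_ge0//= knot_leT// ltnW.
have r1 : 0 <= k.+1%:R * tau <= T by rewrite knot_ge0//= knot_leT.
rewrite PhiE; last by apply: (subspaceB (L2fields_subspace mO)); exact: zL.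
rewrite Rintegral_pairing//; apply: eq_bigr => c _.
rewrite (_ : entry _ c = fun x => entry (z (k.+1%:R * tau)) c x - entry (z (k%:R * tau)) c x).
  rewrite (ip_increment mO _ _ _ (zdz c) (dzT c))//.
  - exact: knot_ge0.
  - exact: knotS.
  - exact: knot_leT.
  - by move=> t ht; exact: zL.
by apply/funext => x; rewrite entryB.
Qed.

(** All times of one interval are equivalent up to an error of order [tau]
    after summation over the grid, since the variations of the intervals add up
    to the total variation. *)
Lemma increment_nsq P k t t' : (k < N)%N ->
  k%:R * tau <= t <= k.+1%:R * tau -> k%:R * tau <= t' <= k.+1%:R * tau ->
  nsq O P (z t - z t') <= tau * variation k.
Proof.
move=> kN.
have key a b : a <= b -> k%:R * tau <= a -> b <= k.+1%:R * tau ->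
    forall c, ip O (fun x => entry (z b) c x - entry (z a) c x) (fun x => entry (z b) c x - entry (z a) c x)
     <= tau * ipm dtdx (Ik k `*` O)
      (uncurried (fun t => entry (dz t) c)) (uncurried (fun t => entry (dz t) c)).
  move=> ab ka bk c.
  have a0 : 0 <= a by exact: le_trans (knot_ge0 T0 N0 k) ka.
  have bT : b <= T by exact: le_trans bk (knot_leT T0 N0 kN).
  have := increment_le mO a0 ab bT (zdz c) (dzT c) (fun t ht => zL ht c).
  move=> /le_trans; apply; apply: ler_pM.
  - by rewrite subr_ge0.
  - exact: ipm_ge0.
  - by rewrite -(knot_le T N k); lra.
  have sub : `]a, b]%classic `*` O `<=` Ik k `*` O.
    move=> [s x] [/= h Ox]; split => //; apply/mem_Ik.
    move: h; rewrite in_itv/= => /andP[h1 h2].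
    by rewrite (le_lt_trans ka h1) (le_trans h2 bk).
  have mI : measurable (Ik k `*` O : set (measurableTypeR R * 'rV[R]_n.+1)) by exact: measurableX.
  have mab : measurable (`]a, b]%classic `*` O : set (measurableTypeR R * 'rV[R]_n.+1)).
    by apply: measurableX => //; exact: measurable_itv.
  have hk := sqint_Ik T0 N0 mO kN (dzT c).
  have hab := sqintS mab mI sub hk.
  rewrite -lee_fin -(ipm_fin hk) -(ipm_fin hab).
  apply: ge0_subset_integral => //; first exact: measurable_sqr hk.1.
  by move=> s _; rewrite lee_fin sqr_ge0.
move=> /andP[t1 t2] /andP[t3 t4].
apply: (@le_trans _ _ (\sum_(c | P c) tau * ipm dtdx (Ik k `*` O)
      (uncurried (fun t => entry (dz t) c)) (uncurried (fun t => entry (dz t) c)))).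
  apply: ler_sum => c _.
  rewrite (_ : entry (z t - z t') c = fun x => entry (z t) c x - entry (z t') c x); last first.
    by apply/funext => x; rewrite entryB.
  have [tt'|/ltW t't] := leP t' t; first exact: key.
  have := key _ _ t't t1 t4 c; congr (_ <= _); apply: eq_Rintegral => x _; ring.
rewrite -mulr_sumr ler_wpM2l//; first by rewrite ltW// tau_gt0.
rewrite /variation [leRHS](bigID P)/= lerDl sumr_ge0// => c _; exact: ipm_ge0.
Qed.

End evolution.

(** * The forms of the adjoint problem *)

Section forms.
Variables (R : realType) (n : nat) (D : geometry R n) (c : coefficients R n).
Local Notation O := (Om D).
Hypotheses (mO : measurable O) (hc : coefficients_ok D c).
Local Notation dx := (leb R n.+1).
Local Notation scalar_fun := (scalar_fun R n).
Local Notation fields := (fields R n).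
Local Notation L2F := (@L2fields R n O).

(** The norm in which [evolution_form] is bounded contains no derivative of the
    pressure and of the temperature. *)
Definition weak_slot (a : slot n) : bool :=
  match a with (inr _, Some _) => false | _ => true end.

(** First equation minus the two others: the couplings then enter
    antisymmetrically and cancel on the diagonal. *)
Definition evolution_form (z y : fields) : R :=
  a_u D c (displacement z) (displacement y) + b_p D c (pressure z).1 (displacement y) + b_th D c (temperature z).1 (displacement y)
  - b_p D c (pressure y).1 (displacement z) - b_th D c (temperature y).1 (displacement z)
  + (s_pp c * ip O (pressure z).1 (pressure y).1 + s_pth c * ip O (temperature z).1 (pressure y).1
     + s_thp c * ip O (pressure z).1 (temperature y).1 + s_thth c * ip O (temperature z).1 (temperature y).1).

Definition diffusion_form (z y : fields) : R :=
  a_p D c (pressure z) (pressure y) + a_th D c (temperature z) (temperature y).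

Let density_prod (P : pred (slot n)) a b : P a -> P b ->
  density O P (fun z y x => entry z a x * entry y b x).
Proof.
move=> Pa Pb.
have h : density O P (fun z y x => cst 1 x * (entry z a x * entry y b x)).
  by apply: (density_entry mO (K := 1)) => // x _; rewrite normr1.
move: h; congr density; apply/funext => z; apply/funext => y; apply/funext => x.
by rewrite /= mul1r.
Qed.

Let density_ext (P : pred (slot n)) b b' : b = b' -> density O P b -> density O P b'.
Proof. by move=> ->. Qed.

(** The product of two strains consists of four products of derivatives, each
    with the bounded coefficient [stiff]. *)
Lemma a_u_bilinear : L2_bilinear O weak_slot (fun z y => a_u D c (displacement z) (displacement y)).
Proof.
have [[mC [B CB] _ _ _] _ _ _ _] := hc.
apply: density_bilinear; apply: density_sum => // i; apply: density_sum => // j.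
apply: density_sum => // k; apply: density_sum => // l.
have h a b : weak_slot a -> weak_slot b -> density O weak_slot
    (fun z y x => stiff c i j k l x * (entry z a x * entry y b x)).
  by move=> Pa Pb; apply: (density_entry mO (K := B)) => //; exact: CB.
have := densityZ mO (4^-1)
    (densityD mO (densityD mO (h (inl k, Some l) (inl i, Some j) isT isT)
                              (h (inl k, Some l) (inl j, Some i) isT isT))
                 (densityD mO (h (inl l, Some k) (inl i, Some j) isT isT)
                              (h (inl l, Some k) (inl j, Some i) isT isT))).
move=> {}h; apply: density_ext h; apply/funext => z; apply/funext => y; apply/funext => x.
by rewrite /strain /entry/=; field.
Qed.

Lemma ip_bilinear a b (P : pred (slot n)) : P a -> P b ->
  L2_bilinear O P (fun z y => ip O (entry z a) (entry y b)).
Proof. by move=> Pa Pb; apply: density_bilinear; exact: density_prod. Qed.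

Lemma ip_div_bilinear b (q : fields -> scalar_fun) : (b = false /\ q = (fun z => (pressure z).1)) \/
  (b = true /\ q = (fun z => (temperature z).1)) ->
  L2_bilinear O weak_slot (fun z y => ip O (q z) (divg (displacement y))) /\
  L2_bilinear O weak_slot (fun z y => ip O (q y) (divg (displacement z))).
Proof.
move=> hb; have qE z : q z = entry z (inr b, None) by case: hb => -[-> ->].
split; apply: density_bilinear.
- have h : density O weak_slot (fun z y x => \sum_i entry z (inr b, None) x * entry y (inl i, Some i) x).
    by apply: density_sum => // i; exact: density_prod.
  apply: density_ext h; apply/funext => z; apply/funext => y; apply/funext => x.
  by rewrite -mulr_sumr qE.
- have h : density O weak_slot (fun z y x => \sum_i entry z (inl i, Some i) x * entry y (inr b, None) x).
    by apply: density_sum => // i; exact: density_prod.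
  apply: density_ext h; apply/funext => z; apply/funext => y; apply/funext => x.
  by rewrite -mulr_suml qE mulrC.
Qed.

Lemma evolution_bilinear : L2_bilinear O weak_slot evolution_form.
Proof.
have [p1 p2] := @ip_div_bilinear false (fun z => (pressure z).1) (or_introl (conj erefl erefl)).
have [t1 t2] := @ip_div_bilinear true (fun z => (temperature z).1) (or_intror (conj erefl erefl)).
have s11 := @ip_bilinear (inr false, None) (inr false, None) weak_slot isT isT.
have s21 := @ip_bilinear (inr true, None) (inr false, None) weak_slot isT isT.
have s12 := @ip_bilinear (inr false, None) (inr true, None) weak_slot isT isT.
have s22 := @ip_bilinear (inr true, None) (inr true, None) weak_slot isT isT.
have := L2_bilinearD mO (L2_bilinearD mO (L2_bilinearD mO a_u_bilinear (L2_bilinearZ mO (- al_p c) p1))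
  (L2_bilinearD mO (L2_bilinearZ mO (- al_th c) t1) (L2_bilinearZ mO (al_p c) p2)))
  (L2_bilinearD mO (L2_bilinearZ mO (al_th c) t2)
   (L2_bilinearD mO (L2_bilinearD mO (L2_bilinearZ mO (s_pp c) s11) (L2_bilinearZ mO (s_pth c) s21))
             (L2_bilinearD mO (L2_bilinearZ mO (s_thp c) s12) (L2_bilinearZ mO (s_thth c) s22)))).
apply: (L2_bilinear_ext mO) => z y _ _; rewrite /evolution_form /b_p /b_th /entry/=; ring.
Qed.

Lemma a_kap_bilinear (kap : 'M[R]_n.+1) (b : bool) :
  L2_bilinear O predT (fun z y => a_kap D kap (field_of z (inr b)) (field_of y (inr b))).
Proof.
apply: density_bilinear.
have h : density O predT (fun z y x => \sum_i \sum_j kap i j *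
    (entry z (inr b, Some j) x * entry y (inr b, Some i) x)).
  by do 2 (apply: density_sum => // ?); apply: densityZ => //; exact: density_prod.
apply: density_ext h; apply/funext => z; apply/funext => y; apply/funext => x.
apply: eq_bigr => i _; rewrite mulr_suml; apply: eq_bigr => j _.
by rewrite mulrA.
Qed.

Lemma diffusion_bilinear : L2_bilinear O predT diffusion_form.
Proof. exact: (L2_bilinearD mO (a_kap_bilinear (kap_p c) false) (a_kap_bilinear (kap_th c) true)). Qed.

Lemma a_kapC (kap : 'M[R]_n.+1) q r : kap^T = kap -> a_kap D kap q r = a_kap D kap r q.
Proof.
move=> kapT; apply: eq_Rintegral => x _.
under eq_bigr do rewrite mulr_suml.
rewrite exchange_big/=; apply: eq_bigr => i _; rewrite mulr_suml.
apply: eq_bigr => j _; rewrite -{1}kapT mxE; ring.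
Qed.

Lemma a_kap_ge0 (kap : 'M[R]_n.+1) q : spd kap -> 0 <= a_kap D kap q q.
Proof.
move=> [kapT kap0]; apply: Rintegral_ge0 => x _.
pose v : 'rV[R]_n.+1 := \row_i q.2 i x.
rewrite (_ : \sum_i _ = (v *m kap *m v^T) ord0 ord0).
  have [->|v0] := eqVneq v 0; first by rewrite !mul0mx mxE.
  exact: ltW (kap0 v v0).
rewrite mxE; apply: eq_bigr => i _; rewrite !mxE; congr (_ * _).
by apply: eq_bigr => j _; rewrite mxE -{1}kapT mxE mulrC.
Qed.

Lemma L2_bilinear_linl (P : pred (slot n)) B y : L2_bilinear O P B -> L2F y -> linear_on L2F (B ^~ y).
Proof. by move=> [d _ _] yL; have [g /(represents_linear mO)] := d y yL. Qed.

(** Symmetric and nonnegative because the matrices are, pointwise in space. *)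
Lemma diffusion_semi_inner : semi_inner L2F diffusion_form.
Proof.
have [_ _ [kp kth] _ _] := hc; split.
- by move=> y yL; exact: L2_bilinear_linl diffusion_bilinear yL.
- by move=> z y _ _; congr (_ + _); apply: a_kapC; [case: kp|case: kth].
- by move=> z _; rewrite addr_ge0//; exact: a_kap_ge0.
Qed.

End forms.

(** * Norms and discrete stability *)

Section norms.
Variables (R : realType) (n : nat) (O : set 'rV[R]_n.+1).
Hypothesis mO : measurable O.
Local Notation dx := (leb R n.+1).
Local Notation scalar_fun := (scalar_fun R n).
Local Notation fields := (fields R n).

Lemma sum_option (I : finType) (F : option I -> R) :
  \sum_o F o = F None + \sum_i F (Some i).
Proof.
rewrite (bigD1 None)//=; congr (_ + _).
rewrite -(big_map (@Some I) xpredT F) -big_filter; apply: perm_big.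
apply: uniq_perm; first exact: filter_uniq (index_enum_uniq _).
  by rewrite map_inj_uniq ?index_enum_uniq//; exact: Some_inj.
move=> [i|]; rewrite mem_filter mem_index_enum/= ?mem_map ?mem_index_enum//; try exact: Some_inj.
by apply/esym/negbTE/mapP => -[].
Qed.

Definition jsq (j : jet R n) : R := \sum_o ip O (jet_entry j o) (jet_entry j o).

Lemma jsq_ge0 j : 0 <= jsq j.
Proof. by apply: sumr_ge0 => o _; exact: ipm_ge0. Qed.

Lemma H1sq_fin j : (forall o, L2 O (jet_entry j o)) -> H1sq O j = (jsq j)%:E.
Proof.
move=> jL; rewrite /jsq sum_option EFinD -sumEFin /H1sq.
by congr (_ + _)%E; [exact: (ipm_fin (jL None))|apply: eq_bigr => i _; exact: (ipm_fin (jL (Some i)))].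
Qed.

Lemma H1norm_sq j : (forall o, L2 O (jet_entry j o)) -> H1norm O j ^+ 2 = jsq j.
Proof. by move=> jL; rewrite /H1norm H1sq_fin//= sqr_sqrtr// jsq_ge0. Qed.

Lemma vH1norm_sq (v : vjet R n) : (forall i o, L2 O (jet_entry (v i) o)) ->
  vH1norm O v ^+ 2 = \sum_i jsq (v i).
Proof.
move=> vL; rewrite /vH1norm (eq_bigr (fun i => (jsq (v i))%:E)); last by move=> i _; exact: H1sq_fin.
by rewrite sumEFin/= sqr_sqrtr// sumr_ge0// => i _; exact: jsq_ge0.
Qed.

Lemma vH1norm_ge0 (v : vjet R n) : 0 <= vH1norm O v.
Proof. exact: sqrtr_ge0. Qed.

Lemma nsq_split (P : pred (slot n)) (z : fields) : nsq O P z =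
  \sum_i \sum_(o | P (inl i, o)) ip O (jet_entry ((displacement z) i) o) (jet_entry ((displacement z) i) o)
  + (\sum_(o | P (inr false, o)) ip O (jet_entry (pressure z) o) (jet_entry (pressure z) o)
     + \sum_(o | P (inr true, o)) ip O (jet_entry (temperature z) o) (jet_entry (temperature z) o)).
Proof.
transitivity (\sum_i \sum_(o | P (i, o)) ip O (entry z (i, o)) (entry z (i, o))).
  rewrite pair_big_dep/=; apply: eq_big => -[i o]//.
by rewrite big_sumType/= big_bool/= [X in _ + X]addrC.
Qed.

Lemma nsq_weak (z : fields) : nsq O (@weak_slot n) z =
  \sum_i jsq ((displacement z) i) + (ip O (pressure z).1 (pressure z).1 + ip O (temperature z).1 (temperature z).1).
Proof.
rewrite nsq_split; congr (_ + (_ + _)).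
- by rewrite (big_pred1 None)// => -[].
- by rewrite (big_pred1 None)// => -[].
Qed.

Lemma nsq_full (z : fields) : nsq O predT z =
  \sum_i jsq ((displacement z) i) + (jsq (pressure z) + jsq (temperature z)).
Proof. exact: nsq_split. Qed.

Lemma nsq_weak_le (z : fields) : nsq O (@weak_slot n) z <= nsq O predT z.
Proof. by rewrite /nsq [leRHS](bigID (@weak_slot n))/= lerDl sumr_ge0// => c _; exact: ipm_ge0. Qed.

(** Integrate the pointwise inequality at the values of [f] and [g]. *)
Lemma quadratic_ge0 (A B C : R) (f g : scalar_fun) : L2 O f -> L2 O g ->
  (forall a b, 0 <= A * a ^+ 2 + 2 * B * (a * b) + C * b ^+ 2) ->
  0 <= A * ip O f f + 2 * B * ip O f g + C * ip O g g.
Proof.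
move=> fL gL q0.
have h1 : L2 O (fun x => A * f x + B * g x).
  by have := (sqint_subspace dx mO).2 A f (fun x => B * g x) fL (sqintZ mO B gL).
have h2 : L2 O (fun x => B * f x + C * g x).
  by have := (sqint_subspace dx mO).2 B f (fun x => C * g x) fL (sqintZ mO C gL).
have e1 : ip O f (fun x => A * f x + B * g x) = A * ip O f f + B * ip O f g.
  have /= := ip_linr mO fL A fL (sqintZ mO B gL).
  by rewrite (linear_onZ (sqint_subspace dx mO) (ip_linr mO fL) B gL).
have e2 : ip O g (fun x => B * f x + C * g x) = B * ip O f g + C * ip O g g.
  have /= := ip_linr mO gL B fL (sqintZ mO C gL).
  by rewrite (linear_onZ (sqint_subspace dx mO) (ip_linr mO gL) C gL) (ipC _ g f).
have -> : A * ip O f f + 2 * B * ip O f g + C * ip O g g =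
  ip O f (fun x => A * f x + B * g x) + ip O g (fun x => B * f x + C * g x) by rewrite e1 e2; ring.
rewrite /ip -RintegralD//; [|exact: (sqint_integrable mO fL h1)|exact: (sqint_integrable mO gL h2)].
apply: Rintegral_ge0 => x _; have := q0 (f x) (g x); congr (0 <= _); ring.
Qed.

End norms.

(** The storage form is positive on the line orthogonal to [(ap, at_)] and
    nonnegative elsewhere; the square of [ap a + at_ b] supplies what is missing.
    The proof splits [(a, b)] along this line and its orthogonal, and compares the
    storage form on the first part with that on [(a, b)] by the parallelogram
    identity. *)
Lemma coercive_pair (R : realType) (ap at_ spp spt stt Cs : R) : 0 < ap -> 0 < Cs ->
  (forall a b, 0 <= spp * a ^+ 2 + 2 * spt * a * b + stt * b ^+ 2) ->
  Cs <= at_ ^+ 2 * spp - 2 * ap * at_ * spt + ap ^+ 2 * stt ->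
  exists2 K, 0 < K & forall a b, a ^+ 2 + b ^+ 2 <=
    K * (spp * a ^+ 2 + 2 * spt * a * b + stt * b ^+ 2 + (ap * a + at_ * b) ^+ 2).
Proof.
move=> ap0 Cs0 S0 CsS; pose g := ap ^+ 2 + at_ ^+ 2.
have g0 : 0 < g by rewrite ltr_wpDr ?sqr_ge0// exprn_gt0.
pose Sa := spp * ap ^+ 2 + 2 * spt * ap * at_ + stt * at_ ^+ 2.
have Sa0 : 0 <= Sa by exact: S0.
exists (g^-1 * (1 + (2 * Sa + 2 * g ^+ 2) / Cs)).
  rewrite mulr_gt0 ?invr_gt0// ltr_wpDr// divr_ge0 ?(ltW Cs0)//.
  by rewrite addr_ge0// mulr_ge0// sqr_ge0.
move=> a b; set S := spp * a ^+ 2 + _ + _; pose y := ap * a + at_ * b.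
pose z := at_ * a - ap * b.
have SS0 : 0 <= S by exact: S0.
have e : g * (a ^+ 2 + b ^+ 2) = y ^+ 2 + z ^+ 2 by rewrite /g/y/z; ring.
have h1 : Cs * z ^+ 2 <= 2 * g ^+ 2 * S + 2 * y ^+ 2 * Sa.
  apply: (@le_trans _ _ ((at_ ^+ 2 * spp - 2 * ap * at_ * spt + ap ^+ 2 * stt) * z ^+ 2)).
    by rewrite ler_wpM2r// sqr_ge0.
  rewrite -subr_ge0; have := S0 (g * a + y * ap) (g * b + y * at_).
  congr (0 <= _); rewrite /S/Sa/g/y/z; ring.
rewrite -/y -(ler_pM2l g0) e -mulrA mulVKf ?gt_eqF//.
rewrite -(ler_pM2l Cs0) mulrDr.
have -> : Cs * ((1 + (2 * Sa + 2 * g ^+ 2) / Cs) * (S + y ^+ 2)) =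
  (Cs + 2 * Sa + 2 * g ^+ 2) * (S + y ^+ 2) by field; rewrite gt_eqF.
have y0 : 0 <= y ^+ 2 by exact: sqr_ge0.
have : 0 <= Cs * S by rewrite mulr_ge0// ltW.
have : 0 <= Sa * S by rewrite mulr_ge0.
have : 0 <= g ^+ 2 * y ^+ 2 by rewrite mulr_ge0// sqr_ge0.
lra.
Qed.

Section stability.
Variables (R : realType) (n : nat) (D : geometry R n) (c : coefficients R n).
Local Notation O := (Om D).
Hypotheses (mO : measurable O) (hc : coefficients_ok D c).
Variables (H : discretization R n) (hH : discretization_ok D c H).
Local Notation dx := (leb R n.+1).
Local Notation fields := (fields R n).
Local Notation L2F := (@L2fields R n O).
Local Notation M := (@evolution_form R n D c).

Definition discrete_fields (i : fam H) : set fields :=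
  [set z | [/\ Vh i (displacement z), Qh i (pressure z) & Psih i (temperature z)]].

(** Test functions for the first equation alone. *)
Definition discrete_displacements (i : fam H) : set fields :=
  [set z | [/\ Vh i (displacement z), (pressure z) = 0 & (temperature z) = 0]].

Definition weak_norm (z : fields) : R := Num.sqrt (nsq O (@weak_slot n) z).

Lemma weak_norm_sq z : weak_norm z ^+ 2 = nsq O (@weak_slot n) z.
Proof. by rewrite sqr_sqrtr// nsq_ge0. Qed.

Lemma H1_0_L2 G j o : H1_0 O G j -> L2 O (jet_entry j o).
Proof. by move=> [[h1 h2 _] _]; case: o => [l|]; [exact: h2|exact: h1]. Qed.

Lemma Vh_spV (i : fam H) : Vh i `<=` spV D.
Proof. by have [_ _ [l /(_ i)[[h _] _ _]] _ _] := hH. Qed.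

Lemma Qh_spQ (i : fam H) : Qh i `<=` spQ D.
Proof. by have [_ _ [l /(_ i)[_ [h _] _]] _ _] := hH. Qed.

Lemma Psih_spPsi (i : fam H) : Psih i `<=` spPsi D.
Proof. by have [_ _ [l /(_ i)[_ _ [h _]]] _ _] := hH. Qed.

Lemma Vh_span (i : fam H) : exists m (b : 'I_m -> vjet R n), Vh i = lin_span b.
Proof. by have [_ _ [l /(_ i)[[_ [m [b [_ ->]]]] _ _]] _ _] := hH; exists m, b. Qed.

Lemma Qh_span (i : fam H) : exists m (b : 'I_m -> jet R n), Qh i = lin_span b.
Proof. by have [_ _ [l /(_ i)[_ [_ [m [b [_ ->]]]] _]] _ _] := hH; exists m, b. Qed.

Lemma Psih_span (i : fam H) : exists m (b : 'I_m -> jet R n), Psih i = lin_span b.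
Proof. by have [_ _ [l /(_ i)[_ _ [_ [m [b [_ ->]]]]]] _ _] := hH; exists m, b. Qed.

Lemma Vh_subspace (i : fam H) : subspace (Vh i).
Proof. by have [m [b ->]] := Vh_span i; exact: lin_span_subspace. Qed.

Lemma Qh_subspace (i : fam H) : subspace (Qh i).
Proof. by have [m [b ->]] := Qh_span i; exact: lin_span_subspace. Qed.

Lemma Psih_subspace (i : fam H) : subspace (Psih i).
Proof. by have [m [b ->]] := Psih_span i; exact: lin_span_subspace. Qed.

Lemma discrete_fields_subspace (i : fam H) : subspace (discrete_fields i).
Proof.
have [v0 vs] := Vh_subspace i; have [q0 qs] := Qh_subspace i.
have [p0 ps] := Psih_subspace i; split; first by split.
by move=> a x y [? ? ?] [? ? ?]; split; [exact: vs|exact: qs|exact: ps].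
Qed.

Lemma spaces_L2fields (z : fields) : spV D (displacement z) -> spQ D (pressure z) -> spPsi D (temperature z) -> L2F z.
Proof.
move=> hv hq hp [[i|[]] o]; rewrite /entry/=.
- exact: H1_0_L2 (hv i).
- exact: H1_0_L2 hp.
- exact: H1_0_L2 hq.
Qed.

Lemma discrete_fields_L2 (i : fam H) : discrete_fields i `<=` L2F.
Proof.
move=> z [hv hq hp]; apply: spaces_L2fields.
- exact: (Vh_spV hv).
- exact: (Qh_spQ hq).
- exact: (Psih_spPsi hp).
Qed.

Lemma discrete_displacements_sub (i : fam H) : discrete_displacements i `<=` discrete_fields i.
Proof.
move=> z [hv e1 e2]; split => //; rewrite ?e1 ?e2.
- exact: (Qh_subspace i).1.
- exact: (Psih_subspace i).1.
Qed.

(** On the diagonal the form is the elastic energy plus the storage form. The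
    energy controls the displacement. For the scalar fields, testing with
    displacements expresses the combination [al_p r + al_th ph] against
    divergences by the elastic term, so the inf-sup condition bounds it; with the
    storage form this bounds both fields, by [coercive_pair]. *)
Lemma stability : exists2 Cs, 0 < Cs & forall (i : fam H) x (f : R), discrete_fields i x -> 0 <= f ->
  (forall y, discrete_displacements i y -> `|M x y| <= f * weak_norm y) ->
  weak_norm x ^+ 2 <= Cs * (M x x + f ^+ 2).
Proof.
have [[_ _ _ _ [ca ca0 coer]] [alp alth] _ [sE S0 [Cs Cs0 CsS]] _] := hc.
have [K K0 KP] := coercive_pair alp Cs0 S0 CsS.
have [_ _ _ [Ci Ci0 infsup] _] := hH.
have [_ _ [Ba Ba0 BaP]] := a_u_bilinear mO hc.
exists ((1 + 2 * K * Ci ^+ 2 * Ba ^+ 2) / ca + K + 2 * K * Ci ^+ 2).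
  rewrite ltr_wpDr//; first by rewrite !mulr_ge0 ?sqr_ge0// ltW.
  rewrite ltr_wpDl// divr_ge0 ?(ltW ca0)// addr_ge0// !mulr_ge0 ?sqr_ge0//; exact: ltW.
move=> i x f hx f0 hf; have xL := discrete_fields_L2 hx.
have [hv hq hp] := hx.
pose V := vH1norm O (displacement x); have V0 : 0 <= V by exact: vH1norm_ge0.
have nV (v : vjet R n) : Vh i v -> weak_norm (Fields v 0 0) = vH1norm O v.
  move=> hv'; have d : discrete_fields i (Fields v 0 0) by apply: discrete_displacements_sub.
  have dL := discrete_fields_L2 d.
  rewrite -[RHS]ger0_norm ?vH1norm_ge0// -sqrtr_sqr vH1norm_sq; last first.
    by move=> l o; exact: (dL (inl l, o)).
  rewrite /weak_norm nsq_weak/=; congr Num.sqrt.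
  have -> : ip O 0 0 = 0 by exact: (linear_on0 (sqint_subspace dx mO) (ip_linr mO (sqint_subspace dx mO).1)).
  by rewrite !addr0.
set r := (pressure x).1; set ph := (temperature x).1.
have rL : L2 O r by exact: (xL (inr false, None)).
have phL : L2 O ph by exact: (xL (inr true, None)).
pose chi x := al_p c * r x + al_th c * ph x.
have chiL : L2 O chi by have := (sqint_subspace dx mO).2 (al_p c) r (fun x => al_th c * ph x) rL (sqintZ mO _ phL).
have Mv v : Vh i v -> M x (Fields v 0 0) = a_u D c (displacement x) v - ip O chi (divg v).
  move=> hv'; have d : discrete_fields i (Fields v 0 0) by apply: discrete_displacements_sub.
  have dL := discrete_fields_L2 d.
  have divL (w : vjet R n) : (forall l o, L2 O (jet_entry (w l) o)) -> L2 O (divg w).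
    by move=> wL; apply: (sqint_sum mO) => l; exact: (wL l (Some l)).
  have dvL : L2 O (divg v) by apply: divL => l o; exact: (dL (inl l, o)).
  have dwL : L2 O (divg (displacement x)) by apply: divL => l o; exact: (xL (inl l, o)).
  have i0 g : L2 O g -> ip O g 0 = 0.
    by move=> gL; exact: (linear_on0 (sqint_subspace dx mO) (ip_linr mO gL)).
  rewrite /evolution_form/b_p/b_th/= -/r -/ph.
  have -> : ip O chi (divg v) = al_p c * ip O r (divg v) + al_th c * ip O ph (divg v).
    have /= := ip_linl mO dvL (al_p c) rL (sqintZ mO (al_th c) phL).
    by rewrite (linear_onZ (sqint_subspace dx mO) (ip_linl mO dvL) _ phL).
  rewrite [ip O 0 (divg (displacement x))]ipC !i0//; ring.
have chi_le : L2norm O chi <= Ci * (Ba * V + f).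
  apply: le_trans (infsup i (pressure x) (temperature x) hq hp) _; rewrite ler_pM2l//.
  set A := [set _ | _ in _].
  have ub : ubound A (Ba * V + f).
    move=> _ [v [hv' v0] <-].
    have vp : 0 < vH1norm O v by rewrite lt_neqAle eq_sym v0 vH1norm_ge0.
    rewrite ler_pdivrMr//.
    have -> : ip O chi (divg v) = a_u D c (displacement x) v - M x (Fields v 0 0) by rewrite Mv//; ring.
    rewrite (le_trans (ler_normB _ _))// mulrDl lerD//; last first.
      by rewrite -nV//; apply: hf; split.
    have d : discrete_fields i (Fields v 0 0) by apply: discrete_displacements_sub.
    have d' : discrete_fields i (Fields (displacement x) 0 0) by apply: discrete_displacements_sub.
    have := BaP (Fields (displacement x) 0 0) (Fields v 0 0) (discrete_fields_L2 d') (discrete_fields_L2 d).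
    by rewrite -/(weak_norm _) -/(weak_norm _) !nV//= mulrA.
  (* the supremum of the empty set is 0 *)
  have [A0|] := pselect (A !=set0); first exact: ge_sup.
  move=> /set0P/negP; rewrite negbK => /eqP ->; rewrite sup0.
  by rewrite addr_ge0// mulr_ge0.
pose Sq := s_pp c * ip O r r + 2 * s_pth c * ip O r ph + s_thth c * ip O ph ph.
have Sq0 : 0 <= Sq.
  by apply: quadratic_ge0 => // a b; have := S0 a b; congr (0 <= _); ring.
have chiE : ip O chi chi = al_p c ^+ 2 * ip O r r + 2 * (al_p c * al_th c) * ip O r ph + al_th c ^+ 2 * ip O ph ph.
  have zL := sqintZ mO (al_th c) phL.
  have e g : L2 O g -> ip O chi g = al_p c * ip O r g + al_th c * ip O ph g.
    move=> gL; have /= := ip_linl mO gL (al_p c) rL zL.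
    by rewrite (linear_onZ (sqint_subspace dx mO) (ip_linl mO gL) _ phL).
  rewrite e// !(ipC _ _ chi) !e// (ipC _ ph r); ring.
have key : ip O r r + ip O ph ph <= K * (Sq + ip O chi chi).
  rewrite -subr_ge0 chiE.
  have := @quadratic_ge0 R n O mO (K * (s_pp c + al_p c ^+ 2) - 1) (K * (s_pth c + al_p c * al_th c))
    (K * (s_thth c + al_th c ^+ 2) - 1) r ph rL phL.
  have h a b : 0 <= (K * (s_pp c + al_p c ^+ 2) - 1) * a ^+ 2 + 2 * (K * (s_pth c + al_p c * al_th c)) * (a * b) + (K * (s_thth c + al_th c ^+ 2) - 1) * b ^+ 2.
    by have := KP a b; rewrite -subr_ge0; congr (0 <= _); ring.
  by move=> /(_ h); congr (0 <= _); rewrite /Sq; ring.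
have MxE : M x x = a_u D c (displacement x) (displacement x) + Sq.
  by rewrite /evolution_form -/r -/ph /Sq sE (ipC _ ph r); ring.
have aV : ca * V ^+ 2 <= a_u D c (displacement x) (displacement x) by exact: (coer _ (Vh_spV hv)).
have chi2 : ip O chi chi <= Ci ^+ 2 * (2 * Ba ^+ 2 * V ^+ 2 + 2 * f ^+ 2).
  have -> : ip O chi chi = L2norm O chi ^+ 2 by rewrite sqr_sqrtr//; exact: (ipm_ge0 dx O chi).
  apply: (@le_trans _ _ ((Ci * (Ba * V + f)) ^+ 2)).
    by rewrite ler_sqr ?nnegrE ?sqrtr_ge0// mulr_ge0 ?(ltW Ci0)// addr_ge0// mulr_ge0.
  rewrite exprMn ler_wpM2l ?sqr_ge0//.
  by have := sqr_ge0 (Ba * V - f); lra.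
rewrite weak_norm_sq nsq_weak -vH1norm_sq -/V -/r -/ph; last by move=> l o; exact: (xL (inl l, o)).
have V2 : V ^+ 2 <= a_u D c (displacement x) (displacement x) / ca by rewrite ler_pdivlMr// mulrC.
have a0 : 0 <= a_u D c (displacement x) (displacement x) by apply: le_trans aV; rewrite mulr_ge0 ?sqr_ge0// ltW.
set L := 1 + 2 * K * Ci ^+ 2 * Ba ^+ 2.
have L0 : 0 <= L by rewrite addr_ge0// !mulr_ge0 ?sqr_ge0// ltW.
have f2 : 0 <= f ^+ 2 by exact: sqr_ge0.
have KC0 : 0 <= 2 * K * Ci ^+ 2 by rewrite !mulr_ge0 ?sqr_ge0// ltW.
apply: (@le_trans _ _ (L * V ^+ 2 + K * Sq + 2 * K * Ci ^+ 2 * f ^+ 2)).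
  have h : K * ip O chi chi <= K * (Ci ^+ 2 * (2 * Ba ^+ 2 * V ^+ 2 + 2 * f ^+ 2)) by rewrite ler_pM2l.
  rewrite /L; lra.
rewrite MxE; set a := a_u _ _ _ _ in a0 V2 *.
have h1 : L * V ^+ 2 <= L / ca * a by rewrite -mulrA ler_wpM2l// [ca^-1 * _]mulrC.
have Lca : 0 <= L / ca by rewrite divr_ge0// ltW.
have : 0 <= L / ca * Sq by rewrite mulr_ge0.
have : 0 <= L / ca * f ^+ 2 by rewrite mulr_ge0.
have : 0 <= K * a by rewrite mulr_ge0// ltW.
have : 0 <= K * f ^+ 2 by rewrite mulr_ge0// ltW.
have : 0 <= 2 * K * Ci ^+ 2 * a by rewrite mulr_ge0.
have : 0 <= 2 * K * Ci ^+ 2 * Sq by rewrite mulr_ge0.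
lra.
Qed.

End stability.

(** * Elliptic projections *)

Section sobolev_norms.
Variables (R : realType) (n : nat) (O : set 'rV[R]_n.+1).

Lemma Hs_semi_ge0 s g : (0 <= Hs_semi O s g)%E.
Proof.
rewrite /Hs_semi; case: ifP => // _; case: ifP => _.
  apply: integral_ge0 => z _; rewrite lee_fin divr_ge0 ?sqr_ge0 ?powR_ge0//.
apply: le_ereal_inf_tmp => _ [G _ <-]; apply: sume_ge0 => i _.
exact: sqr_integral_ge0.
Qed.

Lemma H1s_sq_ge0 s (j : jet R n) : (0 <= H1s_sq O s j)%E.
Proof.
rewrite adde_ge0//; last by apply: sume_ge0 => i _; exact: Hs_semi_ge0.
by rewrite adde_ge0 ?sqr_integral_ge0// sume_ge0// => i _; exact: sqr_integral_ge0.
Qed.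

Lemma H1sq_le_H1s s (j : jet R n) : (H1sq O j <= H1s_sq O s j)%E.
Proof. by rewrite leeDl// sume_ge0// => i _; exact: Hs_semi_ge0. Qed.

(** Square of the [H^(1+s)] norm of a triple. *)
Definition regularity (s : R) (z : fields R n) : \bar R :=
  (\sum_i H1s_sq O s ((displacement z) i) + (H1s_sq O s (pressure z) + H1s_sq O s (temperature z)))%E.

End sobolev_norms.

Section elliptic_projection.
Variables (R : realType) (n : nat) (D : geometry R n) (c : coefficients R n).
Local Notation O := (Om D).
Hypotheses (mO : measurable O) (hc : coefficients_ok D c).
Variables (H : discretization R n) (hH : discretization_ok D c H).
Local Notation dx := (leb R n.+1).
Local Notation fields := (fields R n).
Local Notation L2F := (@L2fields R n O).

Let iv (v : vjet R n) : fields := (Fields v 0 0).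
Let iq (q : jet R n) : fields := (Fields 0 q 0).

Let ivZD a v v' : iv (a *: v + v') = a *: iv v + iv v'.
Proof. by rewrite /iv; congr Fields; rewrite /= scaler0 addr0. Qed.

Let iqZD a q q' : iq (a *: q + q') = a *: iq q + iq q'.
Proof. by rewrite /iq; congr Fields; rewrite /= scaler0 addr0. Qed.

Let L2v : set (vjet R n) := [set v | L2F (iv v)].
Let L2q : set (jet R n) := [set q | L2F (iq q)].

Let L2vs : subspace L2v.
Proof.
split; first exact: (L2fields_subspace mO).1.
by move=> a v v' hv hv'; rewrite /L2v/= ivZD; exact: (L2fields_subspace mO).2.
Qed.

Let L2qs : subspace L2q.
Proof.
split; first exact: (L2fields_subspace mO).1.
by move=> a v v' hv hv'; rewrite /L2q/= iqZD; exact: (L2fields_subspace mO).2.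
Qed.

Let L2vP (v : vjet R n) : (forall i o, L2 O (jet_entry (v i) o)) -> L2v v.
Proof.
by move=> h [[i|[]] o]; [exact: h|exact: ((L2fields_subspace mO).1 (inr true, o))|exact: ((L2fields_subspace mO).1 (inr true, o))].
Qed.

Let L2qP (q : jet R n) : (forall o, L2 O (jet_entry q o)) -> L2q q.
Proof.
by move=> h [[i|[]] o]; [exact: ((L2fields_subspace mO).1 (inl i, o))|exact: ((L2fields_subspace mO).1 (inr true, o))|exact: h].
Qed.

(** A discrete displacement without energy has zero [H1] norm by coercivity,
    and the form is bounded, so it is orthogonal to everything. *)
Lemma displacement_projection (i : fam H) w : spV D w ->
  exists2 wh, Vh i wh & forall v, Vh i v -> a_u D c (w - wh) v = 0.
Proof.
move=> hw; have [m [b VhE]] := Vh_span hH i.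
have [d l [B B0 BP]] := a_u_bilinear mO hc.
have wL : L2v w by apply: L2vP => j o; exact: H1_0_L2 (hw j).
have bL e : Vh i e -> L2v e by move=> /(Vh_spV hH) he; apply: L2vP => j o; exact: H1_0_L2 (he j).
have [||||] := @projection_span _ _ L2v (a_u D c) m b L2vs _ _ _ _ w wL.
- move=> y yL a v v' hv hv'.
  by have := L2_bilinear_linl mO (a_u_bilinear mO hc) (yL : L2F (iv y)) a hv hv'.
- move=> x xL a v v' hv hv'.
  by have := l _ (xL : L2F (iv x)) a _ _ hv hv'.
- by move=> j; apply: bL; rewrite VhE; exists (fun k => (k == j)%:R) => //;
    rewrite (bigD1 j)//= eqxx scale1r big1 ?addr0// => k /negbTE ->; rewrite scale0r.
- rewrite -VhE => e he e0 q hq.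
  have [[_ _ _ _ [ca ca0 coer]] _ _ _ _] := hc.
  have n0 : nsq O (@weak_slot n) (iv e) = 0.
    have -> : nsq O (@weak_slot n) (iv e) = vH1norm O e ^+ 2.
      rewrite vH1norm_sq => [|j o]; last exact: (bL _ he (inl j, o)).
      rewrite nsq_weak/=.
      have -> : ip O 0 0 = 0 by exact: (linear_on0 (sqint_subspace dx mO) (ip_linr mO (sqint_subspace dx mO).1)).
      by rewrite !addr0.
    apply/eqP; rewrite eq_le sqr_ge0 andbT -(ler_pM2l ca0) mulr0 -e0.
    exact: coer (Vh_spV hH he).
  have := BP (iv q) (iv e) hq (bL _ he).
  by rewrite n0 sqrtr0 !mulr0 normr_le0 => /eqP.
- by rewrite -VhE => wh h1 h2; exists wh.
Qed.

(** The form is semi-definite; its degenerate directions are orthogonal to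
    everything by the Cauchy-Schwarz inequality. *)
Lemma scalar_projection (kap : 'M[R]_n.+1) (Xh : set (jet R n)) m (b : 'I_m -> jet R n) q :
  spd kap -> Xh = lin_span b -> (forall e, Xh e -> forall o, L2 O (jet_entry e o)) ->
  (forall o, L2 O (jet_entry q o)) ->
  exists2 qh, Xh qh & forall z, Xh z -> a_kap D kap (q - qh) z = 0.
Proof.
move=> kapP XhE XhL qL.
have [d l _] := a_kap_bilinear mO kap false.
have lin1 y : L2q y -> linear_on L2q (a_kap D kap ^~ y).
  move=> yL a v v' hv hv'.
  by have := L2_bilinear_linl mO (a_kap_bilinear mO kap false) (yL : L2F (iq y)) a hv hv'.
have lin2 x : L2q x -> linear_on L2q (a_kap D kap x).
  move=> xL a v v' hv hv'.
  by have := l _ (xL : L2F (iq x)) a _ _ hv hv'.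
have bL e : Xh e -> L2q e by move=> he; apply: L2qP => o; exact: XhL.
have si : semi_inner L2q (a_kap D kap).
  split => //; first by move=> x y _ _; apply: a_kapC; case: kapP.
  by move=> x _; exact: a_kap_ge0.
have [||] := @projection_span _ _ L2q (a_kap D kap) m b L2qs lin1 lin2 _ _ q (L2qP qL).
- by move=> j; apply: bL; rewrite XhE; exists (fun k => (k == j)%:R) => //;
    rewrite (bigD1 j)//= eqxx scale1r big1 ?addr0// => k /negbTE ->; rewrite scale0r.
- rewrite -XhE => e he e0 x xL.
  have := cauchy_schwarz L2qs si xL (bL _ he); rewrite e0 mulr0 => h.
  by apply/eqP; rewrite -sqrf_eq0 eq_le h sqr_ge0.
- by rewrite -XhE => qh h1 h2; exists qh.
Qed.

Lemma sqrte_bound (x C h K : R) (y : \bar R) : 0 <= x -> 0 <= K -> 0 <= C * h ->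
  (y <= K%:E)%E ->
  (x%:E <= (C * h)%:E * sqrte y)%E -> x ^+ 2 <= C ^+ 2 * h ^+ 2 * K.
Proof.
move=> x0 K0 Ch yK hx.
have : (x%:E <= (C * h)%:E * sqrte K%:E)%E.
  by apply: le_trans hx _; apply: lee_wpmul2l; rewrite ?lee_fin// lee_sqrt// lee_fin.
rewrite /= -EFinM lee_fin => {}hx.
rewrite -exprMn -[K in leRHS]sqr_sqrtr// -exprMn ler_sqr ?nnegrE//.
by rewrite mulr_ge0// sqrtr_ge0.
Qed.

(** One comparison triple for the three fields. Only its diffusion form is
    compared exactly with that of [z]; in the displacement the projection
    matters through its error. *)
Lemma elliptic_projection (s : R) : 0 <= s <= 1 -> exists2 C, 0 < C &
  forall (i : fam H) (z : fields) (K : R),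
    spV D (displacement z) -> spQ D (pressure z) -> spPsi D (temperature z) -> (regularity O s z <= K%:E)%E ->
    exists P : fields, [/\ discrete_fields i P,
      forall y, discrete_fields i y -> diffusion_form D c P y = diffusion_form D c z y
    & nsq O predT (z - P) <= C * (hsz i `^ s) ^+ 2 * K].
Proof.
move=> s01; have [_ _ _ _ /(_ s s01)[C C0 CP]] := hH.
have [_ _ [kp kth] _ _] := hc.
exists (3 * C ^+ 2) => [|i z K hw hr hp zK]; first by rewrite mulr_gt0// exprn_gt0.
have [w1 r1 p1] := CP i.
have L2Q e : Qh i e -> forall o, L2 O (jet_entry e o) by move=> /(Qh_spQ hH) he o; exact: H1_0_L2 he.
have L2P e : Psih i e -> forall o, L2 O (jet_entry e o) by move=> /(Psih_spPsi hH) he o; exact: H1_0_L2 he.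
have [W WV Worth] := displacement_projection i hw.
have [mq [bq QE]] := Qh_span hH i; have [mp [bp PE]] := Psih_span hH i.
have [q qQ qorth] := scalar_projection kp QE L2Q (fun o => H1_0_L2 o hr).
have [p pP porth] := scalar_projection kth PE L2P (fun o => H1_0_L2 o hp).
have zL : L2F z by exact: spaces_L2fields.
have PL : L2F (Fields W q p) by apply: (discrete_fields_L2 hH (i := i)).
have dL := subspaceB (L2fields_subspace mO) zL PL.
exists (Fields W q p); split => //.
  move=> y hy; have yL := discrete_fields_L2 hH hy; have [_ hy2 hy3] := hy.
  have := linear_onB (L2_bilinear_linl mO (diffusion_bilinear c mO) yL) zL PL.
  rewrite {1}/diffusion_form/= /a_p /a_th qorth// porth// addr0 => h.
  by apply/esym/eqP; rewrite -subr_eq0 -h.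
have h0 : 0 <= hsz i `^ s by exact: powR_ge0.
have Ch : 0 <= C * hsz i `^ s by rewrite mulr_ge0// ltW.
have sw : (0 <= \sum_i H1s_sq O s ((displacement z) i))%E by apply: sume_ge0 => j _; exact: H1s_sq_ge0.
have K0 : 0 <= K.
  by rewrite -lee_fin; apply: le_trans zK; rewrite adde_ge0// adde_ge0//; exact: H1s_sq_ge0.
have hK1 : (\sum_i H1s_sq O s ((displacement z) i) <= K%:E)%E.
  by apply: le_trans zK; rewrite leeDl// adde_ge0//; exact: H1s_sq_ge0.
have hK2 : (H1s_sq O s (pressure z) <= K%:E)%E.
  apply: le_trans zK; rewrite -[leLHS]add0e leeD// leeDl//; exact: H1s_sq_ge0.
have hK3 : (H1s_sq O s (temperature z) <= K%:E)%E.
  apply: le_trans zK; rewrite -[leLHS]add0e leeD// leeDr//; exact: H1s_sq_ge0.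
have e1 := sqrte_bound (vH1norm_ge0 O _) K0 Ch hK1 (w1 _ _ hw WV Worth).
have e2 := sqrte_bound (sqrtr_ge0 _) K0 Ch hK2 (r1 _ _ hr qQ qorth).
have e3 := sqrte_bound (sqrtr_ge0 _) K0 Ch hK3 (p1 _ _ hp pP porth).
move: e1 e2 e3; rewrite vH1norm_sq => [|j o]; last exact: (dL (inl j, o)).
rewrite -/(H1norm O ((pressure z) - q)) -/(H1norm O ((temperature z) - p)).
rewrite H1norm_sq; last by move=> o; exact: (dL (inr false, o)).
rewrite H1norm_sq; last by move=> o; exact: (dL (inr true, o)).
move=> e1 e2 e3; rewrite nsq_full.
apply: le_trans (lerD e1 (lerD e2 e3)) _.
by rewrite le_eqVlt; apply/orP; left; apply/eqP; ring.
Qed.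

End elliptic_projection.

(** * Regularity in time *)

Section regularity_in_time.
Variables (R : realType) (n : nat) (T : R) (O : set 'rV[R]_n.+1).
Hypotheses (T0 : 0 < T) (mO : measurable O).
Local Notation dx := (leb R n.+1).
Local Notation dt := (@lebesgue_measure R).
Local Notation dtdx := (@lebesgue_measure R \x leb R n.+1)%E.
Local Notation scalar_fun := (scalar_fun R n).
Local Notation jet := (jet R n).

Let mT : measurable (`[0, T]%classic : set (measurableTypeR R)).
Proof. exact: measurable_itv. Qed.

Lemma L2sq_jet_entry_le s (j : jet) o : (L2sq O (jet_entry j o) <= H1s_sq O s j)%E.
Proof.
apply: le_trans (H1sq_le_H1s O s j); case: o => [l|] /=.
  rewrite /H1sq (bigD1 l)//= addeCA leeDl// adde_ge0 ?sqr_integral_ge0//.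
  by apply: sume_ge0 => i _; exact: sqr_integral_ge0.
by rewrite leeDl// sume_ge0// => i _; exact: sqr_integral_ge0.
Qed.

(** By Tonelli, since the square of the norm in space dominates the square of
    every value and derivative. *)
Lemma L2_time_L2L2 X s (p : R -> jet) o : L2_time T O X s p ->
  L2L2 T O (fun t => jet_entry (p t) o).
Proof.
move=> [m1 m2 _ mH iH].
have m : meas_QT T O (fun t => jet_entry (p t) o) by case: o => [l|]; [exact: m2|exact: m1].
split => //; have mf := measurable_sqr m.
have f0 z : (0 <= ((uncurried (fun t => jet_entry (p t) o) z) ^+ 2)%:E)%E by rewrite lee_fin sqr_ge0.
rewrite (tonelli_on1 _ _ mT mO mf f0); apply: le_lt_trans iH.
apply: ge0_le_integral => //.
- by move=> t _; apply: integral_ge0 => x _; exact: f0.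
- exact: (tonelli_measurable1 _ mT mO mf f0).
- by move=> t _; exact: (L2sq_jet_entry_le s (p t) o).
Qed.

Lemma jet_time_deriv_entry (p dp : R -> jet) o : jet_time_deriv T O p dp ->
  time_deriv T O (fun t => jet_entry (p t) o) (fun t => jet_entry (dp t) o).
Proof. by move=> [h1 h2]; case: o => [l|]; [exact: h2|exact: h1]. Qed.

Lemma regularity_integral X Xq Xp s (w : R -> vjet R n) (r ph : R -> jet) :
  (forall i, L2_time T O X s (fun t => w t i)) -> L2_time T O Xq s r -> L2_time T O Xp s ph ->
  measurable_fun `[0, T] (fun t => regularity O s (Fields (w t) (r t) (ph t))) /\
  (\int[dt]_(t in `[0%R, T]) regularity O s (Fields (w t) (r t) (ph t)) < +oo)%E.
Proof.
move=> hw [_ _ _ mr ir] [_ _ _ mp iph].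
have mw i : measurable_fun `[0, T] (fun t => H1s_sq O s (w t i)) by case: (hw i).
have msw : measurable_fun `[0, T] (fun t => \sum_i H1s_sq O s (w t i))%E.
  exact: emeasurable_sum.
have mrp : measurable_fun `[0, T] (fun t => H1s_sq O s (r t) + H1s_sq O s (ph t))%E.
  exact: emeasurable_funD.
have e : (fun t => regularity O s (Fields (w t) (r t) (ph t))) =
  (fun t => \sum_i H1s_sq O s (w t i) + (H1s_sq O s (r t) + H1s_sq O s (ph t)))%E by [].
rewrite e {e}; move: mw msw mrp mr mp ir iph => mw msw mrp mr mp ir iph.
split; first exact: emeasurable_funD.
have w0 t : (0 <= \sum_i H1s_sq O s (w t i))%E by apply: sume_ge0 => i _; exact: H1s_sq_ge0.
have rp0 t : (0 <= H1s_sq O s (r t) + H1s_sq O s (ph t))%E by rewrite adde_ge0//; exact: H1s_sq_ge0.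
rewrite (ge0_integralD _ mT (fun t _ => w0 t) msw (fun t _ => rp0 t) mrp).
rewrite (ge0_integralD _ mT (fun t _ => H1s_sq_ge0 O s (r t)) mr (fun t _ => H1s_sq_ge0 O s (ph t)) mp).
rewrite (ge0_integral_sum _ mT mw (fun i t _ => H1s_sq_ge0 O s (w t i))).
apply: lte_add_pinfty; last by apply: lte_add_pinfty; [exact: ir|exact: iph].
by apply: lte_sum_pinfty => i _; case: (hw i).
Qed.

End regularity_in_time.

(** * The equation integrated over one time step *)

Section interval_equation.
Variables (R : realType) (n : nat) (D : geometry R n) (c : coefficients R n).
Local Notation O := (Om D).
Hypotheses (mO : measurable O) (hc : coefficients_ok D c).
Variables (T : R) (N : nat).
Hypotheses (T0 : 0 < T) (N0 : (0 < N)%N).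
Local Notation dx := (leb R n.+1).
Local Notation dt := (@lebesgue_measure R).
Local Notation dtdx := (@lebesgue_measure R \x leb R n.+1)%E.
Local Notation scalar_fun := (scalar_fun R n).
Local Notation fields := (fields R n).
Local Notation L2F := (@L2fields R n O).
Local Notation tau := (tau T N).
Local Notation Ik := (Ik T N).
Local Notation M := (@evolution_form R n D c).
Local Notation K := (@diffusion_form R n D c).
Local Notation values := ('I_n.+1 + bool -> scalar_fun)%type.

Definition value (y : fields) : values := fun j => entry y (j, None).

(** The load of the combined equation is the pairing of the values of the
    sources with these weighted values of the test triple; the signs are those of
    [evolution_form]. *)
Definition loads (a b e : R) (y : fields) : values := fun j x =>
  (match j with inl _ => a | inr false => - b | inr true => - e end) * value y j x.

Variables (z dz : R -> fields) (F : R -> values) (a b e : R).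
Hypotheses (zL : forall t, 0 <= t <= T -> L2F (z t))
  (zT : forall j, L2L2 T O (fun t => entry (z t) j))
  (dzT : forall j, L2L2 T O (fun t => entry (dz t) j))
  (zdz : forall j, time_deriv T O (fun t => entry (z t) j) (fun t => entry (dz t) j))
  (FT : forall j, L2L2 T O (F ^~ j)).
Variable Y : set fields.
Hypothesis YL : Y `<=` L2F.
Hypothesis eqn : aet T (fun t => forall y, Y y ->
  - M (dz t) y + K (z t) y = pairing O F (loads a b e y) t).

Let mIk k : measurable (Ik k : set (measurableTypeR R)).
Proof. exact: measurable_itv. Qed.

Lemma loads_L2 y : L2F y -> forall j, L2 O (loads a b e y j).
Proof. by move=> yL j; exact: (sqintZ mO _ (yL (j, None))). Qed.

Lemma ae_L2fields : aet T (fun t => L2F (dz t)).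
Proof.
have mT : measurable (`[0, T]%classic : set (measurableTypeR R)) by exact: measurable_itv.
have h j := sqint_sections (m1 := dt) (m2 := dx) mT mO (dzT j).
have FF : Filter (nbhs (almost_everywhere dt)) by exact: ae_filter_ringOfSetsType.
have := @filter_forall _ _ (fun j t => `[0, T]%classic t -> L2 O (entry (dz t) j)) _ FF h.
by apply: (@filterS _ _ FF) => t ht t0T j; exact: ht.
Qed.

Definition diffusion_integral k (y : fields) : R := \int[dt]_(t in Ik k) K (z t) y.

Let KE k y : (k < N)%N -> L2F y -> exists g, [/\ represents O (K ^~ y) g &
  {in (Ik k : set R), (fun t => K (z t) y) =1 pairing O (fun t => entry (z t)) g}].
Proof.
move=> kN yL; have [d _ _] := diffusion_bilinear c mO; have [g [gL gE]] := d y yL.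
exists g; split => // t; rewrite inE => /(Ik_range T0 N0 kN) ht.
by rewrite gE//; exact: zL.
Qed.

Lemma diffusion_integrable k y : (k < N)%N -> L2F y ->
  dt.-integrable (Ik k) (fun t => (K (z t) y)%:E).
Proof.
move=> kN yL; have [g [[gL _] gE]] := KE kN yL.
have := pairing_integrable T0 N0 mO kN zT gL.
by apply: (eq_integrable (mIk k)) => t tI; rewrite /= gE.
Qed.

Lemma diffusion_integral_linear k : (k < N)%N -> linear_on L2F (diffusion_integral k).
Proof.
move=> kN r y y' yL yL'.
have [_ l _] := diffusion_bilinear c mO.
rewrite /diffusion_integral -RintegralZl//; last exact: diffusion_integrable.
rewrite -RintegralD//; last 2 first.
- exact: (integrableZl (mIk k) r (diffusion_integrable kN yL)).
- exact: diffusion_integrable.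
by apply: eq_Rintegral => t; rewrite inE => /(Ik_range T0 N0 kN)/zL ht; exact: l.
Qed.

(** Almost everywhere, both forms in the equation are replaced by the pairings
    with their representatives, which are measurable in time; integration then
    turns the derivative into an increment by [represents_increment]. *)
Lemma interval_equation k y : (k < N)%N -> Y y ->
  M (z (k%:R * tau)) y - M (z (k.+1%:R * tau)) y + diffusion_integral k y =
  \sum_j \int[dtdx]_(x in Ik k `*` O) (F x.1 j x.2 * loads a b e y j x.2).
Proof.
move=> kN Yy; have yL := YL Yy.
have [g [gD gE]] := KE kN yL; have [gL _] := gD.
have [d _ _] := evolution_bilinear mO hc; have [g' g'D] := d y yL.
have [g'L g'E] := g'D.
have lL := loads_L2 yL.
rewrite -(Rintegral_pairing_ipk T0 N0 mO kN FT lL).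
have i1 := pairing_integrable T0 N0 mO kN dzT g'L.
have i2 := pairing_integrable T0 N0 mO kN zT gL.
have -> : \int[dt]_(t in Ik k) pairing O F (loads a b e y) t =
  \int[dt]_(t in Ik k) (pairing O (fun t => entry (z t)) g t - pairing O (fun t => entry (dz t)) g' t).
  apply: ae_eq_Rintegral => //.
  - exact: (pairing_measurable T0 N0 mO kN FT lL).
  - apply: measurable_funB.
    + exact: (pairing_measurable T0 N0 mO kN zT gL).
    + exact: (pairing_measurable T0 N0 mO kN dzT g'L).
  have FF : Filter (nbhs (almost_everywhere dt)) by exact: ae_filter_ringOfSetsType.
  move: eqn ae_L2fields; apply: (@filterS2 _ _ FF) => t h1 h2 It.
  have t0T := Ik_sub T0 N0 kN It.
  rewrite -(h1 t0T y Yy) (g'E _ (h2 t0T)) -gE ?inE// addrC.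
  by [].
rewrite RintegralB//.
rewrite (represents_increment T0 N0 mO zL dzT zdz kN g'D).
rewrite (linear_onB (represents_linear mO g'D)); last 2 first.
- by apply: zL; rewrite knot_ge0//= knot_leT.
- by apply: zL; rewrite knot_ge0//= knot_leT// ltnW.
rewrite opprB addrC; congr (_ + _).
by apply: eq_Rintegral => t tI; rewrite -gE.
Qed.

End interval_equation.

(** * Error of the scheme *)

Section error_estimate.
Variables (R : realType) (n : nat) (D : geometry R n) (c : coefficients R n).
Local Notation O := (Om D).
Hypotheses (mO : measurable O) (hc : coefficients_ok D c).
Variables (H : discretization R n) (hH : discretization_ok D c H).
Variables (T s : R).
Hypotheses (T0 : 0 < T) (s01 : 0 <= s <= 1).
Local Notation dx := (leb R n.+1).
Local Notation dt := (@lebesgue_measure R).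
Local Notation dtdx := (@lebesgue_measure R \x leb R n.+1)%E.
Local Notation scalar_fun := (scalar_fun R n).
Local Notation fields := (fields R n).
Local Notation L2F := (@L2fields R n O).
Local Notation M := (@evolution_form R n D c).
Local Notation K := (@diffusion_form R n D c).
Local Notation index := ('I_n.+1 + bool)%type.
Local Notation values := (index -> scalar_fun).

Lemma ip_sum_le (f g h : scalar_fun) : L2 O f -> L2 O g ->
  (forall t, h t = f t + g t) -> ip O h h <= 2 * ip O f f + 2 * ip O g g.
Proof.
move=> fL gL hE; have -> : h = f + g by apply/funext.
exact: (semi_innerD_le (sqint_subspace dx mO) (ipm_semi_inner dx mO) fL gL).
Qed.

Lemma nsqB_le P x y z : L2F x -> L2F y -> L2F z ->
  nsq O P (x - z) <= 2 * nsq O P (x - y) + 2 * nsq O P (y - z).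
Proof.
move=> xL yL zL; have Xs := L2fields_subspace mO.
have := subspaceB Xs xL yL; have := subspaceB Xs yL zL.
rewrite /nsq !mulr_sumr -big_split/= => hyz hxy; apply: ler_sum => j _.
apply: (ip_sum_le (hxy j) (hyz j)) => t.
rewrite (entryB x z) (entryB x y) (entryB y z).
by rewrite addrA subrK.
Qed.

Lemma nsqC P x y : nsq O P (x - y) = nsq O P (y - x).
Proof.
by apply: eq_bigr => j _; apply: eq_Rintegral => t _; rewrite !entryB; ring.
Qed.

Lemma sqr_sum_le (I : finType) (f : I -> R) :
  (\sum_i f i) ^+ 2 <= #|I|%:R * \sum_i f i ^+ 2.
Proof.
apply: discriminant_le; first by apply: sumr_ge0 => i _; exact: sqr_ge0.
move=> t; rewrite (_ : _ + _ = \sum_i (1 + t * f i) ^+ 2).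
  by apply: sumr_ge0 => i _; exact: sqr_ge0.
have -> : #|I|%:R = \sum_(i : I) 1 :> R by rewrite sumr_const.
by rewrite !mulr_sumr -!big_split/=; apply: eq_bigr => i _; ring.
Qed.

Section fixed_grid.
Variable N : nat.
Hypothesis N0 : (0 < N)%N.
Local Notation tau := (tau T N).
Local Notation Ik := (Ik T N).

Let mIk k : measurable (Ik k : set (measurableTypeR R)).
Proof. exact: measurable_itv. Qed.

Let dtIk k : dt (Ik k) = tau%:E.
Proof. by rewrite itv_measure ?knotS// knot_le. Qed.

Let Ikfin k : (dt (Ik k) < +oo)%E. Proof. by rewrite dtIk ltry. Qed.

Lemma mean_value_le k (f : R -> R) v B : dt.-integrable (Ik k) (EFin \o f) ->
  (forall t, Ik k t -> `|f t - v| <= B) ->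
  `|\int[dt]_(t in Ik k) f t - tau * v| <= tau * B.
Proof.
move=> fi fB.
have ci w : dt.-integrable (Ik k) (EFin \o cst w).
  rewrite (_ : EFin \o _ = fun t => (cst w t * cst 1 t)%:E).
    exact: (sqint_integrable (mIk k) (sqint_cst w (mIk k) (Ikfin k)) (sqint_cst 1 (mIk k) (Ikfin k))).
  by apply/funext => t; rewrite /= mulr1.
have E w : \int[dt]_(t in Ik k) (cst w t) = tau * w.
  by rewrite Rintegral_cst// [X in fine X]dtIk mulrC.
have bi : dt.-integrable (Ik k) (EFin \o (fun t => f t - cst v t)).
  exact: (integrableB (mIk k) fi (ci v)).
rewrite -(E v) -RintegralB// (le_trans (le_normr_Rintegral (mIk k) bi))// -(E B).
by apply: le_Rintegral => //; exact: (integrable_norm bi).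
Qed.

Section loads_bound.
Variables (a b e : R).
Definition total_weight : R := `|a| + `|b| + `|e|.

Lemma total_weight_ge0 : 0 <= total_weight.
Proof. by rewrite !addr_ge0. Qed.

Lemma loads_le y j : L2F y ->
  Num.sqrt (ip O (loads a b e y j) (loads a b e y j)) <= total_weight * weak_norm D y.
Proof.
move=> yL; have vL : L2 O (value y j) by exact: (yL (j, None)).
rewrite -[total_weight]ger0_norm ?total_weight_ge0// -sqrtr_sqr -sqrtrM ?sqr_ge0// ler_wsqrtr//.
pose w := match j with inl _ => a | inr false => - b | inr true => - e end.
have -> : ip O (loads a b e y j) (loads a b e y j) = w ^+ 2 * ip O (value y j) (value y j).
  rewrite /ip -RintegralZl//; last exact: (sqint_integrable mO vL vL).
  by apply: eq_Rintegral => x _; rewrite /loads -/w; ring.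
apply: ler_pM => //.
- exact: sqr_ge0.
- exact: ipm_ge0.
- rewrite -[leLHS]real_normK ?num_real// ler_sqr ?nnegrE ?total_weight_ge0//.
  rewrite /w /total_weight; case: (j) => [_|[]]; rewrite ?normrN.
  + by rewrite -addrA lerDl addr_ge0.
  + by rewrite lerDr addr_ge0.
  + by rewrite -addrA addrCA lerDl addr_ge0.
- by have := @ip_le_nsq _ _ O (@weak_slot n) y (j, None); apply; case: (j).
Qed.

Variables (Uh : nat -> values) (U : R -> values).
Hypotheses (hU : forall k, (k < N)%N -> forall j, L2 O (Uh k j))
  (UT : forall j, L2L2 T O (U ^~ j)).

Definition source_error k j : R := ipm dtdx (Ik k `*` O)
  (uncurried (fun t x => Uh k j x - U t j x)) (uncurried (fun t x => Uh k j x - U t j x)).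

Definition source_residual k y : R := \sum_j \int[dtdx]_(x in Ik k `*` O)
  ((Uh k j x.2 - U x.1 j x.2) * loads a b e y j x.2).

(** Normalized so that [tau] times its square adds up, over the grid, to the
    squared distance between the discrete and the continuous sources. *)
Definition source_rate k : R :=
  total_weight * (\sum_j Num.sqrt (source_error k j)) / Num.sqrt tau.

Lemma source_rate_ge0 k : 0 <= source_rate k.
Proof.
rewrite divr_ge0 ?sqrtr_ge0// mulr_ge0 ?total_weight_ge0//.
by apply: sumr_ge0 => j _; exact: sqrtr_ge0.
Qed.

Lemma source_residual_le k y : (k < N)%N -> L2F y ->
  `|source_residual k y| <= tau * source_rate k * weak_norm D y.
Proof.
move=> kN yL; have st : 0 < Num.sqrt tau by rewrite sqrtr_gt0 tau_gt0.
have -> : tau * source_rate k * weak_norm D y =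
  \sum_j Num.sqrt (source_error k j) * (Num.sqrt tau * (total_weight * weak_norm D y)).
  rewrite -mulr_suml /source_rate -{1}(sqr_sqrtr (ltW (tau_gt0 T0 N0))); field.
  by rewrite gt_eqF.
apply: le_trans (ler_norm_sum _ _ _) _; apply: ler_sum => j _.
have := ip_time_cs mO (knotS T0 N0 k) (sqint_Ik_diff T0 N0 mO kN (hU kN j) (UT j)) (loads_L2 mO a b e yL j).
rewrite knot_le => /le_trans; apply.
by rewrite ler_wpM2l ?sqrtr_ge0// ler_wpM2l ?sqrtr_ge0//; exact: loads_le.
Qed.

Lemma source_rate_sum :
  \sum_(0 <= k < N) tau * source_rate k ^+ 2 <=
  total_weight ^+ 2 * #|{: index}|%:R *
   \sum_j L2L2_dist T O (pw_const T N (fun k => Uh k j)) (U ^~ j) ^+ 2.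
Proof.
have -> : \sum_j L2L2_dist T O (pw_const T N (fun k => Uh k j)) (U ^~ j) ^+ 2 =
  \sum_(0 <= k < N) \sum_j source_error k j.
  rewrite exchange_big/=; apply: eq_bigr => j _.
  by rewrite (L2L2_dist_grid T0 N0 mO)// => k kN; exact: hU.
rewrite mulr_sumr; apply: ler_sum_nat => k /andP[_ kN].
have st : 0 < Num.sqrt tau by rewrite sqrtr_gt0 tau_gt0.
have -> : tau * source_rate k ^+ 2 = total_weight ^+ 2 * (\sum_j Num.sqrt (source_error k j)) ^+ 2.
  rewrite /source_rate -{1}(sqr_sqrtr (ltW (tau_gt0 T0 N0))); field.
  by rewrite gt_eqF.
rewrite -mulrA ler_wpM2l ?sqr_ge0//; apply: le_trans (sqr_sum_le _) _.
rewrite ler_wpM2l//; apply: ler_sum => j _.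
by rewrite sqr_sqrtr//; exact: ipm_ge0.
Qed.

End loads_bound.
End fixed_grid.

Variables (z dz : R -> fields) (U G : R -> values) (a b e : R).
Definition trial_fields : set fields :=
  [set y | [/\ spV D (displacement y), spQ D (pressure y) & spPsi D (temperature y)]].

Hypotheses (zV : forall t, 0 <= t <= T -> trial_fields (z t))
  (zT : forall j, L2L2 T O (fun t => entry (z t) j))
  (dzT : forall j, L2L2 T O (fun t => entry (dz t) j))
  (zdz : forall j, time_deriv T O (fun t => entry (z t) j) (fun t => entry (dz t) j))
  (mreg : measurable_fun `[0, T] (fun t => regularity O s (z t)))
  (ireg : (\int[dt]_(t in `[0%R, T]) regularity O s (z t) < +oo)%E)
  (UT : forall j, L2L2 T O (U ^~ j)) (GT : forall j, L2L2 T O (G ^~ j)).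
Hypothesis eqn : aet T (fun t => forall y, trial_fields y ->
  - M (dz t) y + K (z t) y = pairing O (fun t j x => U t j x - G t j x) (loads a b e y) t).

Let zL t : 0 <= t <= T -> L2F (z t).
Proof. by move=> /zV[h1 h2 h3]; exact: spaces_L2fields. Qed.

Let trialL : trial_fields `<=` L2F.
Proof. by move=> y [h1 h2 h3]; exact: spaces_L2fields. Qed.

Let discrete_trial (i : fam H) : discrete_fields i `<=` trial_fields.
Proof.
by move=> y [h1 h2 h3]; split; [exact: (Vh_spV hH h1)|exact: (Qh_spQ hH h2)|exact: (Psih_spPsi hH h3)].
Qed.

Let reg_ge0 t : (0 <= regularity O s (z t))%E.
Proof.
rewrite adde_ge0//; first by apply: sume_ge0 => i _; exact: H1s_sq_ge0.
by rewrite adde_ge0//; exact: H1s_sq_ge0.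
Qed.

Let total_reg : R := fine (\int[dt]_(t in `[0%R, T]) regularity O s (z t))%E.
Let total_var : R := \sum_j ipm dtdx (QT T O)
    (uncurried (fun t => entry (dz t) j)) (uncurried (fun t => entry (dz t) j)).

Let total_reg_ge0 : 0 <= total_reg.
Proof. by apply: fine_ge0; exact: integral_ge0. Qed.

Let total_var_ge0 : 0 <= total_var.
Proof. by apply: sumr_ge0 => j _; exact: ipm_ge0. Qed.

(** On each interval, a time at which the [H^(1+s)] norm is finite and about its
    mean. Projecting the solution at these times requires its spatial regularity
    in the mean only. *)
Lemma good_times N : (0 < N)%N -> exists sg rg : nat -> R,
  [/\ forall k, (k < N)%N -> Ik T N k (sg k),
      forall k, (k < N)%N -> (regularity O s (z (sg k)) <= (rg k)%:E)%E &
      \sum_(0 <= k < N) tau T N * rg k = total_reg + T].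
Proof.
move=> N0; pose Iint k := (\int[dt]_(t in Ik T N k) regularity O s (z t))%E.
have sum_e := integral_grid T0 N0 mreg reg_ge0.
have I0 k : (0 <= Iint k)%E by exact: integral_ge0.
have Ifin k : (k < N)%N -> (Iint k < +oo)%E.
  move=> kN; apply: le_lt_trans ireg; apply: ge0_subset_integral; [exact: measurable_itv|exact: measurable_itv|exact: mreg| |exact: (Ik_sub T0 N0 kN)].
  by move=> t _; exact: reg_ge0.
have tau0 := tau_gt0 T0 N0.
have If k : (k < N)%N -> (Iint k = (fine (Iint k))%:E)%E.
  by move=> kN; rewrite fineK// ge0_fin_numE//; exact: Ifin.
have ex k : exists t, (k < N)%N -> Ik T N k t /\
    (regularity O s (z t) <= (fine (Iint k) / tau T N + 1)%:E)%E.
  have [kN|_] := ltnP k N; last by exists 0.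
  have mk : measurable_fun (Ik T N k) (fun t => regularity O s (z t)).
    by apply: measurable_funS mreg => //; exact: (Ik_sub T0 N0 kN).
  have [t It ht] := good_time T0 N0 kN mk reg_ge0 (Ifin k kN).
  exists t => _; split => //.
  rewrite -(@lee_pmul2l _ (tau T N)%:E)// ?lte_fin//.
  apply: le_trans ht _; rewrite -/(Iint k) If// -EFinD -EFinM lee_fin.
  by rewrite mulrDr mulr1 mulrC mulfVK// gt_eqF.
have [sg sgP] := choice ex.
exists sg, (fun k => fine (Iint k) / tau T N + 1); split.
- by move=> k /sgP[].
- by move=> k /sgP[].
transitivity (\sum_(0 <= k < N) (fine (Iint k) + tau T N)).
  by apply: eq_bigr => k _; rewrite mulrDr mulr1 mulrC mulfVK// gt_eqF.
rewrite big_split/= sumr_const_nat subn0 -[tau T N *+ N]mulr_natl natr_tau//; congr (_ + _).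
apply: EFin_inj; rewrite -sumEFin fineK; last by rewrite ge0_fin_numE//; exact: integral_ge0.
by rewrite sum_e; apply: eq_big_nat => k /andP[_ kN]; rewrite -If.
Qed.



Section scheme.
Variables (i : fam H) (N : nat) (zh : nat -> fields) (Uh : nat -> values).
Hypotheses (N0 : (0 < N)%N) (hz : forall k, (k <= N)%N -> discrete_fields i (zh k))
  (hU : forall k, (k < N)%N -> forall j, L2 O (Uh k j))
  (hN : nsq O (@weak_slot n) (zh N - z T) = 0).
Local Notation tau := (tau T N).
Local Notation Ik := (Ik T N).
Hypothesis hstep : forall k, (k < N)%N -> forall y, discrete_fields i y ->
  M (zh k) y - M (zh k.+1) y + tau * K (zh k) y =
  \sum_j \int[dtdx]_(x in Ik k `*` O) ((Uh k j x.2 - G x.1 j x.2) * loads a b e y j x.2).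

Let zk k := z (k%:R * tau).
Let zkL k : (k <= N)%N -> L2F (zk k).
Proof. by move=> kN; apply: zL; rewrite knot_ge0//= knot_leT. Qed.

Let zhL k : (k <= N)%N -> L2F (zh k).
Proof. by move=> kN; exact: (discrete_fields_L2 hH (hz kN)). Qed.

Let Ml y : discrete_fields i y -> linear_on L2F (M ^~ y).
Proof. by move=> hy; exact: (L2_bilinear_linl mO (evolution_bilinear mO hc) (discrete_fields_L2 hH hy)). Qed.

Let Kl y : discrete_fields i y -> linear_on L2F (K ^~ y).
Proof. by move=> hy; exact: (L2_bilinear_linl mO (diffusion_bilinear c mO) (discrete_fields_L2 hH hy)). Qed.

Definition source_diff k y := source_residual N a b e Uh U k y.

(** The discrete equation minus the one integrated over the interval. *)
Lemma error_step P k y : (k < N)%N -> discrete_fields i y -> L2F P ->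
  M (zh k - zk k) y - M (zh k.+1 - zk k.+1) y + tau * K (zh k - P) y
  = source_diff k y + (diffusion_integral D c T N z k y - tau * K P y).
Proof.
move=> kN hy PL; have yL := discrete_fields_L2 hH hy.
have kN' := ltnW kN.
rewrite (linear_onB (Ml hy) (zhL kN') (zkL kN')) (linear_onB (Ml hy) (zhL kN) (zkL kN)).
rewrite (linear_onB (Kl hy) (zhL kN') PL).
have FT j : L2L2 T O (fun t x => U t j x - G t j x) by exact: (L2L2B mO (UT j) (GT j)).
have := interval_equation mO hc T0 N0 zL zT dzT zdz FT trialL eqn kN (discrete_trial hy).
have := hstep kN hy; rewrite -/(zk k) -/(zk k.+1).
set S1 := \sum_j _; set S2 := \sum_j _ => e1 e2.
have -> : source_diff k y = S1 - S2; last by move: e1 e2; rewrite /=; lra.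
rewrite /source_diff /source_residual /S1 /S2 -sumrB; apply: eq_bigr => j _.
have mIO : measurable (Ik k `*` O : set (measurableTypeR R * 'rV[R]_n.+1)).
  by apply: measurableX => //; exact: measurable_itv.
have Ifin : (dt (Ik k) < +oo)%E by rewrite itv_measure ?knotS// ltry.
have mI : measurable (Ik k : set (measurableTypeR R)) by exact: measurable_itv.
have [lI _] := sqint_const_time mI mO Ifin (loads_L2 mO a b e yL j).
rewrite -RintegralB//.
- by apply: eq_Rintegral => x _; ring.
- exact: (sqint_integrable mIO (sqint_Ik_diff T0 N0 mO kN (hU kN j) (GT j)) lI).
- exact: (sqint_integrable mIO (sqint_Ik T0 N0 mO kN (FT j)) lI).
Qed.

Section constants.
Variables (Cs Bm Bk Cp : R).
Hypotheses (Cs0 : 0 < Cs) (Bm0 : 0 <= Bm) (Bk0 : 0 <= Bk) (Cp0 : 0 < Cp).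
Hypothesis stab : forall x (f : R), discrete_fields i x -> 0 <= f ->
  (forall y, discrete_displacements i y -> `|M x y| <= f * weak_norm D y) ->
  weak_norm D x ^+ 2 <= Cs * (M x x + f ^+ 2).
Hypothesis Mbd : forall x y, L2F x -> L2F y -> `|M x y| <=
  Bm * (Num.sqrt (nsq O (@weak_slot n) x) * Num.sqrt (nsq O (@weak_slot n) y)).
Hypothesis Kbd : forall x y, L2F x -> L2F y -> `|K x y| <=
  Bk * (Num.sqrt (nsq O predT x) * Num.sqrt (nsq O predT y)).
Hypothesis proj : forall (y : fields) (r : R), spV D (displacement y) ->
  spQ D (pressure y) -> spPsi D (temperature y) -> (regularity O s y <= r%:E)%E ->
  exists P : fields, [/\ discrete_fields i P,
      forall x, discrete_fields i x -> K P x = K y x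
    & nsq O predT (y - P) <= Cp * (hsz i `^ s) ^+ 2 * r].

Let h2 := (hsz i `^ s) ^+ 2.
Let Sq := \sum_j L2L2_dist T O (pw_const T N (fun k => Uh k j)) (U ^~ j) ^+ 2.
Let W := total_weight a b e.
Let vr := variation T N O dz.

Definition error_const1 : R := euler_const Cs T *
  (Bm ^+ 2 * (2 * Cp * (total_reg + T) + 2 * total_var) + W ^+ 2 * #|{: index}|%:R + Bk * total_var).

Definition error_const : R :=
  2 * error_const1 + 4 * Cp * (total_reg + T) + 4 * total_var.

(** The comparison sequence is the projection of the solution at the good times.
    Its distance to the solution at any time of the interval is that of the
    projection, of order [h^s], plus an increment over the interval, of order
    [tau] after summation. The same increment bounds the defect of the diffusion
    term, because the projection has exactly the diffusion of the solution at the
    good time. *)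
Lemma scheme_error j :
  L2L2_dist T O (pw_const T N (fun k => value (zh k) (inr j)))
    (fun t => value (z t) (inr j)) ^+ 2
  <= error_const * (h2 + tau ^+ 2 + Sq).
Proof.
have tau0 := tau_gt0 T0 N0.
have [sg [rg [sgI sgreg rgsum]]] := good_times N0.
have zs k : (k < N)%N -> trial_fields (z (sg k)).
  by move=> kN; apply: zV; exact: (Ik_range T0 N0 kN (sgI k kN)).
have exP k : exists P : fields, (k < N)%N -> [/\ discrete_fields i P,
      forall x, discrete_fields i x -> K P x = K (z (sg k)) x
    & nsq O predT (z (sg k) - P) <= Cp * h2 * rg k].
  have [kN|_] := ltnP k N; last by exists 0.
  have [v1 v2 v3] := zs k kN.
  by have [P PP] := proj v1 v2 v3 (sgreg k kN); exists P.
have [P PP] := choice exP.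
have Ph k : (k < N)%N -> discrete_fields i (P k) by move=> /PP[].
have PL k : (k < N)%N -> L2F (P k) by move=> kN; exact: (discrete_fields_L2 hH (Ph k kN)).
have zsL k : (k < N)%N -> L2F (z (sg k)) by move=> kN; exact: (trialL (zs k kN)).
have L2s := L2fields_subspace mO.
have sgk k : (k < N)%N -> k%:R * tau <= sg k <= k.+1%:R * tau.
  by move=> kN; have /mem_Ik/andP[q1 q2] := sgI k kN; rewrite (ltW q1).
have vr0 k : 0 <= vr k by exact: variation_ge0.
have incr t k : (k < N)%N -> k%:R * tau <= t <= k.+1%:R * tau ->
    nsq O predT (P k - z t) <= 2 * (Cp * h2 * rg k) + 2 * (tau * vr k).
  move=> kN tk; have tT : 0 <= t <= T.
    case/andP: tk => q1 q2.
    by rewrite (le_trans (knot_ge0 T0 N0 k) q1) (le_trans q2 (knot_leT T0 N0 kN)).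
  have A1 : nsq O predT (P k - z (sg k)) <= Cp * h2 * rg k.
    by rewrite (nsqC predT (P k)); have [_ _] := PP k kN.
  have A2 : nsq O predT (z (sg k) - z t) <= tau * vr k.
    exact: (increment_nsq T0 N0 mO zL dzT zdz predT kN (sgk k kN) tk).
  apply: le_trans (nsqB_le _ (PL k kN) (zsL k kN) (zL tT)) _.
  by apply: lerD; apply: ler_wpM2l; [exact: ler0n|exact: A1|exact: ler0n|exact: A2].
pose lam k := Num.sqrt (Bk * (tau * vr k)).
pose del k := Bm * Num.sqrt (nsq O predT (P k - zk k)).
pose eps := source_rate N a b e Uh U.
pose cns k y := diffusion_integral D c T N z k y - tau * K (P k) y.
have KSI : semi_inner L2F K := diffusion_semi_inner mO hc.
have core := @implicit_euler_estimate R fields L2F (discrete_fields i) (discrete_displacements i)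
  L2s (discrete_fields_subspace hH i) (discrete_fields_L2 hH (i := i)) (discrete_displacements_sub hH (i := i))
  M K (weak_norm D) Ml (semi_innerS (discrete_fields_L2 hH (i := i)) KSI)
  (fun x => sqrtr_ge0 _) _ Cs T tau N Cs0 tau0 (natr_tau T N0) stab zk zh P source_diff cns eps lam del
  zkL hz Ph _ _ _ _ _ _ _ (fun k => sqrtr_ge0 _) _.
have {}core : \sum_(0 <= k < N) tau * weak_norm D (zh k - P k) ^+ 2 <=
  euler_const Cs T * \sum_(0 <= k < N) tau * (del k ^+ 2 + eps k ^+ 2 + lam k ^+ 2).
  apply: core.
  - move=> y [_ e1 e2]; rewrite /diffusion_form e1 e2 /a_p /a_th /a_kap.
    have Z kap : \int[dx]_(x in O) (\sum_i0 (\sum_j0 kap i0 j0 * (0 : jet R n).2 j0 x) * (0 : jet R n).2 i0 x) = 0.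
      rewrite -[RHS](linear_on0 (sqint_subspace dx mO) (ip_linr mO (sqint_subspace dx mO).1)).
      apply: eq_Rintegral => x _; rewrite mulr0 big1// => i0 _; exact: mulr0.
    by rewrite !Z addr0.
  - move=> y hy; have yL := discrete_fields_L2 hH hy.
    have zN : zk N = z T by rewrite /zk (natr_tau T N0).
    have dL := subspaceB L2s (zhL (leqnn N)) (zkL (leqnn N)).
    have := Mbd dL yL.
    rewrite zN hN sqrtr0 mul0r mulr0 normr_le0 => /eqP.
    by [].
  - by move=> k kN y hy; exact: (error_step kN hy (PL k kN)).
  - move=> k kN r x y hx hy; rewrite /cns.
    have xL := discrete_fields_L2 hH hx; have yL := discrete_fields_L2 hH hy.
    rewrite (diffusion_integral_linear c mO T0 N0 zL zT kN)//.
    rewrite (semi_inner_linr L2s KSI (PL k kN) r xL yL); ring.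
  - move=> k kN y hy; exact: (source_residual_le N0 a b e hU UT kN (discrete_fields_L2 hH hy)).
  - move=> k kN y hy; have yL := discrete_fields_L2 hH hy.
    rewrite /cns; have [_ -> // _] := PP k kN.
    rewrite -mulrA; apply: (mean_value_le N0 (diffusion_integrable c mO T0 N0 zL zT kN yL)) => t It.
    have tT := Ik_range T0 N0 kN It.
    have tk : k%:R * tau <= t <= k.+1%:R * tau by have /mem_Ik/andP[q1 q2] := It; rewrite (ltW q1).
    have dL := subspaceB L2s (zL tT) (zsL k kN).
    rewrite -(linear_onB (Kl hy) (zL tT) (zsL k kN)).
    apply: le_trans (cauchy_schwarz_sqrt L2s KSI dL yL) _.
    rewrite ler_wpM2r ?sqrtr_ge0// ler_wsqrtr//.
    apply: le_trans (ler_norm _) _; apply: le_trans (Kbd dL dL) _.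
    rewrite -expr2 sqr_sqrtr ?nsq_ge0// ler_wpM2l//.
    exact: (increment_nsq T0 N0 mO zL dzT zdz predT kN tk (sgk k kN)).
  - move=> k kN y hy; have yL := discrete_fields_L2 hH hy.
    have dL := subspaceB L2s (PL k kN) (zkL (ltnW kN)).
    apply: le_trans (Mbd dL yL) _; rewrite /del mulrA ler_wpM2r ?sqrtr_ge0//.
    by rewrite ler_wpM2l// ler_wsqrtr//; exact: nsq_weak_le.
  - by move=> k; exact: source_rate_ge0.
  - by move=> k; rewrite mulr_ge0// sqrtr_ge0.
have rsum : \sum_(0 <= k < N) tau * rg k = total_reg + T by [].
have vsum : \sum_(0 <= k < N) vr k = total_var by exact: sum_variation.
have h20 : 0 <= h2 by exact: sqr_ge0.
have Sq0 : 0 <= Sq by apply: sumr_ge0 => l _; exact: sqr_ge0.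
have J0 : 0 <= total_reg + T by rewrite addr_ge0// ltW.
have V0 := total_var_ge0.
have dsum : \sum_(0 <= k < N) tau * del k ^+ 2 <=
    Bm ^+ 2 * (2 * Cp * h2 * (total_reg + T) + 2 * tau ^+ 2 * total_var).
  rewrite -rsum -vsum !mulr_sumr -big_split/= mulr_sumr; apply: ler_sum_nat => k /andP[_ kN].
  rewrite /del exprMn sqr_sqrtr ?nsq_ge0//.
  have kk : k%:R * tau <= k%:R * tau <= k.+1%:R * tau by rewrite lexx knotS.
  have := incr _ _ kN kk => h.
  have := ler_wpM2l (mulr_ge0 (ltW tau0) (sqr_ge0 Bm)) h; rewrite -/(zk k); lra.
have lsum : \sum_(0 <= k < N) tau * lam k ^+ 2 = Bk * total_var * tau ^+ 2.
  rewrite -vsum mulr_sumr mulr_suml; apply: eq_bigr => k _.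
  rewrite /lam sqr_sqrtr; first ring.
  by rewrite mulr_ge0// mulr_ge0// ltW.
have esum : \sum_(0 <= k < N) tau * eps k ^+ 2 <= W ^+ 2 * #|{: index}|%:R * Sq.
  exact: (source_rate_sum N0 a b e hU UT).
have core2 : \sum_(0 <= k < N) tau * weak_norm D (zh k - P k) ^+ 2 <=
    error_const1 * (h2 + tau ^+ 2 + Sq).
  apply: le_trans core _; rewrite /error_const1 -mulrA ler_wpM2l//.
    have A0 : 0 <= Cs ^+ 2 + 2 * Cs by rewrite addr_ge0 ?sqr_ge0// mulr_ge0// ltW.
    rewrite /euler_const addr_ge0//; first by rewrite !mulr_ge0// addr_ge0// sqr_ge0.
    by rewrite !mulr_ge0// ltW.
  rewrite (eq_bigr (fun k => tau * del k ^+ 2 + (tau * eps k ^+ 2 + tau * lam k ^+ 2))); last first.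
    by move=> k _; ring.
  rewrite !big_split/= lsum.
  set W2 := W ^+ 2 * #|{: index}|%:R in esum *.
  have W20 : 0 <= W2 by rewrite mulr_ge0 ?sqr_ge0.
  have B20 : 0 <= Bm ^+ 2 by exact: sqr_ge0.
  have t20 : 0 <= tau ^+ 2 by exact: sqr_ge0.
  have BC : 0 <= Bm ^+ 2 * (2 * Cp * (total_reg + T)) by rewrite !mulr_ge0// ltW.
  have BV : 0 <= Bm ^+ 2 * (2 * total_var) by rewrite !mulr_ge0.
  have KV : 0 <= Bk * total_var by rewrite mulr_ge0.
  have p1 := mulr_ge0 BC t20; have p2 := mulr_ge0 BC Sq0.
  have p3 := mulr_ge0 BV h20; have p4 := mulr_ge0 BV Sq0.
  have p5 := mulr_ge0 W20 h20; have p6 := mulr_ge0 W20 t20.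
  have p7 := mulr_ge0 KV h20; have p8 := mulr_ge0 KV Sq0.
  move: dsum esum; lra.
have vzT : L2L2 T O (fun t => value (z t) (inr j)) by exact: (zT (inr j, None)).
have vzh k : (k < N)%N -> L2 O (value (zh k) (inr j)).
  by move=> kN; exact: (zhL (ltnW kN) (inr j, None)).
rewrite (L2L2_dist_grid T0 N0 mO vzh vzT).
have bnd k : (k < N)%N -> ipm dtdx (Ik k `*` O)
    (uncurried (fun t x => value (zh k) (inr j) x - value (z t) (inr j) x))
    (uncurried (fun t x => value (zh k) (inr j) x - value (z t) (inr j) x)) <=
   tau * (2 * weak_norm D (zh k - P k) ^+ 2 + 2 * (2 * (Cp * h2 * rg k) + 2 * (tau * vr k))).
  move=> kN; apply: (ipm_Ik_le T0 N0 mO kN (vzh k kN) vzT) => t It.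
  have tT := Ik_range T0 N0 kN It.
  have tk : k%:R * tau <= t <= k.+1%:R * tau by have /mem_Ik/andP[q1 q2] := It; rewrite (ltW q1).
  apply: (@le_trans _ _ (nsq O (@weak_slot n) (zh k - z t))).
    have := @ip_le_nsq _ _ O (@weak_slot n) (zh k - z t) (inr j, None) isT.
    by congr (_ <= _); apply: eq_Rintegral => x _; rewrite !entryB.
  apply: le_trans (nsqB_le _ (zhL (ltnW kN)) (PL k kN) (zL tT)) _.
  rewrite weak_norm_sq; apply: lerD; first exact: lexx.
  apply: ler_wpM2l; first exact: ler0n.
  by apply: le_trans (nsq_weak_le O _) _; exact: (incr t k kN tk).
apply: (@le_trans _ _ (2 * (error_const1 * (h2 + tau ^+ 2 + Sq))
   + 4 * Cp * (total_reg + T) * h2 + 4 * total_var * tau ^+ 2)).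
  apply: (@le_trans _ _ (2 * (\sum_(0 <= k < N) tau * weak_norm D (zh k - P k) ^+ 2)
     + 4 * Cp * (total_reg + T) * h2 + 4 * total_var * tau ^+ 2)); last first.
    by rewrite !lerD2r ler_pM2l.
  rewrite -rsum -vsum !mulr_sumr !mulr_suml -!big_split/=.
  apply: ler_sum_nat => k /andP[_ kN]; apply: le_trans (bnd k kN) _.
  by rewrite le_eqVlt; apply/orP; left; apply/eqP; ring.
rewrite /error_const.
have t20 : 0 <= tau ^+ 2 by exact: sqr_ge0.
have CJ : 0 <= 4 * Cp * (total_reg + T) by rewrite !mulr_ge0// ltW.
have V4 : 0 <= 4 * total_var by rewrite mulr_ge0.
have p1 := mulr_ge0 CJ t20; have p2 := mulr_ge0 CJ Sq0.
have p3 := mulr_ge0 V4 h20; have p4 := mulr_ge0 V4 Sq0.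
lra.
Qed.

End constants.
End scheme.
End error_estimate.

(** * The adjoint problem as an instance *)

Section instantiation.
Variables (R : realType) (n : nat).
Local Notation dx := (leb R n.+1).
Local Notation dt := (@lebesgue_measure R).
Local Notation dtdx := (@lebesgue_measure R \x leb R n.+1)%E.
Local Notation scalar_fun := (scalar_fun R n).
Local Notation jet := (jet R n).
Local Notation vjet := (vjet R n).
Local Notation index := ('I_n.+1 + bool)%type.

Definition values_of (u : 'I_n.+1 -> scalar_fun) (p th : scalar_fun) : index -> scalar_fun :=
  fun j => match j with inl l => u l | inr false => p | inr true => th end.

Lemma sum_index (F : index -> R) : \sum_j F j = \sum_l F (inl l) + (F (inr false) + F (inr true)).
Proof. by rewrite big_sumType/= big_bool/= [X in _ + X]addrC. Qed.

Variables (T : R) (O : set 'rV[R]_n.+1).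
Hypothesis mO : measurable O.

Lemma vip_sum (f g : 'I_n.+1 -> scalar_fun) : (forall l, L2 O (f l)) -> (forall l, L2 O (g l)) ->
  vip O f g = \sum_l ip O (f l) (g l).
Proof. by move=> fL gL; apply: Rintegral_sum => // l; exact: (sqint_integrable mO (fL l) (gL l)). Qed.

(** Unfolds the load of the combined equation into those of the three
    equations. *)
Lemma pairing_loads (a b e : R) (u : 'I_n.+1 -> scalar_fun) (p th : scalar_fun) (y : fields R n) :
  (forall l, L2 O (u l)) -> L2 O p -> L2 O th -> L2fields O y ->
  \sum_j ip O (values_of u p th j) (loads a b e y j) =
  a * vip O u (vval (displacement y)) - b * ip O p (pressure y).1 - e * ip O th (temperature y).1.
Proof.
move=> uL pL thL yL; have vs := sqint_subspace dx mO.
have h j w f : L2 O f -> ip O f (fun x => w * value y j x) = w * ip O f (value y j).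
  by move=> fL; exact: (linear_onZ vs (ip_linr mO fL) w (yL (j, None))).
rewrite vip_sum//; last by move=> l; exact: (yL (inl l, None)).
rewrite sum_index /loads/= !h// mulr_sumr !mulNr addrA; congr (_ + _ + _).
by apply: eq_bigr => l _; rewrite h.
Qed.

Lemma vL2L2_dist_sq (f g : R -> 'I_n.+1 -> scalar_fun) :
  (forall l, L2L2 T O (f ^~ l)) -> (forall l, L2L2 T O (g ^~ l)) ->
  vL2L2_dist T O f g ^+ 2 = \sum_l L2L2_dist T O (f ^~ l) (g ^~ l) ^+ 2.
Proof.
move=> fL gL.
have mQT : measurable (QT T O : set (measurableTypeR R * 'rV[R]_n.+1)).
  by apply: measurableX => //; exact: measurable_itv.
rewrite /vL2L2_dist sqr_sqrtr; last first.
  by apply: Rintegral_ge0 => z _; apply: sumr_ge0 => l _; exact: sqr_ge0.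
rewrite (Rintegral_sum mQT) => [|l]; last first.
  have h := L2L2B mO (fL l) (gL l).
  exact: (sqint_integrable mQT h h).
apply: eq_bigr => l _; rewrite /L2L2_dist sqr_sqrtr//.
by apply: Rintegral_ge0 => z _; exact: sqr_ge0.
Qed.

(** The discrete and the continuous final values vanish almost everywhere, so
    that their difference has no mass. *)
Lemma jet_ae_eq0_ip (j k : jet) o : (forall o, L2 O (jet_entry j o)) -> (forall o, L2 O (jet_entry k o)) ->
  jet_ae_eq O j 0 -> jet_ae_eq O k 0 ->
  ip O (jet_entry (j - k) o) (jet_entry (j - k) o) = 0.
Proof.
move=> jL kL j0 k0.
have vs := sqint_subspace dx mO.
have dL : L2 O (jet_entry (j - k) o).
  by have := subspaceB vs (jL o) (kL o); congr (L2 O _); case: o.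
rewrite -[RHS](linear_on0 vs (ip_linr mO vs.1)); apply: ae_eq_Rintegral => //.
- by case: dL => m _; exact: measurable_funM.
- by have [m _] := vs.1; exact: measurable_funM.
move: j0 k0; apply: filterS2 => x h1 h2 Ox.
have [a1 a2] := h1 Ox; have [b1 b2] := h2 Ox.
rewrite [RHS]mulr0; have -> : jet_entry (j - k) o x = jet_entry j o x - jet_entry k o x by case: o {dL}.
by case: o {dL} => [l|] /=; rewrite ?a2 ?b2 ?a1 ?b1 subrr mulr0.
Qed.

End instantiation.

Theorem lemma4p3 (R : realType) (n : nat) (hn : n.+1 = 2%N \/ n.+1 = 3%N)
  (D : geometry R n) (hD : geometry_ok D)
  (c : coefficients R n) (hc : coefficients_ok D c)
  (T : R) (hT : 0 < T)
  (dat : problem_data R n) (hdat : data_ok D T dat)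
  (H : discretization R n) (hH : discretization_ok D c H)
  (mp mth : R -> scalar_fun R n)
  (hmp : admissible D T (mp_a dat) (mp_b dat) mp)
  (hmth : admissible D T (mth_a dat) (mth_b dat) mth)
  (u du : R -> vjet R n) (p th : R -> jet R n) (dp dth : R -> scalar_fun R n)
  (hstate : is_state D c T dat mp mth u du p dp th dth)
  (w dw : R -> vjet R n) (r dr ph dph : R -> jet R n)
  (hadj : is_adjoint D c T dat u p th w dw r (fun t => (dr t).1)
            ph (fun t => (dph t).1))
  (s : R) (hs : 0 < s <= 1)
  (hw : vH1_time T (Om D) (H1_0 (Om D) (Gam_d D)) s w dw)
  (hr : H1_time T (Om D) (spQ D) s r dr)
  (hph : H1_time T (Om D) (spPsi D) s ph dph)
  (Cini : R) (hCini : 0 < Cini) :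
  (exists2 C : R, 0 < C &
    forall (i : fam H) (N : nat), (0 < N)%N ->
    forall (uh : nat -> vjet R n) (pd thd : nat -> jet R n),
      is_discrete_state D c T dat i N s Cini mp mth uh pd thd ->
    forall (wh : nat -> vjet R n) (rh phh : nat -> jet R n),
      is_discrete_adjoint D c T dat i N uh pd thd wh rh phh ->
      adjoint_error D T N r ph rh phh
        <= C * (hsz i `^ s + tau T N + state_error D T N u p th uh pd thd))
  /\
  (forall C1 : R, 0 < C1 -> exists2 C2 : R, 0 < C2 &
    forall (i : fam H) (N : nat), (0 < N)%N ->
    forall (uh : nat -> vjet R n) (pd thd : nat -> jet R n),
      is_discrete_state D c T dat i N s Cini mp mth uh pd thd ->
    forall (wh : nat -> vjet R n) (rh phh : nat -> jet R n),
      is_discrete_adjoint D c T dat i N uh pd thd wh rh phh ->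
      state_error D T N u p th uh pd thd <= C1 * (hsz i `^ s + tau T N) ->
      adjoint_error D T N r ph rh phh <= C2 * (hsz i `^ s + tau T N)).
Proof.
have [[_ oO _ _] _ _ _ _] := hD.
have mO : measurable (Om D) by exact: open_measurable_rV.
have s01 : 0 <= s <= 1 by case/andP: hs => s0 ->; rewrite ltW.
have [su _ _ _ _] := hstate; have [suv [spp _ _] [sth _ _]] := su.
have [_ adj1 adj2 adj3 [wT rT phT]] := hadj.
have [_ _ [uCT pCT thCT] [au0 ap0 ath0 _] _] := hdat.
have [hrt hdrt hrX hrd] := hr; have [hpt hdpt hpX hpd] := hph.
pose z t := Fields (w t) (r t) (ph t); pose dz t := Fields (dw t) (dr t) (dph t).
pose U t := values_of (vval (u t)) (p t).1 (th t).1.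
pose G t := values_of (u_C dat t) (p_C dat t) (th_C dat t).
have zV t : 0 <= t <= T -> trial_fields D (z t).
  move=> tT; split; [|exact: hrX|exact: hpX].
  by move=> l; have [_ _ h _] := hw l; exact: h.
have zT j : L2L2 T (Om D) (fun t => entry (z t) j).
  case: j => -[l|[]] o; last exact: (L2_time_L2L2 mO o hrt).
    by have [h _ _ _] := hw l; exact: (L2_time_L2L2 mO o h).
  exact: (L2_time_L2L2 mO o hpt).
have dzT j : L2L2 T (Om D) (fun t => entry (dz t) j).
  case: j => -[l|[]] o; last exact: (L2_time_L2L2 mO o hdrt).
    by have [_ h _ _] := hw l; exact: (L2_time_L2L2 mO o h).
  exact: (L2_time_L2L2 mO o hdpt).
have zdz j : time_deriv T (Om D) (fun t => entry (z t) j) (fun t => entry (dz t) j).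
  case: j => -[l|[]] o; last exact: (jet_time_deriv_entry o hrd).
    by have [_ _ _ h] := hw l; exact: (jet_time_deriv_entry o h).
  exact: (jet_time_deriv_entry o hpd).
have wt l : L2_time T (Om D) (H1_0 (Om D) (Gam_d D)) s (fun t => w t l) by case: (hw l).
have [mreg ireg] := regularity_integral wt hrt hpt.
have UT j : L2L2 T (Om D) (U ^~ j).
  case: j => [l|[]]; last exact: (L2_time_L2L2 mO None spp).
    by have [h _ _ _] := suv l; exact: (L2_time_L2L2 mO None h).
  exact: (L2_time_L2L2 mO None sth).
have GT j : L2L2 T (Om D) (G ^~ j) by case: j => [l|[]]; [exact: uCT|exact: thCT|exact: pCT].
have UGT j : L2L2 T (Om D) (fun t x => U t j x - G t j x) by exact: (L2L2B mO (UT j) (GT j)).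
have FF : Filter (nbhs (almost_everywhere (@lebesgue_measure R))) by exact: ae_filter_ringOfSetsType.
have mT : measurable (`[0, T]%classic : set (measurableTypeR R)) by exact: measurable_itv.
have UGae := @filter_forall _ _
  (fun j t => `[0, T]%classic t -> L2 (Om D) (fun x => U t j x - G t j x)) _ FF
  (fun j => sqint_sections mT mO (UGT j)).
have trialL (y : fields R n) : trial_fields D y -> L2fields (Om D) y.
  by move=> [h1 h2 h3]; exact: spaces_L2fields.
(* first equation minus the two others, at almost every time *)
have eqn : aet T (fun t => forall y, trial_fields D y ->
  - evolution_form D c (dz t) y + diffusion_form D c (z t) y =
  pairing (Om D) (fun t j x => U t j x - G t j x) (loads (al_uC dat) (al_pC dat) (al_thC dat) y) t).
  have := @filterI _ _ FF _ _ adj1 (@filterI _ _ FF _ _ adj2 (@filterI _ _ FF _ _ adj3 UGae)).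
  apply: (@filterS _ _ FF) => t [h1 [h2 [h3 h4]]] tT y hy.
  have [y1 y2 y3] := hy.
  have e1 := h1 tT _ y1; have e2 := h2 tT _ y2; have e3 := h3 tT _ y3.
  have -> : pairing (Om D) (fun t j x => U t j x - G t j x) (loads (al_uC dat) (al_pC dat) (al_thC dat) y) t =
    \sum_j ip (Om D) (values_of (vval (u t) - u_C dat t) ((p t).1 - p_C dat t) ((th t).1 - th_C dat t) j)
       (loads (al_uC dat) (al_pC dat) (al_thC dat) y j).
    by apply: eq_bigr => -[l|[]].
  rewrite pairing_loads//; first by rewrite -e1 -e2 -e3 /evolution_form /diffusion_form/=; ring.
  - by move=> l; exact: (h4 (inl l) tT).
  - exact: (h4 (inr false) tT).
  - exact: (h4 (inr true) tT).
  - exact: trialL.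
have [Cs Cs0 stab] := stability mO hc hH.
have [_ _ [Bm Bm0 Mbd]] := evolution_bilinear mO hc.
have [_ _ [Bk Bk0 Kbd]] := diffusion_bilinear c mO.
have [Cp Cp0 proj] := elliptic_projection mO hc hH s01.
set EC := error_const D T s z dz (al_uC dat) (al_pC dat) (al_thC dat) Cs Bm Bk Cp.
have part1 : exists2 C : R, 0 < C &
    forall (i : fam H) (N : nat), (0 < N)%N ->
    forall (uh : nat -> vjet R n) (pd thd : nat -> jet R n),
      is_discrete_state D c T dat i N s Cini mp mth uh pd thd ->
    forall (wh : nat -> vjet R n) (rh phh : nat -> jet R n),
      is_discrete_adjoint D c T dat i N uh pd thd wh rh phh ->
      adjoint_error D T N r ph rh phh
        <= C * (hsz i `^ s + tau T N + state_error D T N u p th uh pd thd).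
  (* the two scalar errors are each at most the square root of the constant
     times the right-hand side; adding 1 makes the constant positive *)
  exists (2 * Num.sqrt `|EC| + 1) => [|i N N0 uh pd thd hst wh rh phh hdadj].
    by rewrite ltr_wpDl// mulr_ge0// sqrtr_ge0.
  have [stin _ _ _ _] := hst.
  have [adin [wN rN phN] d1 d2 d3] := hdadj.
  have tau0 := tau_gt0 hT N0.
  pose zh k := Fields (wh k) (rh k) (phh k).
  pose Uh k := values_of (vval (uh k.+1)) (pd k.+1).1 (thd k.+1).1.
  have hz k : (k <= N)%N -> discrete_fields i (zh k) by move=> /adin.
  have hU k : (k < N)%N -> forall j, L2 (Om D) (Uh k j).
    move=> kN j; have [q1 q2 q3] := stin _ kN.
    case: j => [l|[]].
    - exact: (H1_0_L2 None ((Vh_spV hH q1) l)).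
    - exact: (H1_0_L2 None (Psih_spPsi hH q3)).
    - exact: (H1_0_L2 None (Qh_spQ hH q2)).
  have zhL k : (k <= N)%N -> L2fields (Om D) (zh k) by move=> kN; exact: (discrete_fields_L2 hH (hz k kN)).
  have zTL : L2fields (Om D) (z T) by apply: trialL; apply: zV; rewrite lexx ltW.
  have hN : nsq (Om D) (@weak_slot n) (zh N - z T) = 0.
    apply: big1 => -[[l|[]] o] _.
    - exact: (jet_ae_eq0_ip mO o (fun o => zhL N (leqnn N) (inl l, o)) (fun o => zTL (inl l, o)) (wN l) (wT l)).
    - exact: (jet_ae_eq0_ip mO o (fun o => zhL N (leqnn N) (inr true, o)) (fun o => zTL (inr true, o)) phN phT).
    - exact: (jet_ae_eq0_ip mO o (fun o => zhL N (leqnn N) (inr false, o)) (fun o => zTL (inr false, o)) rN rT).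
  (* the discrete equations, combined and multiplied by the time step *)
  have hstep k : (k < N)%N -> forall y, discrete_fields i y ->
    evolution_form D c (zh k) y - evolution_form D c (zh k.+1) y + tau T N * diffusion_form D c (zh k) y =
    \sum_j \int[(@lebesgue_measure R \x leb R n.+1)%E]_(x in Ik T N k `*` Om D)
      ((Uh k j x.2 - G x.1 j x.2) * loads (al_uC dat) (al_pC dat) (al_thC dat) y j x.2).
    move=> kN y hy; have [y1 y2 y3] := hy; have yL := discrete_fields_L2 hH hy.
    have e1 := d1 k kN _ y1; have e2 := d2 k kN _ y2; have e3 := d3 k kN _ y3.
    have mI : measurable (Ik T N k : set (measurableTypeR R)) by exact: measurable_itv.
    have mIO : measurable (Ik T N k `*` Om D : set (measurableTypeR R * 'rV[R]_n.+1)) by exact: measurableX.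
    have Ifin : (@lebesgue_measure R (Ik T N k) < +oo)%E by rewrite itv_measure ?knotS// ltry.
    have L2s := L2fields_subspace mO.
    have Ml := L2_bilinear_linl mO (evolution_bilinear mO hc) yL.
    have dL := subspaceB L2s (zhL _ kN) (zhL _ (ltnW kN)).
    have := linear_onZ L2s Ml (tau T N)^-1 dL.
    rewrite (linear_onB Ml (zhL _ kN) (zhL _ (ltnW kN))).
    set zd := (tau T N)^-1 *: (zh k.+1 - zh k) => ed.
    have es : - evolution_form D c zd y + diffusion_form D c (zh k) y =
       al_uC dat / tau T N * vipk D T N k (fun t => vval (uh k.+1) - u_C dat t) (vval (displacement y))
       - al_pC dat / tau T N * ipk D T N k (fun t => (pd k.+1).1 - p_C dat t) (pressure y).1
       - al_thC dat / tau T N * ipk D T N k (fun t => (thd k.+1).1 - th_C dat t) (temperature y).1.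
      by rewrite -e1 -e2 -e3 /evolution_form /diffusion_form/=; ring.
    have vL j : L2 (Om D) (value y j) by exact: (yL (j, None)).
    have DL j := sqint_Ik_diff hT N0 mO kN (hU k kN j) (GT j).
    have lI j := (sqint_const_time mI mO Ifin (vL j)).1.
    have pull wgt j : \int[(@lebesgue_measure R \x leb R n.+1)%E]_(x in Ik T N k `*` Om D)
        ((Uh k j x.2 - G x.1 j x.2) * (wgt * value y j x.2)) =
        wgt * \int[(@lebesgue_measure R \x leb R n.+1)%E]_(x in Ik T N k `*` Om D)
        ((Uh k j x.2 - G x.1 j x.2) * value y j x.2).
      rewrite -RintegralZl//; last exact: (sqint_integrable mIO (DL j) (lI j)).
      by apply: eq_Rintegral => x _; ring.
    rewrite sum_index /loads !pull.
    rewrite (eq_bigr (fun l => al_uC dat * \int[(@lebesgue_measure R \x leb R n.+1)%E]_(x in Ik T N k `*` Om D)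
        ((Uh k (inl l) x.2 - G x.1 (inl l) x.2) * value y (inl l) x.2))); last by move=> l _; exact: pull.
    rewrite -mulr_sumr -(Rintegral_sum mIO (fun l => sqint_integrable mIO (DL (inl l)) (lI (inl l)))).
    rewrite ed in es.
    rewrite -[X in al_uC dat * X]/(vipk D T N k (fun t => vval (uh k.+1) - u_C dat t) (vval (displacement y))).
    rewrite -[X in - al_pC dat * X]/(ipk D T N k (fun t => (pd k.+1).1 - p_C dat t) (pressure y).1).
    rewrite -[X in - al_thC dat * X]/(ipk D T N k (fun t => (thd k.+1).1 - th_C dat t) (temperature y).1).
    have := congr1 (fun x => tau T N * x) es.
    set A := evolution_form D c (zh k) y; set B := evolution_form D c (zh k.+1) y.
    have t0 : tau T N != 0 by rewrite gt_eqF.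
    rewrite mulrDr mulrN mulrA mulfV// mul1r => e4.
    transitivity (- (B - A) + tau T N * diffusion_form D c (zh k) y); first by ring.
    by rewrite e4; field.
  have key (j : bool) := scheme_error mO hc hH hT zV zT dzT zdz mreg ireg UT GT eqn
    N0 hz hU hN hstep Cs0 Bm0 Bk0 Cp0 (stab i) Mbd Kbd (proj i) j.
  set SE := state_error _ _ _ _ _ _ _ _ _.
  have SE0 : 0 <= SE by rewrite /SE /state_error !addr_ge0// sqrtr_ge0.
  have Sq : \sum_j L2L2_dist T (Om D) (pw_const T N (fun k => Uh k j)) (U ^~ j) ^+ 2 <= SE ^+ 2.
    rewrite sum_index -(vL2L2_dist_sq mO (f := fun t l => pw_const T N (fun k => Uh k (inl l)) t) (g := fun t l => U t (inl l))).
    - rewrite /SE /state_error.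
      set d1' := vL2L2_dist _ _ _ _; set d2' := L2L2_dist _ _ _ _; set d3' := L2L2_dist _ _ _ _.
      have q1 : 0 <= d1' by exact: sqrtr_ge0.
      have q2 : 0 <= d2' by exact: sqrtr_ge0.
      have q3 : 0 <= d3' by exact: sqrtr_ge0.
      have := mulr_ge0 q1 q2; have := mulr_ge0 q1 q3; have := mulr_ge0 q2 q3.
      lra.
    - by move=> l; exact: (pw_const_L2L2 T mO (fun k kN => hU k kN (inl l))).
    - by move=> l; exact: UT.
  have h0 : 0 <= hsz i `^ s by exact: powR_ge0.
  have X0 : 0 <= hsz i `^ s + tau T N + SE by exact: (addr_ge0 (addr_ge0 h0 (ltW tau0)) SE0).
  have bound (j : bool) : L2L2_dist T (Om D) (pw_const T N (fun k => value (zh k) (inr j)))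
     (fun t => value (z t) (inr j)) <= Num.sqrt `|EC| * (hsz i `^ s + tau T N + SE).
    rewrite -ler_sqr ?nnegrE ?sqrtr_ge0//; last by rewrite mulr_ge0// sqrtr_ge0.
    apply: le_trans (key j) _; rewrite [leRHS]exprMn (sqr_sqrtr (normr_ge0 EC)) -/EC.
    set Y := _ + _ + _; have Y0 : 0 <= Y.
      by apply: addr_ge0; [rewrite addr_ge0 ?sqr_ge0|apply: sumr_ge0 => l _; exact: sqr_ge0].
    apply: (@le_trans _ _ (`|EC| * Y)); first by rewrite ler_wpM2r// ler_norm.
    rewrite ler_wpM2l// /Y.
    have := mulr_ge0 h0 (ltW tau0); have := mulr_ge0 h0 SE0; have := mulr_ge0 (ltW tau0) SE0.
    move: Sq; lra.
  rewrite /adjoint_error.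
  have := bound false; have := bound true; rewrite mulrDl mul1r -mulrA; lra.
split=> // C1 C10; have [C C0 h] := part1.
exists (C * (1 + C1)) => [|i N N0 uh pd thd hst wh rh phh hdadj hse].
  by rewrite mulr_gt0// addr_gt0.
apply: le_trans (h i N N0 uh pd thd hst wh rh phh hdadj) _.
rewrite -mulrA ler_pM2l// mulrDl mul1r.
exact: lerD.
Qed.
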